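(* Let $k \in \mathbb{N}$ and let $\mathbb{A}$ be an affine subspace of $\mathbb{Q}^k$. Then $\mathbb{A} \cap A^k \neq \emptyset$ for every WM set $A \subset \mathbb{N}$ if and only if $\mathbb{A}$ contains a set of the form $$\{ n\vec{a} + m\vec{b} + \vec{f} \mid n,m \in \mathbb{N} \},$$ where $\vec{a} = (a_1,\ldots,a_k)^t \in \mathbb{N}^k$, $\vec{b} = (b_1,\ldots,b_k)^t \in \mathbb{N}^k$, $\vec{f} = (f_1,\ldots,f_k)^t \in \mathbb{Z}^k$, and there exists a partition $F_1,\ldots,F_l$ of $\{1,2,\ldots,k\}$ such that: (a) for every $r \in \{1,\ldots,l\}$ there exist $c_{1,r}, c_{2,r} \in \mathbb{N}$ such that for every $i \in F_r$ we have $a_i = c_{1,r}$ and $b_i = c_{2,r}$, and for every $j \in \{1,\ldots,k\} \setminus F_r$ we have $$\det \begin{pmatrix} a_j & b_j \\ c_{1,r} & c_{2,r} \end{pmatrix} \neq 0;$$ (b) for every $r \in \{1,\ldots,l\}$ there exists $c_r \in \mathbb{Z}$ such that $f_i = c_r$ for every $i \in F_r$.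
   Context: $\mathbb{N}$ denotes the positive integers and $\mathbb{N}_0 = \mathbb{N} \cup \{0\}$. Let $\Omega = \{0,1\}^{\mathbb{N}_0}$ with the product topology and the continuous shift $T:\Omega \to \Omega$, $(T\omega)_n = \omega_{n+1}$. For $\xi \in \Omega$ let $X_\xi = \overline{\{T^n \xi : n \in \mathbb{N}_0\}} \subset \Omega$. A measure preserving system $(X,\mathbb{B},\mu,T)$ consists of a compact metric space $X$, its Borel $\sigma$-algebra $\mathbb{B}$, a continuous map $T: X \to X$ and a $T$-invariant probability measure $\mu$ on $\mathbb{B}$. It is ergodic if every $B \in \mathbb{B}$ with $T^{-1}B = B$ has $\mu(B) \in \{0,1\}$; it is weakly mixing if $(X \times X, \mathbb{B}_{X\times X}, \mu\times\mu, T \times T)$ is ergodic. A point $\xi \in X$ is generic for $(X,\mathbb{B},\mu,T)$ if $\lim_{N\to\infty} \frac1N \sum_{n=0}^{N-1} f(T^n \xi) = \int_X f\, d\mu$ for every continuous $f$ on $X$. The density of $S \subset \mathbb{N}$ is $d(S) = \lim_{N\to\infty} \frac1N \sum_{n=1}^N 1_S(n)$, when the limit exists. A set $S \subset \mathbb{N}$ is a WM set if there is a measure $\mu$ such that $1_S \in \{0,1\}^{\mathbb{N}_0}$ is a generic point of the weakly mixing system $(X_{1_S},\mathbb{B},\mu,T)$, and $d(S) > 0$. An affine subspace of $\mathbb{Q}^k$ is a translate of a $\mathbb{Q}$-linear subspace. *)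

(* Defs.v *)
From HB Require Import structures.
From mathcomp Require Import all_boot all_order all_algebra.
From mathcomp Require Import all_classical all_reals all_analysis.

Set Implicit Arguments.
Unset Strict Implicit.
Unset Printing Implicit Defensive.

Import Order.TTheory GRing.Theory Num.Theory.
Import numFieldNormedType.Exports.

Local Open Scope classical_set_scope.
Local Open Scope ring_scope.

Notation borel X := (g_sigma_algebraType (@open X)).

Definition measure_preserving (d : measure_display) (X : measurableType d)
    (R : realType) (mu : set X -> \bar R) (T : X -> X) : Prop :=
  forall B : set X, measurable B -> mu (T @^-1` B) = mu B.

Definition ergodic (d : measure_display) (X : measurableType d)
    (R : realType) (mu : set X -> \bar R) (T : X -> X) : Prop :=
  forall B : set X, measurable B -> T @^-1` B = B ->
    mu B = 0%E \/ mu B = 1%E.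

(* The product carries the product sigma-algebra, which for the Borel sets of
   a compact metric space is the Borel sigma-algebra of the square. *)
Definition weakly_mixing (d : measure_display) (X : measurableType d)
    (R : realType) (mu : set X -> \bar R) (T : X -> X) : Prop :=
  ergodic (mu \x mu)%E (fun p : X * X => (T p.1, T p.2)).

Definition generic (R : realType) (X : ptopologicalType)
    (mu : probability (borel X) R) (T : X -> X) (xi : X) : Prop :=
  forall f : X -> R, continuous f ->
    N%:R^-1 * \sum_(0 <= n < N) f (iter n T xi) @[N --> \oo] -->
      \int[mu]_x f x.

Definition shift (w : cantor_space) : cantor_space := fun n => w n.+1.

Definition orbit_closure_set (xi : cantor_space) : set cantor_space :=
  closure [set iter n shift xi | n in [set: nat]].

Definition orbit_closure (xi : cantor_space) : Type :=
  set_type (orbit_closure_set xi).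

Lemma orbit_closure_set_self (xi : cantor_space) :
  xi \in orbit_closure_set xi.
Proof. by apply/mem_set/subset_closure; exists 0%N. Qed.

Definition orbit_base (xi : cantor_space) : orbit_closure xi :=
  exist _ xi (orbit_closure_set_self xi).

HB.instance Definition _ (xi : cantor_space) :=
  Topological.on (orbit_closure xi).
HB.instance Definition _ (xi : cantor_space) :=
  isPointed.Build (orbit_closure xi) (orbit_base xi).

Lemma shift_continuous : continuous shift.
Proof.
move=> w; apply/cvg_sup => i U [V [[W oW <-] Ww WU]].
have Wnbhs : nbhs (proj i.+1 w) W by apply: open_nbhs_nbhs; split.
have := @proj_continuous nat (fun=> bool) i.+1 w W Wnbhs.
rewrite !nbhs_simpl /=; apply: (@filterS _ (nbhs w)) => x Wx; exact: WU.
Qed.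

Lemma orbit_closure_set_shift (xi w : cantor_space) :
  w \in orbit_closure_set xi -> shift w \in orbit_closure_set xi.
Proof.
move=> /set_mem cw; apply/mem_set => B /shift_continuous/cw [_ [[n _ <-] Bn]].
by exists (iter n.+1 shift xi); split => //; exists n.+1.
Qed.

Definition orbit_shift (xi : cantor_space) (w : orbit_closure xi) :
    orbit_closure xi :=
  exist _ (shift (val w)) (orbit_closure_set_shift (valP w)).

Lemma orbit_shift_continuous (xi : cantor_space) :
  continuous (@orbit_shift xi).
Proof.
apply: (@continuous_comp_initial _ _ _ set_val) => w.
apply: (@continuous_comp _ _ _ set_val shift); first exact: initial_continuous.
exact: shift_continuous.
Qed.

Lemma orbit_closure_compact (xi : cantor_space) :
  compact [set: orbit_closure xi].
Proof.
have cO : compact (orbit_closure_set xi).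
  exact: (subclosed_compact (@closed_closure _ _) cantor_space_compact).
move=> F FF _.
pose incl (w : orbit_closure xi) : cantor_space := val w.
have [|x [Ox clx]] := cO (incl @ F) _.
  apply: (@filterS _ F _ setT) => [w _|]; last exact: filterT.
  exact: (set_mem (valP w)).
exists (exist _ x (mem_set Ox)); split=> // A B FA [V [[W oW <-] Wx WB]].
have [_ [[w Aw <-] Ww]] : (incl @` A) `&` W !=set0.
  apply: clx; last by apply: open_nbhs_nbhs; split.
  by apply: (@filterS _ F _ A) => // w Aw; exists w.
by exists w; split=> //; exact: WB.
Qed.

Lemma orbit_closure_hausdorff (xi : cantor_space) :
  hausdorff_space (orbit_closure xi).
Proof.
move=> v w vw; apply: val_inj; apply: cantor_space_hausdorff => A B nA nB.
have val_cont := @initial_continuous (orbit_closure xi) _ set_val.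
by have [z [Az Bz]] := vw _ _ (val_cont _ _ nA) (val_cont _ _ nB); exists (val z).
Qed.

Definition char_seq (S : set nat) : cantor_space := fun n => `[< S n >].

Definition has_density (R : realType) (S : set nat) (d : R) : Prop :=
  N%:R^-1 * \sum_(1 <= n < N.+1) (\1_S n : R) @[N --> \oo] --> d.

(* The positive integers are encoded as the nonzero elements of [nat]. The
   system lives on the orbit closure itself with its subspace topology; being
   closed in the Cantor space it is automatically compact and metrizable, and
   the shift is continuous on it, so no separate clause is needed. *)
Definition WM_set (R : realType) (S : set nat) : Prop :=
  [/\ S `<=` [set n | (0 < n)%N],
      exists mu : probability (borel (orbit_closure (char_seq S))) R,
        [/\ measure_preserving mu (@orbit_shift (char_seq S)),
            weakly_mixing mu (@orbit_shift (char_seq S)) &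
            generic mu (@orbit_shift (char_seq S)) (orbit_base (char_seq S))] &
      exists2 d : R, has_density S d & 0 < d].

Definition affine_subspace (k : nat) (A : set 'cV[rat]_k) : Prop :=
  exists (p : 'cV[rat]_k) (U : {vspace 'cV[rat]_k}),
    A = [set p + u | u in [set` U]].

Definition cartesian_power (k : nat) (S : set nat) : set 'cV[rat]_k :=
  [set x | forall i, exists2 n, S n & x i 0 = n%:R].

Arguments cartesian_power : clear implicits.

Definition two_parameter_set (k : nat) (a b : 'cV[nat]_k) (f : 'cV[int]_k) :
    set 'cV[rat]_k :=
  [set x | exists n m : nat, [/\ (0 < n)%N, (0 < m)%N &
     x = n%:R *: map_mx (fun z : nat => z%:R) a
         + m%:R *: map_mx (fun z : nat => z%:R) b
         + map_mx intr f]].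

Definition mx22 (T : nzRingType) (x y z t : T) : 'M[T]_(1 + 1) :=
  block_mx x%:M y%:M z%:M t%:M.

Definition directions_compatible (k : nat) (a b : 'cV[nat]_k)
    (P : {set {set 'I_k}}) : Prop :=
  forall F : {set 'I_k}, F \in P -> exists c1 c2 : nat,
    [/\ (0 < c1)%N, (0 < c2)%N,
        forall i, i \in F -> a i 0 = c1 /\ b i 0 = c2 &
        forall j, j \notin F ->
          \det (mx22 (a j 0)%:Z (b j 0)%:Z c1%:Z c2%:Z) != 0].

Definition translation_compatible (k : nat) (f : 'cV[int]_k)
    (P : {set {set 'I_k}}) : Prop :=
  forall F : {set 'I_k}, F \in P -> exists c : int,
    forall i, i \in F -> f i 0 = c.

(* Main.v *)
(* Sufficiency: weak mixing makes the autocorrelations of [1_A - d(A)] tend to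
   zero in mean along every arithmetic progression, so two-parameter van der
   Corput shows that the average of the product over [F] in [P] of
   [1_A (c1 F * n + c2 F * m + c F)] is [d(A) ^ #|P|]: the linear forms are
   pairwise independent by the determinant condition.

   Necessity: for finitely many relations [y = q x + s] with [q > 0] and
   [(q, s) <> (1, 0)] there is a WM set none of whose pairs satisfies any of
   them.  Let each pair [(x, q x + s)], [q <> 1], carry a random bit whose two
   endpoints demand opposite values, keep the [n] whose demands are all met, and
   thin out to kill the translations [q = 1]; the result is a finite coding of a
   Bernoulli sequence.  Now avoid the relations forced between two coordinates by
   [AA] together with any set of coordinate equalities.  A point [x] of [AA] in
   the power of such a set has coordinates larger than those of a base point, so
   [x] minus the base point is a positive direction; as no relation is forced
   between distinct values of [x], a generic perturbation of this direction gives
   a second one, independent of it on any two blocks of equal coordinates. *)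

Require Import Defs.
From HB Require Import structures.
From mathcomp Require Import all_boot all_order all_algebra.
From mathcomp Require Import all_classical all_reals all_analysis.
From mathcomp Require Import measurable_realfun.
From mathcomp Require Import zify ring lra.

Set Implicit Arguments.
Unset Strict Implicit.
Unset Printing Implicit Defensive.

Import Order.TTheory GRing.Theory Num.Theory.
Import numFieldNormedType.Exports.

Local Open Scope classical_set_scope.
Local Open Scope ring_scope.

(** * Averages and van der Corput's inequality *)

Section averages.
Variable R : realType.
Implicit Types (u v : nat -> R) (F : nat -> nat -> R) (N : nat).

(** No probability space of random sequences is used. For necessity, one deterministic bit sequence
    must show all the frequencies of a Bernoulli sequence although its bits are read through edges
    that the shift does not preserve. It comes from a second-moment bound on finite cubes and
    compactness of the Cantor space. Independence survives because an edge with [q <> 1] joins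
    positions whose distance grows: a bounded window far out never reads a bit twice, and
    frequencies see only bounded windows. Translations violate exactly this, hence the separate
    thinning, after which windows are independent only across a gap. The measure is not transported
    from a Bernoulli shift but extends the cylinder frequencies of the sequence itself, so
    genericity is built in and weak mixing is read off the gap independence. For sufficiency, van
    der Corput replaces each factor by a product of two of its shifts, different for each form; the
    induction therefore runs over an algebra of sequences, not over [1_A - d(A)] alone. The WM set
    has to be fixed before its solution is known, so every possible set of coordinate equalities is
    provided for in advance. *)

Definition avg u N : R := N%:R^-1 * \sum_(0 <= n < N) u n.

Definition avg2 F N : R := avg (fun n => avg (F n) N) N.

Definition has_mean u (m : R) := avg u N @[N --> \oo] --> m.

Lemma eq_avg u v N : (forall n, (n < N)%N -> u n = v n) -> avg u N = avg v N.
Proof.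
by move=> uv; congr (_ * _); apply: eq_big_nat => n /andP[_]; exact: uv.
Qed.

Lemma avgD u v N : avg (fun n => u n + v n) N = avg u N + avg v N.
Proof. by rewrite /avg big_split mulrDr. Qed.

Lemma avgZ (a : R) u N : avg (fun n => a * u n) N = a * avg u N.
Proof. by rewrite /avg -mulr_sumr mulrCA. Qed.

Lemma avgZr (a : R) u N : avg (fun n => u n * a) N = avg u N * a.
Proof. by rewrite mulrC -avgZ; apply: eq_avg => n _; rewrite mulrC. Qed.

Lemma avgB u v N : avg (fun n => u n - v n) N = avg u N - avg v N.
Proof. by rewrite /avg sumrB mulrBr. Qed.

Lemma avg_cst (a : R) N : (0 < N)%N -> avg (fun=> a) N = a.
Proof.
move=> N0; rewrite /avg big_const_nat subn0 iter_addr_0 -[a *+ N]mulr_natl mulKf//.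
by rewrite pnatr_eq0 -lt0n.
Qed.

Lemma le_avg u v N : (forall n, (n < N)%N -> u n <= v n) -> avg u N <= avg v N.
Proof.
move=> uv; rewrite ler_wpM2l ?invr_ge0// big_nat [leRHS]big_nat.
by apply: ler_sum => n /andP[_]; exact: uv.
Qed.

Lemma avg_ge0 u N : (forall n, 0 <= u n) -> 0 <= avg u N.
Proof. by move=> u0; rewrite mulr_ge0 ?invr_ge0// sumr_ge0. Qed.

Lemma ler_norm_avg u N : `|avg u N| <= avg (fun n => `|u n|) N.
Proof. by rewrite normrM ger0_norm ?invr_ge0// ler_wpM2l ?invr_ge0// ler_norm_sum. Qed.

Lemma avg_bound u (C : R) N : 0 <= C -> (forall n, `|u n| <= C) -> `|avg u N| <= C.
Proof.
move=> C0 uC; case: N => [|N].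
  by rewrite /avg big_geq// mulr0 normr0.
apply: (le_trans (ler_norm_avg _ _)); rewrite -[leRHS](@avg_cst C N.+1)//.
by apply: le_avg.
Qed.

Lemma exchange_avg F N M :
  avg (fun n => avg (F n) M) N = avg (fun m => avg (F ^~ m) N) M.
Proof.
rewrite /avg -!mulr_sumr mulrCA exchange_big/=; congr (_ * _).
Qed.

Lemma sqr_avg_le u N : avg u N ^+ 2 <= avg (fun n => u n ^+ 2) N.
Proof.
case: N => [|N]; first by rewrite /avg !big_geq// !mulr0 expr0n.
set a := avg u N.+1.
have : 0 <= avg (fun n => (u n - a) ^+ 2) N.+1 by apply: avg_ge0 => n; exact: sqr_ge0.
rewrite (@eq_avg _ (fun n => (u n ^+ 2 + (- 2 * a) * u n) + a ^+ 2)); last first.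
  by move=> n _; ring.
rewrite avgD avgD avgZ avg_cst// -/a => h; rewrite -subr_ge0.
by apply: le_trans h _; rewrite le_eqVlt; apply/orP; left; apply/eqP; ring.
Qed.

Lemma avg_shift u (C : R) N k : 0 <= C -> (forall n, `|u n| <= C) ->
  `|avg u N - avg (fun n => u (n + k)%N) N| <= (2 * k%:R * C) / N%:R.
Proof.
move=> C0 uC; rewrite /avg -mulrBr normrM ger0_norm ?invr_ge0// mulrC.
rewrite ler_wpM2r ?invr_ge0//.
have bnd a b : `|\sum_(a <= n < b) u n| <= (b - a)%:R * C.
  apply: (le_trans (ler_norm_sum _ _ _)).
  apply: le_trans (_ : \sum_(a <= n < b) C <= _); first exact: ler_sum.
  by rewrite big_const_nat iter_addr_0 mulr_natl.
have -> : \sum_(0 <= n < N) u (n + k)%N = \sum_(k <= n < N + k) u n.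
  by rewrite -{2}[k]add0n big_addn addnK.
have e1 : \sum_(0 <= n < N) u n + \sum_(N <= n < N + k) u n =
          \sum_(0 <= n < k) u n + \sum_(k <= n < N + k) u n.
  rewrite -!big_cat_nat//=; [exact: leq_addl|exact: leq_addr].
have -> : \sum_(0 <= n < N) u n - \sum_(k <= n < N + k) u n =
  \sum_(0 <= n < k) u n - \sum_(N <= n < N + k) u n.
  by apply/eqP; rewrite subr_eq addrAC eq_sym subr_eq -e1.
apply: le_trans (ler_normB _ _) _.
apply: le_trans (lerD (bnd _ _) (bnd _ _)) _.
by rewrite subn0 addKn -mulrDl -natrD addnn -mul2n natrM.
Qed.

Lemma cvg_divn (C : R) : C / N%:R @[N --> \oo] --> (0 : R).
Proof.
rewrite -[X in _ --> X](mulr0 C); apply: cvgM; first exact: cvg_cst.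
have := @cvg_harmonic R; rewrite -(cvg_shiftS (fun n => n%:R^-1 : R)).
by [].
Qed.

Lemma eq_has_mean u v m : u =1 v -> has_mean u m -> has_mean v m.
Proof. by move=> /funext ->. Qed.

Lemma has_mean_unique u m m' : has_mean u m -> has_mean u m' -> m = m'.
Proof. exact: (@cvg_unique R (@norm_hausdorff _ R)). Qed.

Lemma has_meanD u v a b : has_mean u a -> has_mean v b ->
  has_mean (fun n => u n + v n) (a + b).
Proof.
move=> ua vb; rewrite /has_mean; under eq_fun do rewrite avgD; exact: cvgD.
Qed.

Lemma has_meanZ (c : R) u a : has_mean u a -> has_mean (fun n => c * u n) (c * a).
Proof.
move=> ua; rewrite /has_mean; under eq_fun do rewrite avgZ.
by apply: cvgM => //; exact: cvg_cst.
Qed.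

Lemma has_mean_cst c : has_mean (fun=> c) c.
Proof.
rewrite /has_mean -(cvg_shiftS (avg (fun=> c))).
by under eq_fun do rewrite avg_cst//; exact: cvg_cst.
Qed.

Lemma has_meanB u v a b : has_mean u a -> has_mean v b ->
  has_mean (fun n => u n - v n) (a - b).
Proof.
move=> ua vb; rewrite /has_mean; under eq_fun do rewrite avgB; exact: cvgB.
Qed.

Lemma has_mean_shift u m (C : R) k : (forall n, `|u n| <= C) -> has_mean u m ->
  has_mean (fun n => u (n + k)%N) m.
Proof.
move=> uC um; have C0 : 0 <= C by exact: le_trans (normr_ge0 (u 0%N)) (uC _).
have h : avg u N - avg (fun n => u (n + k)%N) N @[N --> \oo] --> (0 : R).
  apply/norm_cvg0P; apply: squeeze_cvgr (cvg_cst 0) (@cvg_divn (2 * k%:R * C)).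
  by near=> N; rewrite normr_ge0 /=; exact: avg_shift.
have := cvgB um h; rewrite subr0 => hm.
suff e : avg (fun n => u (n + k)%N) =
    (fun N => avg u N - (avg u N - avg (fun n => u (n + k)%N) N)).
  by rewrite /has_mean e; exact: hm.
by apply/funext => N; rewrite subKr.
Unshelve. all: by end_near. Qed.

Lemma mean_bound u m (C : R) : has_mean u m -> (forall n, `|u n| <= C) -> `|m| <= C.
Proof.
move=> um uC; have C0 : 0 <= C by exact: le_trans (normr_ge0 (u 0%N)) (uC _).
have h : `|avg u N| @[N --> \oo] --> `|m| by exact: cvg_norm.
rewrite -(cvg_lim _ h)//.
apply: limr_le; first by apply/cvg_ex; exists `|m|.
by near=> N; exact: avg_bound.
Unshelve. all: by end_near. Qed.

Lemma mean_bounded_avg_ge0 u m : has_mean u m -> (forall n, 0 <= u n) -> 0 <= m.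
Proof.
move=> um u0; rewrite -(cvg_lim _ um)//.
apply: limr_ge; first by apply/cvg_ex; exists m.
by near=> N; exact: avg_ge0.
Unshelve. all: by end_near. Qed.

(** An iterated limit: [N] tends to infinity for fixed [H], then [H] does. Only positive [H] are
    asked for, an average over no terms carrying no information. *)
Lemma squeeze_sqr_cvg0 (x : nat -> R) (e : nat -> R) :
  (forall H, (0 < H)%N -> exists2 y : nat -> R,
    (forall N, x N ^+ 2 <= y N) & y N @[N --> \oo] --> e H) ->
  e H @[H --> \oo] --> (0 : R) -> x N @[N --> \oo] --> (0 : R).
Proof.
move=> xy e0; apply/cvgr0Pnorm_lt => eps eps0.
have e2 : 0 < eps ^+ 2 by rewrite exprn_gt0.
have [H /andP[H0 He]] : exists H, (0 < H)%N && (e H < eps ^+ 2).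
  apply: (@filter_ex _ \oo); near=> H; apply/andP; split.
    by near: H; exact: nbhs_infty_gt.
  by apply: le_lt_trans (ler_norm _) _; near: H; move/cvgr0Pnorm_lt : e0; exact.
have [y xley ye] := xy H H0; near=> N.
suff : `|x N| ^+ 2 < eps ^+ 2 by rewrite ltr_pXn2r ?nnegrE ?(ltW eps0).
rewrite real_normK ?num_real//; apply: le_lt_trans (xley N) _; near: N.
exact: (cvgr_lt _ ye).
Unshelve. all: by end_near. Qed.

Lemma avg2_shift F (C : R) N a b : 0 <= C -> (forall n m, `|F n m| <= C) ->
  `|avg2 F N - avg2 (fun n m => F (n + a)%N (m + b)%N) N| <=
    (2 * (a + b)%:R * C) / N%:R.
Proof.
move=> C0 FC.
have h1 : `|avg2 F N - avg2 (fun n m => F (n + a)%N m) N| <= (2 * a%:R * C) / N%:R.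
  by apply: (@avg_shift (fun n => avg (F n) N)) => // n; exact: avg_bound.
have h2 : `|avg2 (fun n m => F (n + a)%N m) N
          - avg2 (fun n m => F (n + a)%N (m + b)%N) N| <= (2 * b%:R * C) / N%:R.
  rewrite /avg2 -avgB; apply: avg_bound; first by rewrite !mulr_ge0 ?invr_ge0.
  by move=> n; exact: avg_shift.
have -> : 2 * (a + b)%:R * C / N%:R = 2 * a%:R * C / N%:R + 2 * b%:R * C / N%:R.
  by rewrite natrD; ring.
apply: (le_trans _ (lerD h1 h2)).
by apply: (le_trans _ (ler_normD _ _)); rewrite addrA subrK.
Qed.

Lemma eq_avg2 F G N : (forall n m, F n m = G n m) -> avg2 F N = avg2 G N.
Proof. by move=> FG; apply: eq_avg => n _; apply: eq_avg => m _; exact: FG. Qed.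

Lemma le_avg2 F G N : (forall n m, F n m <= G n m) -> avg2 F N <= avg2 G N.
Proof. by move=> FG; apply: le_avg => n _; apply: le_avg => m _; exact: FG. Qed.

Lemma avg2D F G N : avg2 (fun n m => F n m + G n m) N = avg2 F N + avg2 G N.
Proof. by rewrite /avg2 -avgD; apply: eq_avg => n _; rewrite avgD. Qed.

Lemma avg2Z (c : R) F N : avg2 (fun n m => c * F n m) N = c * avg2 F N.
Proof. by rewrite /avg2 -avgZ; apply: eq_avg => n _; rewrite avgZ. Qed.

Lemma sqr_avg2_le F N : avg2 F N ^+ 2 <= avg2 (fun n m => F n m ^+ 2) N.
Proof.
by apply: (le_trans (sqr_avg_le _ _)); apply: le_avg => n _; exact: sqr_avg_le.
Qed.

Lemma avg2_exchange (F : nat -> nat -> nat -> R) N H :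
  avg2 (fun n m => avg (fun h => F h n m) H) N = avg (fun h => avg2 (F h) N) H.
Proof.
rewrite /avg2 [RHS]exchange_avg; apply: eq_avg => n _.
by rewrite [RHS]exchange_avg.
Qed.

Lemma sqr_avg u N : avg u N ^+ 2 = avg2 (fun h h' => u h * u h') N.
Proof.
rewrite expr2 /avg2 -avgZr; apply: eq_avg => h _.
by rewrite -avgZ.
Qed.

Lemma cvg_sum_seq (I : Type) (s : seq I) (u : I -> nat -> R) (l : I -> R) :
  (forall i, u i N @[N --> \oo] --> l i) ->
  \sum_(i <- s) u i N @[N --> \oo] --> \sum_(i <- s) l i.
Proof.
move=> ul; elim: s => [|i s IH].
  by under eq_fun do rewrite big_nil; rewrite big_nil; exact: cvg_cst.
by under eq_fun do rewrite big_cons; rewrite big_cons; apply: cvgD.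
Qed.

Lemma cvg_avg (u : nat -> nat -> R) (l : nat -> R) H :
  (forall h, u h N @[N --> \oo] --> l h) ->
  avg (fun h => u h N) H @[N --> \oo] --> avg l H.
Proof.
move=> ul; apply: cvgM; first exact: cvg_cst.
exact: cvg_sum_seq.
Qed.

Lemma cvg_avg2 (u : nat -> nat -> nat -> R) (l : nat -> nat -> R) H :
  (forall h h', u h h' N @[N --> \oo] --> l h h') ->
  avg2 (fun h h' => u h h' N) H @[N --> \oo] --> avg2 l H.
Proof.
by move=> ul; apply: (@cvg_avg (fun h N => avg (fun h' => u h h' N) H)) => h;
  exact: cvg_avg.
Qed.

(* Van der Corput: [F] is averaged over the shifts [(a h, b h)], and the factor
   [w], common to all the shifted copies, is removed by Cauchy-Schwarz. *)
Lemma van_der_corput F (C D : R) (a b : nat -> nat -> nat)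
    (w : nat -> nat -> nat -> R) (G : nat -> nat -> nat -> nat -> R)
    (y : nat -> nat -> R) (e : nat -> R) :
  (forall n m, `|F n m| <= C) ->
  (forall H h n m, (h < H)%N ->
     F (n + a H h)%N (m + b H h)%N = w H n m * G H h n m) ->
  (forall H n m, `|w H n m| <= D) ->
  (forall H N, avg2 (fun n m => avg (fun h => G H h n m) H ^+ 2) N <= y H N) ->
  (forall H, y H N @[N --> \oo] --> e H) ->
  e H @[H --> \oo] --> (0 : R) ->
  avg2 F N @[N --> \oo] --> (0 : R).
Proof.
move=> FC FG wD Gy ye e0.
have C0 : 0 <= C by exact: le_trans (normr_ge0 _) (FC 0%N 0%N).
pose K H : R := avg (fun h => 2 * (a H h + b H h)%:R * C) H.
apply: (@squeeze_sqr_cvg0 _ (fun H => 2 * (D ^+ 2 * e H))); last first.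
  rewrite -[X in _ --> X](mulr0 2); apply: cvgM; first exact: cvg_cst.
  by rewrite -[X in _ --> X](mulr0 (D ^+ 2)); apply: cvgM => //; exact: cvg_cst.
move=> H H0.
pose z N := avg2 (fun n m => w H n m * avg (fun h => G H h n m) H) N.
have xz N : `|avg2 F N - z N| <= K H / N%:R.
  have -> : z N = avg (fun h => avg2 (fun n m => F (n + a H h)%N (m + b H h)%N) N) H.
    rewrite -avg2_exchange; apply: eq_avg2 => n m; rewrite -avgZ.
    by apply: eq_avg => h hH; rewrite FG.
  rewrite -[avg2 F N](@avg_cst _ H)// -avgB -avgZr.
  by apply: (le_trans (ler_norm_avg _ _)); apply: le_avg => h _; exact: avg2_shift.
have zG N : z N ^+ 2 <= D ^+ 2 * y H N.
  apply: (le_trans (sqr_avg2_le _ _)).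
  apply: (@le_trans _ _ (D ^+ 2 *
      avg2 (fun n m => avg (fun h => G H h n m) H ^+ 2) N)); last first.
    by rewrite ler_wpM2l ?sqr_ge0.
  rewrite -avg2Z; apply: le_avg2 => n m; rewrite exprMn.
  rewrite ler_wpM2r ?sqr_ge0// -[leLHS]real_normK ?num_real//.
  by rewrite lerXn2r ?nnegrE// (le_trans _ (wD H n m)).
exists (fun N => 2 * (K H / N%:R) ^+ 2 + 2 * (D ^+ 2 * y H N)).
  move=> N; have h1 : (avg2 F N - z N) ^+ 2 <= (K H / N%:R) ^+ 2.
    rewrite -[leLHS]real_normK ?num_real// lerXn2r ?nnegrE//.
    exact: le_trans (xz N).
  have h2 := zG N.
  (* With [x] the average, [2 (x - z)^2 + 2 z^2 - x^2 = (x - 2 z)^2]. *)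
  have : 0 <= (avg2 F N - 2 * z N) ^+ 2 by exact: sqr_ge0.
  move: h1 h2; set u1 := (K H / _) ^+ 2; set u2 := D ^+ 2 * _ => h1 h2 h3.
  apply: (@le_trans _ _ (2 * (avg2 F N - z N) ^+ 2 + 2 * z N ^+ 2)); last by lra.
  rewrite -subr_ge0; apply: le_trans h3 _; rewrite le_eqVlt; apply/orP; left.
  by apply/eqP; ring.
rewrite -[X in _ --> X]add0r; apply: cvgD.
  rewrite -[X in _ --> X](mulr0 2); apply: cvgM; first exact: cvg_cst.
  rewrite -[X in _ --> X](mulr0 0); apply: cvgM; exact: cvg_divn.
apply: cvgM; first exact: cvg_cst.
by apply: cvgM => //; exact: cvg_cst.
Qed.

(** * Two-parameter averages of products along linear forms *)

Lemma avg2_form_le (q : nat -> R) (a b c N : nat) :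
  (forall n, 0 <= q n) -> (0 < a)%N -> (0 < b)%N ->
  avg2 (fun n m => q (a * n + b * m + c)%N) N <=
    N%:R^-1 * \sum_(0 <= j < (a + b) * N + c) q j.
Proof.
move=> q0 a0 b0; rewrite /avg2 exchange_avg.
case: N => [|N].
  by rewrite /avg big_geq// mulr0 mulr_ge0 ?invr_ge0// sumr_ge0.
rewrite -[leRHS](@avg_cst _ N.+1)//; apply: le_avg => m mN.
rewrite ler_wpM2l ?invr_ge0//.
(* For fixed [m] the values of the form are distinct and lie in the range of the right-hand sum, so
   each row is dominated by that same sum. *)
pose s := [seq (a * n + b * m + c)%N | n <- index_iota 0 N.+1].
have us : uniq s.
  rewrite map_inj_uniq ?iota_uniq// => x y /eqP.
  by rewrite !eqn_add2r eqn_pmul2l// => /eqP.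
rewrite (_ : \sum_(0 <= n < N.+1) _ = \sum_(j <- s) q j); last by rewrite big_map.
have ss : {subset s <= index_iota 0 ((a + b) * N.+1 + c)}.
  move=> j /mapP[n]; rewrite mem_index_iota => /= nN ->.
  rewrite mem_index_iota/= ltn_add2r mulnDl -addSn leq_add//.
    by rewrite ltn_pmul2l.
  by rewrite leq_pmul2l// ltnW.
rewrite [leRHS](bigID (fun j => j \in s))/= -[leLHS]addr0 lerD//; last first.
  by apply: sumr_ge0.
rewrite le_eqVlt; apply/orP; left; apply/eqP; rewrite -[RHS]big_filter.
apply: perm_big; apply: uniq_perm => // [|j]; first by rewrite filter_uniq ?iota_uniq.
by rewrite mem_filter; case: (boolP (j \in s)) => // /ss ->.
Qed.

Lemma cvg_avg_affine u m (a c : nat) : (0 < a)%N -> has_mean u m ->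
  N%:R^-1 * \sum_(0 <= j < a * N + c) u j @[N --> \oo] --> a%:R * m.
Proof.
move=> a0 um.
have hN : (a * N + c)%:R * (N%:R^-1 : R) @[N --> \oo] --> (a%:R : R).
  have : a%:R + c%:R / N%:R @[N --> \oo] --> (a%:R + 0 : R).
    by apply: cvgD; [exact: cvg_cst|exact: cvg_divn].
  rewrite addr0; apply: cvg_trans; apply: near_eq_cvg; near=> N.
  have N0 : (N%:R : R) != 0 by rewrite pnatr_eq0 -lt0n; near: N; exact: nbhs_infty_gt.
  by rewrite natrD natrM mulrDl mulfK.
have uN : avg u (a * N + c)%N @[N --> \oo] --> m.
  apply: (cvg_comp _ _ _ um) => A [M _ MA]; exists M => // N /= MN; apply: MA => /=.
  apply: (leq_trans MN); apply: (leq_trans (leq_pmull _ a0)); exact: leq_addr.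
have : (a * N + c)%:R * N%:R^-1 * avg u (a * N + c)%N @[N --> \oo] --> a%:R * m.
  exact: cvgM.
apply: cvg_trans; apply: near_eq_cvg; near=> N.
have N0 : (0 < N)%N by near: N; exact: nbhs_infty_gt.
have aN0 : ((a * N + c)%:R : R) != 0.
  by rewrite pnatr_eq0 -lt0n addn_gt0 muln_gt0 a0 N0.
by rewrite /= /avg -mulrA mulrCA mulVKf.
Unshelve. all: by end_near. Qed.

(** Abstracts the sequences [g (T^n xi)], [g] continuous, along a generic point of a weakly mixing
    system. Products and shifts are what van der Corput differencing produces, [wmf_subc] allows
    centring, and [wmf_mix] is the decay of correlations in mean. *)
Record wm_family (AA : set (nat -> R)) : Prop := WMFamily {
  wmf_bounded : forall u, AA u -> exists C : R, forall n, `|u n| <= C;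
  wmf_mul : forall u v, AA u -> AA v -> AA (fun n => u n * v n);
  wmf_shift : forall u k, AA u -> AA (fun n => u (n + k)%N);
  wmf_subc : forall u c, AA u -> AA (fun n => u n - c);
  wmf_mean : forall u, AA u -> exists m, has_mean u m;
  wmf_mix : forall u, AA u -> has_mean u 0 -> exists2 c : nat -> R,
    (forall h, has_mean (fun n => u n * u (n + h)%N) (c h)) &
    avg (fun h => `|c h|) N @[N --> \oo] --> (0 : R) }.

(** For fixed [h] each value of [|h - h'|] is taken by at most two [h'], one on each side of [h]:
    hence the factor 2. The sum over multiples of [d] is then bounded by the sum over all indices
    below [d * H]. *)
Lemma avg2_dist_le (c : nat -> R) d H : (forall h, 0 <= c h) -> (0 < d)%N ->
  avg2 (fun h h' => c (`|h%:Z - h'%:Z| * d)%N) H <= 2 * (d%:R * avg c (d * H)).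
Proof.
move=> c0 d0; rewrite /avg2.
case: H => [|H]; first by rewrite /avg !muln0 !big_geq// !mulr0.
rewrite -[leRHS](@avg_cst _ H.+1)//; apply: le_avg => h hH.
have S0 a b : 0 <= \sum_(a <= i < b) c i by exact: sumr_ge0.
have key (f : nat -> nat) p q : (p <= q <= H.+1)%N ->
    {in index_iota p q &, injective f} -> (forall i, (p <= i < q)%N -> (f i < H.+1)%N) ->
  \sum_(p <= i < q) c (f i * d)%N <= \sum_(0 <= j < d * H.+1) c j.
  move=> /andP[pq qH] finj fH.
  pose s := [seq (f n * d)%N | n <- index_iota p q].
  have us : uniq s.
    rewrite map_inj_in_uniq ?iota_uniq// => x y xI yI /eqP.
    by rewrite eqn_pmul2r// => /eqP; exact: finj.
  rewrite (_ : \sum_(p <= n < q) _ = \sum_(j <- s) c j); last by rewrite big_map.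
  have ss : {subset s <= index_iota 0 (d * H.+1)}.
    move=> j /mapP[n]; rewrite mem_index_iota => /fH nN ->.
    by rewrite mem_index_iota/= mulnC ltn_pmul2l.
  rewrite [leRHS](bigID (fun j => j \in s))/= -[leLHS]addr0 lerD ?sumr_ge0//.
  rewrite le_eqVlt; apply/orP; left; apply/eqP; rewrite -[RHS]big_filter.
  apply: perm_big; apply: uniq_perm => // [|j]; first by rewrite filter_uniq ?iota_uniq.
  by rewrite mem_filter; case: (boolP (j \in s)) => // /ss ->.
have -> : 2 * (d%:R * avg c (d * H.+1)) =
    H.+1%:R^-1 * (2 * \sum_(0 <= j < d * H.+1) c j).
  have d0' : (d%:R : R) != 0 by rewrite pnatr_eq0 -lt0n.
  by rewrite /avg natrM invfM -mulrA mulVKf// mulrCA.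
rewrite ler_wpM2l ?invr_ge0// mulr_natl mulr2n.
rewrite (big_cat_nat _ (n := h))//=; last exact: ltnW.
apply: lerD.
  rewrite (eq_big_nat _ _ (F2 := fun i => c ((h - i) * d)%N)); last first.
    by move=> i /andP[_ ih]; congr (c (_ * _)%N); lia.
  apply: key; first by rewrite /= ltnW.
    by move=> x y; rewrite !mem_index_iota/= => xh yh; lia.
  by move=> i ih; lia.
rewrite (eq_big_nat _ _ (F2 := fun i => c ((i - h) * d)%N)); last first.
  by move=> i /andP[ih _]; congr (c (_ * _)%N); lia.
apply: key; first by rewrite leqnn ltnW.
  by move=> x y; rewrite !mem_index_iota/= => /andP[xh _] /andP[yh _]; lia.
by move=> i ih; lia.
Qed.

Lemma mix_avg2 (AA : set (nat -> R)) u d : wm_family AA -> AA u -> has_mean u 0 ->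
  (0 < d)%N -> exists2 c : nat -> R,
    (forall h, has_mean (fun n => u n * u (n + h)%N) (c h)) &
    avg2 (fun h h' => `|c (`|h%:Z - h'%:Z| * d)%N|) H @[H --> \oo] --> (0 : R).
Proof.
move=> wmA Au u0 d0; have [c uc c0] := wmf_mix wmA Au u0; exists c => //.
have h0 : 2 * (d%:R * avg (fun h => `|c h|) (d * H)) @[H --> \oo] --> (0 : R).
  rewrite -[X in _ --> X](mulr0 2); apply: cvgM; first exact: cvg_cst.
  rewrite -[X in _ --> X](mulr0 d%:R); apply: cvgM; first exact: cvg_cst.
  apply: (cvg_comp _ _ _ c0) => A [M _ MA]; exists M => // N /= MN; apply: MA => /=.
  by apply: (leq_trans MN); exact: leq_pmull.
apply: (squeeze_cvgr _ (cvg_cst 0) h0); near=> H; apply/andP; split.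
  by apply: avg_ge0 => h; apply: avg_ge0.
by rewrite (avg2_dist_le (c := fun h => `|c h|)).
Unshelve. all: by end_near. Qed.

Lemma shift_corr u (c : nat -> R) (C : R) s s' : (forall n, `|u n| <= C) ->
  (forall h, has_mean (fun n => u n * u (n + h)%N) (c h)) ->
  has_mean (fun n => u (n + s)%N * u (n + s')%N) (c `|s%:Z - s'%:Z|%N).
Proof.
move=> uC uc.
wlog ss' : s s' / (s <= s')%N.
  move=> h; have [/h//|/ltnW/h] := leqP s s'.
  by rewrite distnC; apply: eq_has_mean => n; rewrite mulrC.
have -> : `|s%:Z - s'%:Z|%N = (s' - s)%N by lia.
have C0 : 0 <= C by exact: le_trans (normr_ge0 (u 0%N)) (uC _).
have := @has_mean_shift _ _ (C * C) s _ (uc (s' - s)%N).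
have h n : `|u n * u (n + (s' - s))%N| <= C * C by rewrite normrM ler_pM.
move=> /(_ h); apply: eq_has_mean => n.
by rewrite -addnA subnKC.
Qed.

(** Base case of the induction on the number of forms. Shifting [n] by [h] moves the argument by
    [a * h]; there is no common factor to remove ([w = 1]), and the remaining square depends on one
    variable, with mean an average of autocorrelations. *)
Lemma cvg_avg2_form (AA : set (nat -> R)) u (a b c : nat) :
  wm_family AA -> AA u -> has_mean u 0 -> (0 < a)%N -> (0 < b)%N ->
  avg2 (fun n m => u (a * n + b * m + c)%N) N @[N --> \oo] --> (0 : R).
Proof.
move=> wmA Au u0 a0 b0.
have [C uC] := wmf_bounded wmA Au.
have [r ur r0] := mix_avg2 wmA Au u0 a0.
pose q H j := avg (fun h => u (j + a * h)%N) H ^+ 2.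
have qm H : has_mean (q H) (avg2 (fun h h' => r (`|h%:Z - h'%:Z| * a)%N) H).
  have qE j : avg2 (fun h h' => u (j + a * h)%N * u (j + a * h')%N) H = q H j.
    by rewrite -sqr_avg.
  apply: (eq_has_mean qE).
  have := @cvg_avg2 (fun h h' N => avg (fun j => u (j + a * h)%N * u (j + a * h')%N) N)
    (fun h h' => r (`|h%:Z - h'%:Z| * a)%N) H.
  rewrite /has_mean => h; have {}h := h _.
  rewrite (_ : avg _ = fun N => avg2 (fun h h' =>
     avg (fun j => u (j + a * h)%N * u (j + a * h')%N) N) H).
    apply: h => h h'.
    rewrite (_ : (`|h%:Z - h'%:Z| * a)%N = `|(a * h)%N%:Z - (a * h')%N%:Z|%N).
      exact: shift_corr.
    by rewrite !PoszM -mulrBr abszM mulnC.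
  apply/funext => N; rewrite /avg2 exchange_avg; apply: eq_avg => k _.
  by rewrite exchange_avg.
apply: (@van_der_corput _ C 1 (fun _ h => h) (fun _ _ => 0%N) (fun _ _ _ => 1)
  (fun _ h n m => u (a * n + b * m + c + a * h)%N)
  (fun H N => N%:R^-1 * \sum_(0 <= j < (a + b) * N + c) q H j)
  (fun H => (a + b)%:R * avg2 (fun h h' => r (`|h%:Z - h'%:Z| * a)%N) H)).
- by move=> n m; exact: uC.
- by move=> H h n m _; rewrite mul1r addn0; congr u; ring.
- by move=> H n m; rewrite normr1.
- move=> H N; apply: (avg2_form_le (q := q H)) => // j; exact: sqr_ge0.
- by move=> H; apply: cvg_avg_affine => //; rewrite addn_gt0 a0.
- rewrite -[X in _ --> X](mulr0 (a + b)%:R); apply: cvgM; first exact: cvg_cst.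
  apply/norm_cvg0P; apply: (squeeze_cvgr _ (cvg_cst 0) r0); near=> H.
  rewrite normr_ge0/=; apply: (le_trans (ler_norm_avg _ _)).
  by apply: le_avg => h _; exact: ler_norm_avg.
Unshelve. all: by end_near. Qed.

Lemma wmf_uniform_bound (AA : set (nat -> R)) (I : eqType) (s : seq I)
    (u : I -> nat -> R) :
  wm_family AA -> (forall i, i \in s -> AA (u i)) ->
  exists2 D : R, 1 <= D & forall i n, i \in s -> `|u i n| <= D.
Proof.
move=> wmA; elim: s => [|i s IH] As; first by exists 1.
have [C uC] := wmf_bounded wmA (As i (mem_head _ _)).
have [j js|D D1 sD] := IH _; first by apply: As; rewrite inE js orbT.
exists (Num.max C D) => [|j n]; first by rewrite le_max D1 orbT.
by rewrite inE le_max => /predU1P[->|/sD ->]; rewrite ?uC ?orbT.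
Qed.

Definition mean u : R := lim (avg u N @[N --> \oo]).

Lemma meanP u : (exists m, has_mean u m) -> has_mean u (mean u).
Proof. by move=> h; apply/cvgP/cvg_ex. Qed.

Lemma norm_prod_leX (I : eqType) (s : seq I) (f : I -> R) (D : R) n :
  1 <= D -> (size s <= n)%N -> (forall i, i \in s -> `|f i| <= D) ->
  `|\prod_(i <- s) f i| <= D ^+ n.
Proof.
move=> D1; elim: s n => [|i t IH] n nt tD; first by rewrite big_nil normr1 exprn_ege1.
case: n nt => // n nt; rewrite big_cons normrM exprS ler_pM ?tD ?mem_head//.
by apply: IH => // j jt; apply: tD; rewrite inE jt orbT.
Qed.

Lemma norm_prod_le (I : eqType) (s : seq I) (f : I -> R) (D : R) r :
  1 <= D -> r \in s -> (forall i, i \in s -> `|f i| <= D) ->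
  `|\prod_(i <- s) f i| <= D ^+ size s * `|f r|.
Proof.
move=> D1 rs fD; rewrite (perm_big _ (perm_to_rem rs))/= big_cons normrM mulrC.
rewrite ler_wpM2r// norm_prod_leX// ?size_rem ?leq_pred// => i.
by move/mem_rem/fD.
Qed.

(** Induction on the number of forms. If factor [i] has mean zero, another form [j] is frozen and
    removed by Cauchy-Schwarz, leaving products over one form fewer; centring one factor gives the
    general case. *)
Lemma cvg_avg2_prod (AA : set (nat -> R)) (I : eqType) (a b : I -> nat) (s : seq I) :
  wm_family AA -> uniq s ->
  (forall i, i \in s -> (0 < a i)%N /\ (0 < b i)%N) ->
  (forall i j, i \in s -> j \in s -> i != j -> (a i * b j != a j * b i)%N) ->
  forall (u : I -> nat -> R) (c : I -> nat) (m : I -> R),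
  (forall i, i \in s -> AA (u i) /\ has_mean (u i) (m i)) ->
  avg2 (fun n k => \prod_(i <- s) u i (a i * n + b i * k + c i)%N) N @[N --> \oo]
    --> \prod_(i <- s) m i.
Proof.
move=> wmA.
have [l] := ubnP (size s); elim: l s => // l IHl s ls us ab abs u c m Aum.
have mean0 (v : I -> nat -> R) (i : I) : i \in s ->
    (forall i, i \in s -> AA (v i)) -> has_mean (v i) 0 ->
    avg2 (fun n k => \prod_(i <- s) v i (a i * n + b i * k + c i)%N) N @[N --> \oo]
    --> (0 : R).
  move=> si Av vi0.
  have [s1|[j /andP[sj ij]]] : s = [:: i] \/ exists j, (j \in s) && (j != i).
    case: (boolP (has (fun j => j != i) s)) => [/hasP[j sj ij]|/hasPn h].
      by right; exists j; rewrite sj.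
    left; have hi : forall x, x \in s -> x = i by move=> x /h; rewrite negbK => /eqP.
    have : (size s <= 1)%N.
      by rewrite -[1%N]/(size [:: i]) uniq_leq_size// => x /hi ->; rewrite mem_head.
    by case: s si hi {us ls ab abs Aum Av h} => [|x [|y t]]// _ /(_ x (mem_head _ _)) ->.
  - have [a0 b0] := ab _ si.
    rewrite s1; under eq_fun do under eq_avg2 do rewrite big_seq1.
    by apply: (cvg_avg2_form _ wmA) => //; exact: Av.

  pose t := rem j s.
  have st : (size t < l)%N by rewrite size_rem// -ltnS prednK//; case: (s) sj.
  have ut : uniq t by exact: rem_uniq.
  have ts k : k \in t -> k \in s by exact: mem_rem.
  have it : i \in t by rewrite mem_rem_uniq// inE eq_sym ij.
  have tj k : k \in t -> k != j by rewrite mem_rem_uniq// inE => /andP[].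
  (* The shift by [(h * b j, (H - h) * a j)] moves form [j] by [H * a j * b j], whatever [h] is;
     [H - h] instead of [- h] stays natural. Form [k] moves by [sh H h k], and for form [i] two such
     shifts differ by [|h - h'| * d], where [d] is nonzero because forms [i] and [j] are not
     proportional. *)
  pose sh H h k := (a k * (h * b j) + b k * ((H - h) * a j))%N.
  pose vv H h h' k x := v k (x + sh H h k)%N * v k (x + sh H h' k)%N.
  have Avv H h h' k : k \in t -> AA (vv H h h' k).
    by move=> /ts/Av Avk; apply: (wmf_mul wmA); apply: (wmf_shift wmA _ Avk).
  pose mm H h h' k := mean (vv H h h' k).
  have vvm H h h' k : k \in t -> has_mean (vv H h h' k) (mm H h h' k).
    by move=> kt; apply: meanP; apply: (wmf_mean wmA); exact: Avv.
  have [D D1 vD] := wmf_uniform_bound wmA Av.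
  have D0 : 0 <= D by apply: le_trans D1.
  have mmD H h h' k : k \in t -> `|mm H h h' k| <= D * D.
    move=> kt; apply: (mean_bound (vvm H h h' k kt)) => n.
    by rewrite normrM ler_pM// vD// ts.
  pose d := `|(a i * b j)%N%:Z - (b i * a j)%N%:Z|%N.
  have d0 : (0 < d)%N.
    have := abs i j si sj; rewrite eq_sym ij => /(_ isT) /eqP h.
    by rewrite absz_gt0 subr_eq0; apply/eqP => -[] h'; apply: h; rewrite h' mulnC.
  have [r vr r0] := mix_avg2 wmA (Av _ si) vi0 d0.
  have mmr H h h' : (h < H)%N -> (h' < H)%N -> mm H h h' i = r (`|h%:Z - h'%:Z| * d)%N.
    move=> hH hH'; apply: (has_mean_unique (vvm H h h' i it)).
    rewrite (_ : (`|h%:Z - h'%:Z| * d)%N = `|(sh H h i)%:Z - (sh H h' i)%:Z|%N).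
      by apply: (@shift_corr (v i) r D) => // n; exact: vD.
    rewrite -abszM /sh !PoszD !PoszM -!subzn ?(ltnW hH) ?(ltnW hH')//.
    by congr absz; ring.
  pose G H h n k := \prod_(p <- t) v p (a p * n + b p * k + c p + sh H h p)%N.
  apply: (@van_der_corput _ (D ^+ size s) D (fun _ h => h * b j)%N
    (fun H h => (H - h) * a j)%N
    (fun H n k => v j (a j * n + b j * k + c j + H * a j * b j)%N) G
    (fun H N => avg2 (fun h h' => avg2 (fun n k => G H h n k * G H h' n k) N) H)
    (fun H => avg2 (fun h h' => \prod_(p <- t) mm H h h' p) H)).
  - by move=> n k; apply: norm_prod_leX => // p; exact: vD.
  - move=> H h n k hH; rewrite (perm_big _ (perm_to_rem sj))/= big_cons; congr (_ * _).
      by congr (v j _); rewrite -{2}(subnKC (ltnW hH)); ring.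
    by apply: eq_bigr => p _; congr (v p _); rewrite /sh; ring.
  - by move=> H n k; exact: vD.
  - move=> H N; rewrite (_ : avg2 _ N = avg2 (fun n k =>
        avg2 (fun h h' => G H h n k * G H h' n k) H) N); last first.
      by apply: eq_avg2 => n k; exact: sqr_avg.
    rewrite le_eqVlt; apply/orP; left; apply/eqP.
    rewrite {2}/avg2 (avg2_exchange (fun h n k => avg (fun h' => G H h n k * G H h' n k) H)).
    by apply: eq_avg => h _; rewrite avg2_exchange.
  - move=> H; apply: cvg_avg2 => h h'.
    have := IHl t st ut _ _ (vv H h h') c (mm H h h').
    rewrite (_ : (fun N : nat => avg2 (fun n k => G H h n k * G H h' n k) N) =
      (fun N => avg2 (fun n k => \prod_(p <- t) vv H h h' p (a p * n + b p * k + c p)%N) N)).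
      apply; first by move=> p /ts; exact: ab.
        by move=> p q /ts ps /ts qs; exact: abs.
      by move=> p pt; split; [exact: Avv|exact: vvm].
    apply/funext => N; apply: eq_avg2 => n k; rewrite -big_split/=.
    by apply: eq_bigr => p _.
  (* Only the mean of factor [i] is small on average; the others are bounded by [D * D]. *)
  - have r0' : (D * D) ^+ size t *
        avg2 (fun h h' => `|r (`|h%:Z - h'%:Z| * d)%N|) H @[H --> \oo] --> (0 : R).
      rewrite -[X in _ --> X](mulr0 ((D * D) ^+ size t)).
      by apply: cvgM => //; exact: cvg_cst.
    apply/norm_cvg0P; apply: (squeeze_cvgr _ (cvg_cst 0) r0'); near=> H.
    rewrite normr_ge0/=; apply: (le_trans (ler_norm_avg _ _)).
    rewrite -avg2Z; apply: le_avg => h hH.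
    apply: (le_trans (ler_norm_avg _ _)); apply: le_avg => h' hH'.
    rewrite -(mmr H)//; apply: norm_prod_le => //; last by move=> p; exact: mmD.
    by rewrite -[1]mulr1 ler_pM.
case: s us ab abs Aum ls mean0 => [|i s] /=.
  move=> _ _ _ _ _ _; rewrite big_nil -(cvg_shiftS (avg2 _)).
  rewrite (_ : (fun N => avg2 _ N.+1) = fun=> 1); first exact: cvg_cst.
  apply/funext => N; rewrite /avg2 (eq_avg (v := fun=> 1)) ?avg_cst// => n _.
  by rewrite (eq_avg (v := fun=> 1)) ?avg_cst// => k _; rewrite big_nil.
move=> /andP[iNs us] ab abs Aum ls mean0.
have [Aui ui] := Aum i (mem_head _ _).
(* Centring factor [i] splits the product into one with a mean-zero factor and [m i] times a product
   over one form fewer. *)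
pose v k := if k == i then fun n => u i n - m i else u k.
have h1 : avg2 (fun n k => \prod_(p <- i :: s) v p (a p * n + b p * k + c p)%N) N
    @[N --> \oo] --> (0 : R).
  apply: (mean0 v i); first by rewrite mem_head.
    move=> p ps; rewrite /v; case: eqP => _; first exact: wmf_subc.
    by have [] := Aum p ps.
  rewrite /v eqxx -(subrr (m i)); apply: has_meanB => //; exact: has_mean_cst.
have h2 : m i * avg2 (fun n k => \prod_(p <- s) u p (a p * n + b p * k + c p)%N) N
    @[N --> \oo] --> m i * \prod_(p <- s) m p.
  apply: cvgM; first exact: cvg_cst.
  apply: IHl => //.
  - by move=> p ps; apply: ab; rewrite inE ps orbT.
  - by move=> p q ps qs; apply: abs; rewrite inE ?ps ?qs orbT.
  - by move=> p ps; apply: Aum; rewrite inE ps orbT.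
rewrite big_cons -[X in _ --> X]add0r.
rewrite (_ : (fun N => avg2 _ N) = (fun N =>
    avg2 (fun n k => \prod_(p <- i :: s) v p (a p * n + b p * k + c p)%N) N +
    m i * avg2 (fun n k => \prod_(p <- s) u p (a p * n + b p * k + c p)%N) N)).
  exact: cvgD.
apply/funext => N; rewrite -avg2Z -avg2D; apply: eq_avg2 => n k.
rewrite !big_cons {1}/v eqxx (_ : \prod_(p <- s) v p _ =
    \prod_(p <- s) u p (a p * n + b p * k + c p)%N); first by ring.
rewrite !big_seq; apply: eq_bigr => p ps; rewrite /v.
by case: eqP => // pi; rewrite -pi ps in iNs.
Unshelve. all: by end_near. Qed.
End averages.

(** * The ergodic theorem *)

Section ergodic_averages.
Context (R : realType) (d : measure_display) (Y : measurableType d).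
Variables (P : {measure set Y -> \bar R}) (T : Y -> Y).
Hypothesis P1 : P setT = 1%E.
Hypothesis mT : measurable_fun setT T.
Hypothesis presT : measure_preserving P T.
Implicit Types f g F : Y -> R.

Definition bmfun f := measurable_fun setT f /\ exists C : R, forall x, `|f x| <= C.

Lemma bmfun_integrable f : bmfun f -> P.-integrable setT (EFin \o f).
Proof.
move=> [mf [C fC]]; apply: measurable_bounded_integrable => //.
  by rewrite P1 ltry.
by exists C; split; [exact: num_real|move=> M CM x _; apply: le_trans (fC x) (ltW CM)].
Qed.

Lemma bmfun_cst c : bmfun (fun=> c).
Proof. by split; [exact: measurable_cst|exists `|c|]. Qed.

Lemma bmfunD f g : bmfun f -> bmfun g -> bmfun (fun x => f x + g x).
Proof.
move=> [mf [C fC]] [mg [D gD]]; split; first exact: measurable_funD.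
by exists (C + D) => x; apply: le_trans (ler_normD _ _) (lerD _ _).
Qed.

Lemma bmfunM f g : bmfun f -> bmfun g -> bmfun (fun x => f x * g x).
Proof.
move=> [mf [C fC]] [mg [D gD]]; split; first exact: measurable_funM.
by exists (C * D) => x; rewrite normrM ler_pM.
Qed.

Lemma bmfunZ c f : bmfun f -> bmfun (fun x => c * f x).
Proof. by move=> bf; apply: bmfunM => //; exact: bmfun_cst. Qed.

Lemma bmfunN f : bmfun f -> bmfun (fun x => - f x).
Proof.
by move=> bf; under eq_fun do rewrite -mulN1r; exact: bmfunZ.
Qed.

Lemma bmfunB f g : bmfun f -> bmfun g -> bmfun (fun x => f x - g x).
Proof. by move=> bf bg; apply: bmfunD => //; exact: bmfunN. Qed.

Lemma bmfun_norm f : bmfun f -> bmfun (fun x => `|f x|).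
Proof.
move=> [mf [C fC]]; split; first exact: measurableT_comp.
by exists C => x; rewrite normr_id.
Qed.

Lemma bmfun_comp f : bmfun f -> bmfun (fun x => f (T x)).
Proof.
move=> [mf [C fC]]; split; first exact: measurableT_comp.
by exists C => x.
Qed.

Lemma bmfun_iter f n : bmfun f -> bmfun (fun x => f (iter n T x)).
Proof.
move=> bf; elim: n => // n IH.
by under eq_fun do rewrite iterSr; exact: (bmfun_comp IH).
Qed.

Lemma bmfun_sum (I : Type) (s : seq I) (f : I -> Y -> R) :
  (forall i, bmfun (f i)) -> bmfun (fun x => \sum_(i <- s) f i x).
Proof.
move=> bf; elim: s => [|i s IH].
  by under eq_fun do rewrite big_nil; exact: bmfun_cst.
by under eq_fun do rewrite big_cons; exact: bmfunD.
Qed.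

Lemma Rintegral_cst1 (c : R) : \int[P]_x c = c.
Proof. by rewrite Rintegral_cst// P1 mulr1. Qed.

Lemma Rintegral_sum (I : Type) (s : seq I) (f : I -> Y -> R) :
  (forall i, bmfun (f i)) ->
  \int[P]_x (\sum_(i <- s) f i x) = \sum_(i <- s) \int[P]_x f i x.
Proof.
move=> bf; elim: s => [|i s IH].
  rewrite big_nil -[RHS](Rintegral_cst1 0).
  by apply: eq_Rintegral => x _; rewrite big_nil.
rewrite big_cons -IH -RintegralD//; [|exact: bmfun_integrable|].
  by apply: eq_Rintegral => x _; rewrite big_cons.
by apply: bmfun_integrable; exact: bmfun_sum.
Qed.

Lemma Rintegral_comp f : bmfun f -> \int[P]_x f (T x) = \int[P]_x f x.
Proof.
move=> bf; congr fine.
rewrite -[RHS](@eq_measure_integral _ _ _ _ _ (pushforward P T)); last first.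
  by move=> A mA _; rewrite /= /pushforward presT.
have [mf _] := bf; have mEf : measurable_fun setT (EFin \o f) by exact/measurable_EFinP.
rewrite (integral_pushforward mT mEf)// preimage_setT//.
by apply: bmfun_integrable; exact: (bmfun_comp bf).
Qed.

Definition birkhoff_sum F n x : R := \sum_(0 <= i < n) F (iter i T x).

Lemma birkhoff_sumSr F n x :
  birkhoff_sum F n.+1 x = F x + birkhoff_sum F n (T x).
Proof.
rewrite /birkhoff_sum big_nat_recl//; congr (_ + _).
by apply: eq_bigr => i _; rewrite -iterSr.
Qed.

(** This is the maximum of [birkhoff_sum F n x] over [n <= N]; the recursion is the identity that
    Garsia's argument uses. *)
Fixpoint birkhoff_max F N x : R :=
  if N is n.+1 then Num.max 0 (F x + birkhoff_max F n (T x)) else 0.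

Lemma bmfun_max f : bmfun f -> bmfun (fun x => Num.max 0 (f x)).
Proof.
move=> [mf [C fC]]; split; first by apply: measurable_maxr => //; exact: measurable_cst.
exists C => x; have C0 := le_trans (normr_ge0 _) (fC x).
by case: (leP 0 (f x)) => _; rewrite ?normr0.
Qed.

Lemma bmfun_birkhoff_max F N : bmfun F -> bmfun (birkhoff_max F N).
Proof.
move=> bF; elim: N => [|N IH]; first exact: bmfun_cst.
by apply: bmfun_max; apply: bmfunD => //; exact: bmfun_comp.
Qed.

Lemma birkhoff_max_ge0 F N x : 0 <= birkhoff_max F N x.
Proof. by case: N => //= n; rewrite le_max lexx. Qed.

Lemma birkhoff_max_ge F N x : birkhoff_sum F N x <= birkhoff_max F N x.
Proof.
elim: N x => [|N IH] x; first by rewrite /birkhoff_sum big_geq.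
by rewrite birkhoff_sumSr/= le_max lerD2l IH orbT.
Qed.

Lemma birkhoff_max_nd F N x : birkhoff_max F N x <= birkhoff_max F N.+1 x.
Proof.
elim: N x => [|N IH] x; first exact: birkhoff_max_ge0.
rewrite /= ge_max le_max lexx/=.
by rewrite le_max; apply/orP; right; rewrite lerD2l; exact: IH.
Qed.

(* Garsia's proof: on [birkhoff_max F N.+1 > 0] the function [F] dominates
   [birkhoff_max F N.+1 - birkhoff_max F N.+1 \o T], whose integral vanishes. *)
Lemma maximal_ergodic F N : bmfun F ->
  0 <= \int[P]_x (F x * \1_[set x | 0 < birkhoff_max F N.+1 x] x).
Proof.
move=> bF; set M := birkhoff_max F N.+1.
have bM : bmfun M by exact: bmfun_birkhoff_max.
have bE : bmfun (\1_[set x | 0 < M x] : Y -> R).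
  split; last by exists 1 => x; rewrite indicE; case: (_ \in _); rewrite ?normr1 ?normr0.
  apply: measurable_indic; rewrite -[X in measurable X]setTI.
  have -> : [set x | 0 < M x] = M @^-1` `]0, +oo[%classic.
    by apply/seteqP; split => x /=; rewrite in_itv/= andbT.
  by apply: bM.1 => //; exact: measurable_itv.
apply: (@le_trans _ _ (\int[P]_x (M x - M (T x)))).
  rewrite RintegralB ?Rintegral_comp ?subrr//; apply: bmfun_integrable => //.
  exact: bmfun_comp.
apply: le_Rintegral => //.
- by apply: bmfun_integrable; apply: bmfunB => //; exact: bmfun_comp.
- by apply: bmfun_integrable; exact: bmfunM.
move=> x _; rewrite indicE; have MT0 := birkhoff_max_ge0 F N.+1 (T x).
case: (boolP (x \in _)) => [/set_mem/= Mx|/negP xM].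
  rewrite mulr1; have := birkhoff_max_nd F N (T x); rewrite -/M in MT0 *.
  have -> : M x = F x + birkhoff_max F N (T x).
    by move: Mx; rewrite /M/=; case: (leP 0 (F x + _)) => //; rewrite ltxx.
  by rewrite -/M; lra.
rewrite mulr0 subr_le0; apply: le_trans MT0; rewrite leNgt; apply/negP => Mx.
by apply: xM; apply/mem_set.
Qed.

(** The points where the limit superior of [birkhoff_sum F n x / n] is positive, written with
    countably many thresholds. *)
Definition birkhoff_pos F : set Y :=
  \bigcup_j \bigcap_N \bigcup_(n in [set n | (N <= n)%N])
    [set x | n%:R / j.+1%:R < birkhoff_sum F n x].

Lemma bmfun_birkhoff_sum F n : bmfun F -> bmfun (birkhoff_sum F n).
Proof. by move=> bF; apply: bmfun_sum => i; exact: bmfun_iter. Qed.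

Lemma measurable_gt (f : Y -> R) (c : R) : bmfun f -> measurable [set x | c < f x].
Proof.
move=> [mf _]; rewrite -[X in measurable X]setTI.
have -> : [set x | c < f x] = f @^-1` `]c, +oo[%classic.
  by apply/seteqP; split => x /=; rewrite in_itv/= andbT.
by apply: mf => //; exact: measurable_itv.
Qed.

Lemma measurable_birkhoff_pos F : bmfun F -> measurable (birkhoff_pos F).
Proof.
move=> bF; apply: bigcupT_measurable => j; apply: bigcapT_measurable => N.
by apply: bigcup_measurable => n _; apply: measurable_gt; exact: bmfun_birkhoff_sum.
Qed.

(** Passing between [x] and [T x] changes the sum by at most [C] and the index by one; halving the
    threshold absorbs both once [n] is large. *)
Lemma birkhoff_pos_invariant F : bmfun F -> T @^-1` birkhoff_pos F = birkhoff_pos F.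
Proof.
move=> [_ [C FC]].
have [K CK] : exists K : nat, C + 1 <= K%:R.
  exists (Num.bound `|C + 1|); apply: le_trans (ler_norm _) _.
  by apply: ltW; exact: archi_boundP.
have half j (n : nat) : (2 * j.+1 * K <= n)%N ->
    n.+1%:R / (2 * j.+1)%N%:R + C <= n%:R / j.+1%:R :> R.
  move=> nj; have : (2 * j.+1 * K)%:R <= n%:R :> R by rewrite ler_nat.
  rewrite !natrM invfM -(natr1 n).
  have j0 : 0 < j.+1%:R^-1 :> R by rewrite invr_gt0.
  have j1 : j.+1%:R^-1 <= 1 :> R by rewrite invf_le1// ler1n.
  move=> nK; have : 2 * K%:R <= n%:R * j.+1%:R^-1 :> R.
    by rewrite ler_pdivlMr// mulrAC.
  rewrite (_ : (n%:R + 1) * (2^-1 / _) = (n%:R / j.+1%:R + j.+1%:R^-1) / 2); last by ring.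
  have aux (p q k : R) : C + 1 <= k -> q <= 1 -> 2 * k <= p -> (p + q) / 2 + C <= p by lra.
  exact: aux CK j1.
have dN j n : n.+1%:R / j%:R = n%:R / j%:R + j%:R^-1 :> R.
  by rewrite -natr1 mulrDl mul1r.
have double j : exists J, J.+1 = (2 * j.+1)%N by exists (2 * j.+1).-1; rewrite prednK.
apply/seteqP; split => x [j _ xj]; have [J JE] := double j; exists J => // N _.
  have [n /= + xn] := xj (maxn N (2 * j.+1 * K)) I; rewrite geq_max => /andP[Nn jn].
  exists n.+1; first by rewrite /= leqW.
  rewrite /= birkhoff_sumSr JE.
  have := FC x; rewrite ler_norml => /andP[Fx _].
  have aux (p q f s : R) : - C <= f -> p + C <= q -> q < s -> p < f + s by lra.
  exact: aux Fx (half _ _ jn) xn.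
have [[//|n] /= + xn] := xj (maxn N (2 * j.+1 * K)).+1 I.
rewrite ltnS geq_max => /andP[Nn jn]; exists n => //.
move: xn; rewrite /= birkhoff_sumSr JE dN => xn.
have := FC x; rewrite ler_norml => /andP[_ Fx].
have := half _ _ jn; rewrite dN => h.
have j0 : 0 < j.+1%:R^-1 :> R by rewrite invr_gt0.
have j0' : 0 < (2 * j.+1)%N%:R^-1 :> R by rewrite invr_gt0 ltr0n muln_gt0.
have aux (p q r t f s : R) : f <= C -> p + q + C <= r -> 0 < t -> 0 < q ->
  r + t < f + s -> p < s by lra.
exact: aux Fx h j0 j0' xn.
Qed.

Hypothesis ergT : ergodic P T.

(** By ergodicity the measure is 0 or 1. If it were 1, almost every point would have a positive
    partial sum, the sets [E N] would exhaust the space, and the maximal inequality would give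
    [0 <= \int F] in the limit. *)
Lemma birkhoff_pos_null F : bmfun F -> \int[P]_x F x < 0 -> P (birkhoff_pos F) = 0%E.
Proof.
move=> bF F0.
have [//|PB1] := ergT (measurable_birkhoff_pos bF) (birkhoff_pos_invariant bF).
exfalso.
pose E N : set Y := [set x | 0 < birkhoff_max F N.+1 x].
have mE N : measurable (E N) by apply: measurable_gt; exact: bmfun_birkhoff_max.
have BE : birkhoff_pos F `<=` \bigcup_N E N.
  move=> x [j _ /(_ 1%N I)[[//|n] _ xn]]; exists n => //=.
  apply: lt_le_trans (birkhoff_max_ge _ _ _); apply: le_lt_trans xn.
  by rewrite divr_ge0.
have PE1 : P (\bigcup_N E N) = 1%E.
  apply/eqP; rewrite eq_le; apply/andP; split.
    by rewrite -P1; apply: le_measure; rewrite ?inE//; exact: bigcupT_measurable.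
  rewrite -PB1; apply: le_measure; rewrite ?inE//; first exact: measurable_birkhoff_pos.
  exact: bigcupT_measurable.
have nd x : {homo (fun N => birkhoff_max F N x) : m n / (m <= n)%N >-> m <= n}.
  by apply: homo_leq => // [? ? ?|N]; [exact: le_trans|exact: birkhoff_max_nd].
have Ecvg : P (E N) @[N --> \oo] --> (1%E : \bar R).
  rewrite -PE1; apply: nondecreasing_cvg_mu => //; first exact: bigcupT_measurable.
  move=> m n mn; apply/subsetPset => x; rewrite /E /= => h.
  by apply: lt_le_trans h _; apply: (nd x m.+1 n.+1).
have [_ [C FC]] := bF.
have C0 : 0 <= C by exact: le_trans (normr_ge0 _) (FC point).
have key N : - C * (1 - fine (P (E N))) <= \int[P]_x F x.
  have bE : bmfun (\1_(E N) : Y -> R).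
    split; first exact: measurable_indic.
    by exists 1 => x; rewrite indicE; case: (_ \in _); rewrite ?normr1 ?normr0.
  have IE : \int[P]_x (\1_(E N) x : R) = fine (P (E N)).
    by rewrite /Rintegral integral_indic// setIT.
  have h := maximal_ergodic N bF.
  have bFE := bmfunM bF bE.
  have b1E := bmfunB (bmfun_cst 1) bE.
  apply: (@le_trans _ _ (\int[P]_x (F x * \1_(E N) x) +
      \int[P]_x (- C * (1 - \1_(E N) x)))).
    rewrite RintegralZl//; last exact: bmfun_integrable.
    rewrite RintegralB//; [|exact: bmfun_integrable (bmfun_cst 1)|exact: bmfun_integrable].
    by rewrite IE Rintegral_cst1 lerDr.
  rewrite -RintegralD//; [|exact: bmfun_integrable|by apply: bmfun_integrable; exact: bmfunZ].
  apply: le_Rintegral => //.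
  - by apply: bmfun_integrable; apply: bmfunD => //; exact: bmfunZ.
  - exact: bmfun_integrable.
  move=> x _; have := FC x; rewrite ler_norml indicE => /andP[? ?].
  by case: (_ \in _); rewrite /= ?mulr1n ?mulr0n; lra.
have : - C * (1 - fine (P (E N))) @[N --> \oo] --> - C * (1 - 1).
  apply: cvgM; first exact: cvg_cst.
  apply: cvgB; first exact: cvg_cst.
  exact: (fine_cvg Ecvg).
rewrite subrr mulr0 => cvg0.
suff : 0 <= \int[P]_x F x by rewrite leNgt F0.
rewrite -(cvg_lim _ cvg0)//; apply: limr_le; first by apply/cvg_ex; exists 0.
by apply: nearW => N; exact: key.
Qed.

Lemma birkhoff_pos_le F x : ~ birkhoff_pos F x -> forall j,
  \forall n \near \oo, birkhoff_sum F n x <= n%:R / j.+1%:R.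
Proof.
move=> nB j; apply: contrapT => h; apply: nB; exists j => // N _.
apply: contrapT => h'; apply: h; exists N => // n /= Nn.
by rewrite leNgt; apply/negP => hn; apply: h'; exists n.
Qed.

(** The functions [F - 1 / (i + 1)] and [- F - 1 / (i + 1)] have negative integral. Off countably
    many null sets the averages of [F] and of [- F] are therefore eventually at most [2 / (j + 1)],
    for every [j]. *)
Theorem birkhoff_ergodic F : bmfun F -> \int[P]_x F x = 0 ->
  {ae P, forall x, avg (fun n => F (iter n T x)) N @[N --> \oo] --> (0 : R)}.
Proof.
move=> bF F0.
pose G (b : bool) i x : R := (-1) ^+ b * F x - i.+1%:R^-1.
have bG b i : bmfun (G b i).
  by apply: bmfunB; [exact: bmfunZ|exact: bmfun_cst].
have aeG b i : {ae P, forall x, ~ birkhoff_pos (G b i) x}.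
  exists (birkhoff_pos (G b i)); split; first exact: measurable_birkhoff_pos.
    apply: birkhoff_pos_null => //.
    rewrite RintegralB//; [|exact: bmfun_integrable (bmfunZ _ bF)|exact: bmfun_integrable (bmfun_cst _)].
    rewrite RintegralZl//; last exact: bmfun_integrable.
    by rewrite F0 mulr0 Rintegral_cst1 sub0r oppr_lt0 invr_gt0.
  by move=> x /= /contrapT.
have aeb b : {ae P, forall x, forall i, ~ birkhoff_pos (G b i) x}.
  by apply: ae_foralln => i; exact: aeG.
apply: filterS2 (aeb true) (aeb false) => x xt xf.
apply/cvgr0Pnorm_le => e e0.
have [j je] : exists j, j.+1%:R^-1 <= e / 2 :> R.
  exists (Num.bound (2 / e)); rewrite -[leRHS]invrK lef_pV2 ?posrE// ?invr_gt0 ?divr_gt0//.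
  rewrite invf_div; apply: ltW; apply: lt_trans (archi_boundP _) _.
    by rewrite divr_ge0 // ltW.
  by rewrite ltr_nat.
have sG b n : birkhoff_sum (G b j) n x =
    (-1) ^+ b * birkhoff_sum F n x - n%:R * j.+1%:R^-1.
  rewrite /birkhoff_sum /G sumrB -mulr_sumr; congr (_ - _).
  by rewrite big_const_nat subn0 iter_addr_0 -[LHS]mulr_natl.
have ht := birkhoff_pos_le (xt j) j.
have hf := birkhoff_pos_le (xf j) j.
near=> n.
have n0 : (0 < n)%N by near: n; exact: nbhs_infty_gt.
have : birkhoff_sum (G true j) n x <= n%:R / j.+1%:R by near: n.
have : birkhoff_sum (G false j) n x <= n%:R / j.+1%:R by near: n.
rewrite !sG /= expr0 expr1 mul1r mulN1r => h1 h2.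
rewrite /avg normrM ger0_norm ?invr_ge0// ler_pdivrMl ?ltr0n//.
rewrite -/(birkhoff_sum F n x) ler_norml.
have h3 : n%:R / j.+1%:R <= n%:R * (e / 2) by rewrite ler_wpM2l.
have aux (s a b : R) : s - a <= a -> - s - a <= a -> a <= b / 2 -> - b <= s <= b by lra.
by apply: (aux _ _ _ h1 h2); rewrite -mulrA.
Unshelve. all: by end_near. Qed.

Lemma cvg_Rintegral_norm_avg F : bmfun F -> \int[P]_x F x = 0 ->
  \int[P]_x `|avg (fun n => F (iter n T x)) N| @[N --> \oo] --> (0 : R).
Proof.
move=> bF F0; have [_ [C FC]] := bF.
have C0 : 0 <= C by exact: le_trans (normr_ge0 _) (FC point).
have bA N : bmfun (fun x => avg (fun n => F (iter n T x)) N).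
  by apply: bmfunZ; exact: bmfun_birkhoff_sum.
have [] := @dominated_convergence _ _ _ P setT measurableT
  (fun N x => (`|avg (fun n => F (iter n T x)) N|)%:E) (cst 0%E) (cst C%:E).
- by move=> N; apply/measurable_EFinP; exact: (bmfun_norm (bA N)).1.
- exact: measurable_cst.
- have := birkhoff_ergodic bF F0; apply: filterS => x xF _.
  by apply: cvg_EFin; [exact: nearW|apply/norm_cvg0P].
- exact: (bmfun_integrable (bmfun_cst C)).
- by apply: aeW => x n _; rewrite /= lee_fin normr_id; apply: avg_bound.
- move=> _ _; rewrite integral0 => h.
  exact: (fine_cvg h).
Qed.

(** The averaged correlation is the integral of [F] against its own ergodic average, which tends to
    0 in [L^1]. *)
Lemma cvg_avg_correlation F : bmfun F -> \int[P]_x F x = 0 ->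
  avg (fun h => \int[P]_x (F x * F (iter h T x))) H @[H --> \oo] --> (0 : R).
Proof.
move=> bF F0; have [_ [C FC]] := bF.
have C0 : 0 <= C by exact: le_trans (normr_ge0 _) (FC point).
have bA N : bmfun (fun x => avg (fun n => F (iter n T x)) N).
  by apply: bmfunZ; exact: bmfun_birkhoff_sum.
have h : C * \int[P]_x `|avg (fun n => F (iter n T x)) N| @[N --> \oo] --> (0 : R).
  rewrite -[X in _ --> X](mulr0 C); apply: cvgM; first exact: cvg_cst.
  exact: cvg_Rintegral_norm_avg.
apply/norm_cvg0P; apply: (squeeze_cvgr _ (cvg_cst 0) h); near=> N.
rewrite normr_ge0/=.
have -> : avg (fun h => \int[P]_x (F x * F (iter h T x))) N =
    \int[P]_x (F x * avg (fun n => F (iter n T x)) N).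
  rewrite /avg -Rintegral_sum; last by move=> i; apply: bmfunM => //; exact: bmfun_iter.
  rewrite -RintegralZl//; last first.
    by apply: bmfun_integrable; apply: bmfun_sum => i; apply: bmfunM => //; exact: bmfun_iter.
  by apply: eq_Rintegral => x _; rewrite -mulr_sumr mulrCA.
have bN := bmfun_norm (bA N).
apply: le_trans (le_normr_Rintegral _ _) _ => //.
  by apply: bmfun_integrable; exact: bmfunM.
rewrite -RintegralZl//; last exact: bmfun_integrable.
apply: le_Rintegral => //.
- by apply: bmfun_integrable; apply: bmfun_norm; exact: bmfunM.
- by apply: bmfun_integrable; exact: bmfunZ.
by move=> x _; rewrite normrM ler_wpM2r.
Unshelve. all: by end_near. Qed.

End ergodic_averages.

(** * Correlations along generic points of weakly mixing systems *)

Lemma continuous_borel_measurable (X : ptopologicalType) (R : realType) (f : X -> R) :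
  continuous f -> measurable_fun setT (f : borel X -> R).
Proof.
move=> /continuousP cf; apply: (measurability _ (RGenOpens.measurableE R)).
move=> _ [_ [a [b ->] <-]]; rewrite setTI.
by apply: sub_sigma_algebra; apply: cf; exact: interval_open.
Qed.

Lemma continuous_borel_measurable_self (X : ptopologicalType) (T : X -> X) :
  continuous T -> measurable_fun setT (T : borel X -> borel X).
Proof.
move=> /continuousP cT; apply: (@measurability _ _ (borel X) (borel X) setT T (@open X)) => //.
by move=> _ [A oA <-]; rewrite setTI; apply: sub_sigma_algebra; exact: cT.
Qed.

Section weak_mixing_correlations.
Context (R : realType) (d : measure_display) (X : measurableType d).
Variables (mu : probability X R) (T : X -> X).
Hypothesis mT : measurable_fun setT T.
Hypothesis presT : measure_preserving mu T.
Hypothesis wmT : weakly_mixing mu T.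

Let TT (p : X * X) := (T p.1, T p.2).

Let mu1 : mu setT = 1%E. Proof. exact: probability_setT. Qed.

Lemma square_setT : (mu \x mu)%E setT = 1%E.
Proof.
transitivity (mu setT * mu setT)%E; last by rewrite mu1 mule1.
by rewrite -setXTT; exact: product_measure1E.
Qed.

Lemma measurable_square_map : measurable_fun setT TT.
Proof.
apply/measurable_fun_pairP; split.
  exact: (measurableT_comp mT measurable_fst).
exact: (measurableT_comp mT measurable_snd).
Qed.

Lemma square_measure_preserving : measure_preserving (mu \x mu)%E TT.
Proof.
move=> B mB; apply/esym.
have mTT := measurable_square_map.
apply: (@product_measure_unique _ _ _ _ _ mu mu (pushforward (mu \x mu)%E TT)) => // C D mC mD.
change ((mu \x mu)%E (TT @^-1` (C `*` D)) = (mu C * mu D)%E).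
have -> : TT @^-1` (C `*` D) = (T @^-1` C) `*` (T @^-1` D) by [].
transitivity (mu (T @^-1` C) * mu (T @^-1` D))%E; last by rewrite !presT.
by apply: product_measure1E; rewrite -[X in measurable X]setTI; exact: mT.
Qed.

Lemma bmfun_tensor (k : X -> R) : bmfun k ->
  bmfun (fun p : X * X => k p.1 * k p.2).
Proof.
move=> [mk [C kC]]; apply: bmfunM.
  by split; [exact: (measurableT_comp mk measurable_fst)|exists C].
by split; [exact: (measurableT_comp mk measurable_snd)|exists C].
Qed.

Lemma Rintegral_tensor (k : X -> R) : bmfun k ->
  \int[(mu \x mu)%E]_p (k p.1 * k p.2) = (\int[mu]_x k x) ^+ 2.
Proof.
move=> bk; have ik := bmfun_integrable mu1 bk.
have := bmfun_integrable square_setT (bmfun_tensor bk) => ikk.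
rewrite /Rintegral -(integral12_prod_meas1 ikk).
have kfin : (\int[mu]_x (k x)%:E)%E \is a fin_num by exact: integrable_fin_num.
set I := fine (\int[mu]_x (k x)%:E)%E.
have IE : (\int[mu]_x (k x)%:E = I%:E)%E by rewrite /I fineK.
rewrite (eq_integral (fun x => I%:E * (k x)%:E)%E); last first.
  move=> x _; rewrite /fubini_F/=; under eq_integral do rewrite EFinM.
  by rewrite integralZl// IE muleC.
by rewrite integralZl// IE -EFinM expr2.
Qed.

(** The correlations of [G (x, y) = g x * g y] on the square are the squares of those of [g], so
    ergodicity of the square makes these squares vanish in mean; Cauchy-Schwarz passes to absolute
    values. *)
Lemma weak_mixing_correlation (g : X -> R) : bmfun g -> \int[mu]_x g x = 0 ->
  avg (fun h => `|\int[mu]_x (g x * g (iter h T x))|) H @[H --> \oo] --> (0 : R).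
Proof.
move=> bg g0; pose G (p : X * X) := g p.1 * g p.2.
have G0 : \int[(mu \x mu)%E]_p G p = 0 by rewrite Rintegral_tensor// g0 expr0n.
have := cvg_avg_correlation square_setT measurable_square_map
  square_measure_preserving wmT (bmfun_tensor bg) G0.
rewrite (_ : (fun H => avg _ H) = avg (fun h => (\int[mu]_x (g x * g (iter h T x))) ^+ 2)).
  move=> h; apply: (@squeeze_sqr_cvg0 _ _ (fun=> 0)); last exact: cvg_cst.
  move=> _ _; exists (avg (fun h => (\int[mu]_x (g x * g (iter h T x))) ^+ 2)) => //.
  move=> N; apply: (le_trans (sqr_avg_le _ _)); apply: le_avg => n _.
  by rewrite real_normK ?num_real.
apply/funext => H; apply: eq_avg => h _.
rewrite -Rintegral_tensor; last by apply: bmfunM => //; exact: bmfun_iter.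
apply: eq_Rintegral => p _; rewrite /G.
have -> : iter h TT p = (iter h T p.1, iter h T p.2).
  by elim: h => [|h /= ->]//; case: p.
by rewrite /= mulrACA.
Qed.

End weak_mixing_correlations.

Lemma iter_continuous (X : topologicalType) (T : X -> X) n :
  continuous T -> continuous (iter n T).
Proof.
move=> cT; elim: n => [|n IH] x; first exact: cvg_id.
by apply: (@continuous_comp _ _ _ (iter n T) T x); [exact: IH|exact: cT].
Qed.

Lemma coordinate_continuous (R : realType) (xi : cantor_space) (n : nat) :
  continuous (fun w : orbit_closure xi => (val w n)%:R : R).
Proof.
move=> w; apply: (@continuous_comp _ _ _ (fun w : orbit_closure xi => val w n)
   (fun b : bool => b%:R : R)); last first.
  by move=> A /nbhs_singleton Ab; apply: filterS (discrete_set1 _) => _ ->.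
have c1 : continuous (set_val : orbit_closure xi -> cantor_space).
  exact: initial_continuous.
move=> A nA; apply: (c1 w (proj n @^-1` A)).
exact: (@proj_continuous nat (fun=> bool) n).
Qed.

Lemma val_iter_orbit_shift (xi : cantor_space) (w : orbit_closure xi) n k :
  val (iter n (@orbit_shift xi) w) k = val w (k + n)%N.
Proof.
elim: n k => [|n IH] k; first by rewrite addn0.
transitivity (Defs.shift (val (iter n (@orbit_shift xi) w)) k); first by [].
by rewrite /Defs.shift IH addSnnS.
Qed.

(** The density sums over [1..N], the mean over [0..N-1]: the sums differ only in two end terms. *)
Lemma has_mean_density (R : realType) (S : set nat) (m : R) :
  has_mean \1_S m -> has_density S m.
Proof.
move=> h.
have h0 : N%:R^-1 * ((\1_S N - \1_S 0%N) : R) @[N --> \oo] --> (0 : R).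
  apply/norm_cvg0P; apply: (squeeze_cvgr _ (cvg_cst 0) (@cvg_divn R 1)); near=> N.
  rewrite normr_ge0/= mul1r normrM ger0_norm ?invr_ge0// ler_piMr ?invr_ge0//.
  rewrite !indicE; case: (_ \in _); case: (_ \in _);
    by rewrite /= ?mulr1n ?mulr0n ?subrr ?subr0 ?sub0r ?normrN ?normr0 ?normr1.
rewrite /has_density -[X in _ --> X]addr0.
rewrite (_ : (fun N => N%:R^-1 * _) =
  (fun N => avg \1_S N + N%:R^-1 * ((\1_S N - \1_S 0%N) : R))).
  exact: cvgD.
apply/funext => N; rewrite /avg -mulrDr; congr (_ * _).
have e : \sum_(0 <= n < N.+1) (\1_S n : R) = \1_S 0%N + \sum_(1 <= n < N.+1) (\1_S n : R).
  by rewrite big_ltn.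
by rewrite addrA; rewrite big_nat_recr//= in e; rewrite e addrAC subrr add0r.
Unshelve. all: by end_near. Qed.

(** The family is that of all [g (T^n xi)] with [g] continuous on the orbit closure: genericity
    turns means and correlations into integrals. The indicator of [S] is the zeroth coordinate along
    the orbit. *)
Theorem WM_set_family (R : realType) (S : set nat) : WM_set R S ->
  exists AA : set (nat -> R), [/\ wm_family AA, AA \1_S &
    exists2 m : R, has_mean \1_S m & 0 < m].
Proof.
move=> [_ [mu [presT wmT genT]] [dS hd dS0]].
set xi := char_seq S in mu presT wmT genT *.
pose X := orbit_closure xi.
pose T := @orbit_shift xi.
have cT : continuous T := @orbit_shift_continuous xi.
pose u (g : X -> R) n := g (iter n T (orbit_base xi)).
have bg (g : X -> R) : continuous g -> exists C : R, forall x, `|g x| <= C.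
  move=> cg.
  have : compact (g @` [set: X]).
    apply: continuous_compact; last exact: orbit_closure_compact.
    exact: continuous_subspaceT.
  move=> /compact_bounded [M [_ /(_ (`|M| + 1))]] h.
  exists (`|M| + 1) => x; apply: (h _ (g x)); last by exists x.
  by apply: le_lt_trans (ler_norm M) _; rewrite ltrDl.
have bmg (g : X -> R) : continuous g -> bmfun (g : borel X -> R).
  by move=> cg; split; [exact: continuous_borel_measurable|exact: bg].
have um (g : X -> R) : continuous g -> has_mean (u g) (\int[mu]_x g x).
  by move=> cg; exact: genT.
have indS n : \1_S n = (val (iter n T (orbit_base xi)) 0%N)%:R :> R.
  rewrite val_iter_orbit_shift.
  by rewrite add0n indicE /xi /char_seq.
pose c0 : X -> R := fun w : orbit_closure xi => (val w 0%N)%:R.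
exists [set u g | g in [set g : X -> R | continuous g]]; split.
- split.
  + by move=> _ [g /= cg <-]; have [C gC] := bg g cg; exists C => n; exact: gC.
  + move=> _ _ [f /= cf <-] [g /= cg <-]; exists (fun x => f x * g x) => //.
    by move=> x; apply: continuousM; [exact: cf|exact: cg].
  + move=> _ k [g /= cg <-]; exists (g \o iter k T).
      by move=> x; apply: continuous_comp; [exact: iter_continuous|exact: cg].
    by apply/funext => n; rewrite /u /= addnC iterD.
  + move=> _ c [g /= cg <-]; exists (fun x => g x - c) => //.
    by move=> x; apply: continuousB; [exact: cg|exact: cst_continuous].
  + by move=> _ [g /= cg <-]; exists (\int[mu]_x g x); exact: um.
  + move=> _ [g /= cg <-] ug0.
    have g0 := has_mean_unique (um g cg) ug0.
    exists (fun h => \int[mu]_x (g x * g (iter h T x))).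
      move=> h; apply: (@eq_has_mean _ (u (fun x => g x * g (iter h T x)))).
        by move=> n; rewrite /u [(n + h)%N]addnC iterD.
      apply: um => x; apply: continuousM; first exact: cg.
      by apply: continuous_comp; [exact: iter_continuous|exact: cg].
    apply: weak_mixing_correlation => //; last exact: bmg.
    exact: continuous_borel_measurable_self.
- exists c0; first exact: coordinate_continuous.
  by apply/funext => n; rewrite indS.
- have h : has_mean (\1_S : nat -> R) (\int[mu]_x c0 x).
    apply: (@eq_has_mean _ (u c0)).
      by move=> n; rewrite indS.
    by apply: um; exact: coordinate_continuous.
  exists (\int[mu]_x c0 x) => //.
  suff <- : dS = \int[mu]_x c0 x by [].
  exact: (@cvg_unique R (@norm_hausdorff _ R) _ _ _ _ hd (has_mean_density h)).
Qed.

(** * Solutions of the two-parameter system in a WM set *)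

Lemma det_mx22 (T : comNzRingType) (x y z t : T) : \det (mx22 x y z t) = x * t - y * z.
Proof.
have l1 : lift (lshift 1 (ord0 : 'I_1)) 0 = rshift 1 (ord0 : 'I_1) by exact: val_inj.
have l2 : lift (rshift 1 (ord0 : 'I_1)) 0 = lshift 1 (ord0 : 'I_1) by exact: val_inj.
have s1 : fintype.split (lshift 1 (ord0 : 'I_1)) = inl ord0 by exact: (unsplitK (inl ord0)).
have s2 : fintype.split (rshift 1 (ord0 : 'I_1)) = inr ord0 by exact: (unsplitK (inr ord0)).
rewrite (expand_det_row _ (lshift 1 ord0)) big_split_ord !big_ord1 /cofactor !det_mx11.
by rewrite !mxE /= !(l1, l2, s1, s2) !mxE !(s1, s2) !mxE /= !mulr1n; ring.
Qed.

Theorem WM_set_solvable (R : realType) (k : nat) (a b : 'cV[nat]_k) (f : 'cV[int]_k)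
    (P : {set {set 'I_k}}) (S : set nat) :
  finset.partition P [set: 'I_k]%SET -> directions_compatible a b P ->
  translation_compatible f P -> WM_set R S ->
  two_parameter_set a b f `&` cartesian_power k S !=set0.
Proof.
move=> /and3P[/eqP coverP trivP P0] dirP transP wmS.
have [AA [wmA AS [m Sm m0]]] := WM_set_family wmS.
pose c1 (F : {set 'I_k}) := (if [pick i in F] is Some i then a i ord0 else 0)%N.
pose c2 (F : {set 'I_k}) := (if [pick i in F] is Some i then b i ord0 else 0)%N.
pose c (F : {set 'I_k}) : int := if [pick i in F] is Some i then f i ord0 else 0.
have cE F i : F \in P -> i \in F -> [/\ c1 F = a i 0, c2 F = b i 0 & c F = f i 0].
  move=> PF Fi; rewrite /c1 /c2 /c; case: pickP => [j Fj|/(_ i)]; last by rewrite Fi.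
  have [x [y [_ _ h _]]] := dirP F PF; have [z hz] := transP F PF.
  by have [-> ->] := h _ Fi; have [-> ->] := h _ Fj; rewrite !hz.
have Pne F : F \in P -> exists i, i \in F.
  move=> PF; apply/set0Pn; apply/eqP => F0; by rewrite -F0 PF in P0.
have c_gt0 F : F \in P -> (0 < c1 F)%N /\ (0 < c2 F)%N.
  move=> PF; have [i Fi] := Pne F PF; have [-> -> _] := cE F i PF Fi.
  by have [x [y [x0 y0 h _]]] := dirP F PF; have [-> ->] := h _ Fi.
have c_indep F G : F \in P -> G \in P -> F != G -> (c1 F * c2 G != c1 G * c2 F)%N.
  move=> PF PG FG; have [j Gj] := Pne G PG; have [i Fi] := Pne F PF.
  have [-> -> _] := cE F i PF Fi; have [-> -> _] := cE G j PG Gj.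
  have [x [y [_ _ h /(_ j)]]] := dirP F PF.
  have jF : j \notin F.
    have /pred0P/(_ j) := finset.trivIsetP trivP F G PF PG FG.
    by rewrite /= Gj andbT => ->.
  move=> /(_ jF); have [-> ->] := h _ Fi; rewrite det_mx22 subr_eq0.
  by rewrite [(x * _)%N]mulnC; apply: contra => /eqP e; rewrite -!PoszM e.
(* Translations may be negative while sequences are indexed by naturals. Passing to the parameters
   [n + K] and [p + K] makes every constant [g F] a natural number, and the parameters positive
   since [K > 0]. *)
pose K := (\sum_(i : 'I_k) `|f i ord0|).+1%N.
have fK i : - K%:Z <= f i 0.
  have : (`|f i ord0| <= \sum_(i : 'I_k) `|f i ord0|)%N.
    by rewrite (bigD1 i)//= leq_addr.
  by rewrite /K -[f i 0]/(f i ord0); move: (\sum_(_ < _) _)%N => s; lia.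
pose g F : nat := absz (c F + ((c1 F + c2 F) * K)%N%:Z).
have gE F : F \in P -> (g F)%:Z = c F + ((c1 F + c2 F) * K)%N%:Z.
  move=> PF; rewrite /g gez0_abs//; have [i Fi] := Pne F PF.
  have [_ _ ->] := cE F i PF Fi; have := fK i; have [x0 _] := c_gt0 F PF.
  have : (K <= (c1 F + c2 F) * K)%N by rewrite leq_pmull// addn_gt0 x0.
  by lia.
have := @cvg_avg2_prod R AA _ c1 c2 (enum P) wmA (enum_uniq _) _ _ (fun=> \1_S) g (fun=> m).
have -> : \prod_(i <- enum P) m = m ^+ #|P|.
  by rewrite big_const_seq count_predT -cardE iter_mulr_1.
move=> h; have {}h := h _ _ _.
(* If every product vanished, the averages would tend to 0 and not to [m ^+ #|P|]. *)
have [n [p np]] : exists n p, \prod_(F <- enum P) (\1_S (c1 F * n + c2 F * p + g F)%N : R) != 0.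
  apply: contrapT => hn.
  suff : m ^+ #|P| = 0 by apply/eqP; rewrite expf_neq0// gt_eqF.
  have h0 : avg2 (fun n p => \prod_(F <- enum P) (\1_S (c1 F * n + c2 F * p + g F)%N : R)) N
     @[N --> \oo] --> (0 : R).
    rewrite (_ : (fun N => _) = fun=> 0); first exact: cvg_cst.
    apply/funext => N; rewrite (eq_avg2 (G := fun _ _ => 0)).
      by rewrite /avg2 /avg !big1 ?mulr0// => i _; rewrite big1 ?mulr0.
    by move=> n p; apply: contrapT => /eqP np; apply: hn; exists n, p.
  apply: (@cvg_unique R (@norm_hausdorff _ R) _ _ _ _ _ h0); apply: h.
  - by move=> F; rewrite mem_enum; exact: c_gt0.
  - by move=> F G; rewrite !mem_enum; exact: c_indep.
  - by [].
have inS F : F \in P -> S (c1 F * n + c2 F * p + g F)%N.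
  move=> PF; move: np; rewrite prodf_seq_neq0 => /allP/(_ F).
  rewrite mem_enum => /(_ PF)/=.
  by rewrite indicE; case: (boolP (_ \in S)) => [/set_mem//|_]; rewrite eqxx.
exists ((n + K)%:R *: map_mx (fun z : nat => z%:R) a
         + (p + K)%:R *: map_mx (fun z : nat => z%:R) b
         + map_mx intr f); split.
  by exists (n + K)%N, (p + K)%N; split => //; rewrite addn_gt0 orbT.
move=> i.
have /finset.bigcupP[F PF Fi] : i \in finset.cover P by rewrite coverP inE.
exists (c1 F * n + c2 F * p + g F)%N; first exact: inS.
have [aE bE fE] := cE F i PF Fi.
rewrite !mxE -aE -bE -fE.
rewrite -[RHS]/((_ : nat)%:Z%:~R) PoszD gE// !PoszD !PoszM !rmorphD/= !rmorphM/=.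
by rewrite [(_ + _)%:~R]rmorphD/= -!pmulrn; ring.
Qed.

(** * Bit sequences with prescribed uncorrelated products *)

Section random_bits.
Variable R : realType.
Implicit Types (L : seq nat) (e : nat -> bool).

(** The Walsh function of a list with multiplicities: a bit occurring an even number of times
    cancels. *)
Definition walsh L e : R := \prod_(b <- L) (-1) ^+ e b.

Definition flip_bit (b : nat) e : nat -> bool := fun i => e i (+) (i == b).

Lemma walsh_cat L L' e : walsh (L ++ L') e = walsh L e * walsh L' e.
Proof. by rewrite /walsh big_cat. Qed.

Lemma norm_walsh L e : `|walsh L e| = 1.
Proof.
rewrite /walsh; elim: L => [|b L IH]; first by rewrite big_nil normr1.
by rewrite big_cons normrM IH mulr1 normrX normrN1 expr1n.
Qed.

Lemma walsh_flip b L e : walsh L (flip_bit b e) = (-1) ^+ count_mem b L * walsh L e.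
Proof.
rewrite /walsh; elim: L => [|c L IH]; first by rewrite !big_nil mulr1.
rewrite !big_cons IH /flip_bit /= signr_addb exprD.
by case: (c == b); ring.
Qed.

Lemma walsh_ext L e e' : (forall b, b \in L -> e b = e' b) -> walsh L e = walsh L e'.
Proof. by move=> ee'; apply: eq_big_seq => b /ee' ->. Qed.

Definition cube_point m (x : {ffun 'I_m -> bool}) : nat -> bool :=
  fun i => if insub i is Some j then x j else false.

(** Flipping bit [b] is an involution of the cube that reverses the sign of the Walsh function. *)
Lemma sum_walsh_eq0 m L b : (b < m)%N -> odd (count_mem b L) ->
  \sum_(x : {ffun 'I_m -> bool}) walsh L (cube_point x) = 0.
Proof.
move=> bm oddb.
pose h (x : {ffun 'I_m -> bool}) := [ffun i : 'I_m => x i (+) (val i == b)].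
have hh : involutive h by move=> x; apply/ffunP => i; rewrite !ffunE addbK.
have hx x : cube_point (h x) = flip_bit b (cube_point x).
  apply/funext => i; rewrite /cube_point /flip_bit; case: insubP => [j _ <-|im].
    by rewrite ffunE.
  by case: eqP => // ib; rewrite ib bm in im.
set s := (LHS); have : s = - s.
  rewrite {1}/s (reindex_inj (inv_inj hh)) /s -sumrN; apply: eq_bigr => x _.
  by rewrite hx walsh_flip -signr_odd oddb expr1 mulN1r.
by move=> /eqP; rewrite -subr_eq0 opprK -mulr2n mulrn_eq0 /= => /eqP.
Qed.

Variable W : nat -> nat -> seq nat.
Variable C : nat -> nat.
(** The Walsh functions at [n] and [n'] are then orthogonal over every cube containing their bits.
    The bound on the witness makes the property boolean, so that exceptions can be counted. *)
Definition decoupled v n n' :=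
  [exists b : 'I_(\max_(i <- W v n ++ W v n') i).+1,
     odd (count_mem (val b) (W v n ++ W v n'))].
Hypothesis WC : forall v n N,
  (count (fun n' => ~~ decoupled v n n') (iota 0 N) <= C v)%N.

Definition walsh_sum v N e : R := \sum_(0 <= n < N) walsh (W v n) e.

Definition cube_card m : R := #|{ffun 'I_m -> bool}|%:R.

Lemma cube_card_ge0 m : 0 <= cube_card m. Proof. exact: ler0n. Qed.

(** Second moment: of the expanded square only coupled pairs survive, at most [C v] for each [n]. *)
Lemma sum_sqr_walsh_sum v N m :
  (forall n b, (n < N)%N -> b \in W v n -> (b < m)%N) ->
  \sum_(x : {ffun 'I_m -> bool}) walsh_sum v N (cube_point x) ^+ 2 <=
  cube_card m * (N * C v)%:R.
Proof.
move=> Wm.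
have -> : \sum_(x : {ffun 'I_m -> bool}) walsh_sum v N (cube_point x) ^+ 2 =
    \sum_(0 <= n < N) \sum_(0 <= n' < N)
     \sum_(x : {ffun 'I_m -> bool}) walsh (W v n ++ W v n') (cube_point x).
  rewrite (eq_bigr (fun x : {ffun 'I_m -> bool} => \sum_(0 <= n < N) \sum_(0 <= n' < N)
     walsh (W v n ++ W v n') (cube_point x))); last first.
    move=> x _; rewrite expr2 /walsh_sum mulr_suml; apply: eq_bigr => n _.
    by rewrite mulr_sumr; apply: eq_bigr => n' _; rewrite walsh_cat.
  by rewrite exchange_big /=; apply: eq_bigr => n _; rewrite exchange_big.
have -> : cube_card m * (N * C v)%:R =
    \sum_(0 <= n < N) cube_card m * (C v)%:R :> R.
  by rewrite big_const_nat iter_addr_0 subn0 natrM -[RHS]mulr_natl; ring.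
rewrite big_nat [leRHS]big_nat; apply: ler_sum => n /andP[_ nN].
rewrite (bigID (fun n' => decoupled v n n'))/= big_nat_cond big1 ?add0r.
  apply: le_trans (_ : \sum_(0 <= n' < N | ~~ decoupled v n n')
    cube_card m <= _).
    apply: ler_sum => n' _; apply: le_trans (ler_norm _) _.
    apply: le_trans (ler_norm_sum _ _ _) _.
    by rewrite (eq_bigr (fun=> 1)) ?sumr_const// => x _; rewrite norm_walsh.
  rewrite big_const_seq iter_addr_0 -[leLHS]mulr_natl mulrC ler_wpM2l ?ler_nat//.
  by rewrite /index_iota subn0; exact: WC.
move=> n' /andP[/andP[_ n'N] /existsP[b oddb]].
have bW : val b \in W v n ++ W v n'.
  by rewrite -has_pred1 has_count; case: count oddb.
apply: sum_walsh_eq0 oddb.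
by move: bW; rewrite mem_cat => /orP[] /Wm; exact.
Qed.

(* Averaged over all bit sequences the terms with a given [v] sum to less than
   [2 ^- v * \sum_j (j * j.+1)^-1], whence the bound [2] below.  The sparse
   times [j * j.+1] make this sum converge, yet have consecutive ratios tending
   to [1], so that they control the averages at all times. *)
Definition potential J e : R :=
  \sum_(0 <= v < J) \sum_(1 <= j < J)
    (2 ^ v * (C v).+1)%:R^-1 * ((walsh_sum v (j * j.+1) e) / (j * j.+1)%:R) ^+ 2.

Lemma potential_average J m :
  (forall v n b, (v < J)%N -> (n < J * J.+1)%N -> b \in W v n -> (b < m)%N) ->
  \sum_(x : {ffun 'I_m -> bool}) potential J (cube_point x) <=
    cube_card m * 2.
Proof.
move=> Wm; rewrite /potential exchange_big/=.
have h1 K : \sum_(1 <= j < K) (j * j.+1)%:R^-1 <= 1 - K%:R^-1 :> R.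
  elim: K => [|K IH]; first by rewrite big_geq// invr0 subr0.
  case: K IH => [|K] IH; first by rewrite big_geq// invr1 subrr.
  rewrite big_nat_recr//=; apply: le_trans (lerD IH (lexx _)) _.
  have k1 : (K.+1%:R : R) != 0 by [].
  have k2 : (K.+2%:R : R) != 0 by [].
  rewrite natrM -addrA lerD2l -subr_ge0 le_eqVlt; apply/orP; left; apply/eqP.
  rewrite -[K.+2%:R]natr1 in k2 *; move: k1 k2; move: (K.+1%:R) => z k1 k2.
  by field; rewrite k1 k2.
have h1' K : \sum_(1 <= j < K) (j * j.+1)%:R^-1 <= 1 :> R.
  by apply: (le_trans (h1 K)); rewrite gerBl invr_ge0.
have h2 K : \sum_(0 <= v < K) (2 ^ v)%:R^-1 <= 2 - 2 * (2 ^ K)%:R^-1 :> R.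
  elim: K => [|K IH]; first by rewrite big_geq// expn0 invr1 mulr1 subrr.
  rewrite big_nat_recr//=; apply: le_trans (lerD IH (lexx _)) _.
  rewrite expnS natrM invfM le_eqVlt; apply/orP; left; apply/eqP.
  by move: ((2 ^ K)%:R^-1) => z; field.
have h2' K : \sum_(0 <= v < K) (2 ^ v)%:R^-1 <= 2 :> R.
  by apply: (le_trans (h2 K)); rewrite gerBl mulr_ge0// invr_ge0.
apply: (@le_trans _ _ (\sum_(0 <= v < J) cube_card m * (2 ^ v)%:R^-1)).
  rewrite big_nat [leRHS]big_nat; apply: ler_sum => v /andP[_ vJ].
  rewrite exchange_big /=.
  apply: (@le_trans _ _ (\sum_(1 <= j < J)
      (cube_card m * (2 ^ v)%:R^-1) * (j * j.+1)%:R^-1)); last first.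
    by rewrite -mulr_sumr ler_piMr// mulr_ge0 ?invr_ge0// cube_card_ge0.
  rewrite big_nat [leRHS]big_nat; apply: ler_sum => j /andP[j0 jJ].
  rewrite -mulr_sumr natrM invfM.
  under eq_bigr do rewrite exprMn.
  rewrite -mulr_suml.
  have := @sum_sqr_walsh_sum v (j * j.+1) m.
  set s := \sum_(x | _) _ => hs.
  have {}hs : s <= cube_card m * (j * j.+1 * C v)%:R.
    apply: hs => n b nj bW; apply: Wm bW => //; apply: (leq_trans nj).
    exact: leq_mul (ltnW jJ) (leqW jJ).
  move: hs (cube_card_ge0 m); move: (cube_card m) => Q hs Q0.
  have N0 : (0 : R) < (j * j.+1)%:R by rewrite ltr0n muln_gt0 j0.
  rewrite [X in Q * X]natrM in hs.
  move: N0 hs; move: ((j * j.+1)%:R : R) => N N0 hs.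
  have h3 : s * N^-1 ^+ 2 <= Q * (C v)%:R * N^-1.
    have : s * N^-1 ^+ 2 <= Q * (N * (C v)%:R) * N^-1 ^+ 2.
      by rewrite ler_wpM2r// sqr_ge0.
    move/le_trans; apply; rewrite le_eqVlt; apply/orP; left; apply/eqP.
    by have N0' := lt0r_neq0 N0; field.
  have p0 : 0 <= (2 ^ v)%:R^-1 / (C v).+1%:R :> R by rewrite mulr_ge0 ?invr_ge0.
  apply: (le_trans (ler_wpM2l p0 h3)).
  have aux (p x y : R) : p / x * (Q * y / N) = Q * p / N * (y / x) by ring.
  rewrite aux.
  rewrite ler_piMr//; first by rewrite !mulr_ge0 ?invr_ge0// ltW.
  by rewrite ler_pdivrMr// mul1r ler_nat.
by rewrite -mulr_sumr ler_wpM2l// cube_card_ge0.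
Qed.

Lemma cantor_nbhs_prefix (e : cantor_space) m :
  nbhs e [set y : cantor_space | forall i, (i < m)%N -> y i = e i].
Proof.
elim: m => [|m IH]; first exact: filterS filterT.
have : nbhs e (proj m @^-1` [set (e m : bool)]).
  by apply: (@proj_continuous nat (fun=> bool) m); exact: discrete_set1.
move=> em; apply: filterS (filterI IH em) => y [ym yem] i.
by rewrite ltnS leq_eqVlt => /predU1P[->|/ym].
Qed.

Lemma potential_ext J e e' m :
  (forall v n b, (v < J)%N -> (n < J * J.+1)%N -> b \in W v n -> (b < m)%N) ->
  (forall i, (i < m)%N -> e i = e' i) -> potential J e = potential J e'.
Proof.
move=> Wm ee'; apply: eq_big_nat => v /andP[_ vJ]; apply: eq_big_nat => j /andP[_ jJ].
congr (_ * (_ / _) ^+ 2); apply: eq_big_nat => n /andP[_ nj]; apply: walsh_ext => b bW.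
by apply: ee'; apply: Wm bW => //; apply: (leq_trans nj); exact: leq_mul (ltnW jJ) (leqW jJ).
Qed.

Lemma potential_homo J J' e : (J <= J')%N -> potential J e <= potential J' e.
Proof.
move=> JJ'; have t0 v j : 0 <= (2 ^ v * (C v).+1)%:R^-1 *
    ((walsh_sum v (j * j.+1) e) / (j * j.+1)%:R) ^+ 2.
  by rewrite mulr_ge0 ?invr_ge0// sqr_ge0.
have s0 a b v : 0 <= \sum_(a <= j < b) (2 ^ v * (C v).+1)%:R^-1 *
    ((walsh_sum v (j * j.+1) e) / (j * j.+1)%:R) ^+ 2 by exact: sumr_ge0.
rewrite /potential [leRHS](big_cat_nat _ (n := J))//=.
rewrite -[leLHS]addr0 lerD ?sumr_ge0//; apply: ler_sum => v _.
case: J JJ' => [|J] JJ'; first by rewrite big_geq.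
by rewrite [leRHS](big_cat_nat _ (n := J.+1))//= lerDl.
Qed.

Lemma exists_bound J : exists m,
  forall v n b, (v < J)%N -> (n < J * J.+1)%N -> b \in W v n -> (b < m)%N.
Proof.
exists (\max_(v < J) \max_(n < J * J.+1) \max_(b <- W v n) b).+1.
move=> v n b vJ nJ bW; rewrite ltnS.
apply: leq_trans (leq_bigmax (Ordinal vJ)) => /=.
apply: leq_trans (leq_bigmax (Ordinal nJ)) => /=.
exact: leq_bigmax_seq.
Qed.

(** For each [J] some point of a large cube does no worse than the average. A cluster point of these
    serves all [J] at once, since [potential J] increases with [J] and reads finitely many bits. *)
Lemma exists_low_potential : exists e : nat -> bool, forall J, potential J e <= 2.
Proof.
have ex J : exists e : nat -> bool, potential J e <= 2.
  have [m Wm] := exists_bound J; apply: contrapT => h.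
  have := potential_average Wm; apply/negP; rewrite -ltNge /cube_card.
  rewrite mulr_natl -sumr_const; apply: ltr_sum => [|x _].
    by apply/hasP; exists [ffun=> false] => //; rewrite mem_index_enum.
  by rewrite ltNge; apply/negP => h'; apply: h; exists (cube_point x).
have [x xJ] := choice ex.
have [e [_ ce]] := @cantor_space_compact ((x : nat -> cantor_space) @ \oo) _ filterT.
exists e => J; have [m Wm] := exists_bound J.
have [y [[J' JJ' <-] xe]] : [set x J' | J' in [set J' | (J <= J')%N]] `&`
    [set y : cantor_space | forall i, (i < m)%N -> y i = e i] !=set0.
  apply: ce; last exact: cantor_nbhs_prefix.
  by exists J => // J' /= JJ'; exists J'.
rewrite -(potential_ext Wm xe); apply: le_trans (xJ J').
exact: potential_homo.
Qed.

(** Between the times [j (j + 1)] and [(j + 1) (j + 2)] fewer than [2 (j + 1)] terms are added, a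
    share of at most [2 / j]. *)
Lemma cvg_avg_subseq (u : nat -> R) : (forall n, `|u n| <= 1) ->
  avg u (j * j.+1) @[j --> \oo] --> (0 : R) -> has_mean u 0.
Proof.
move=> u1 uj; apply/cvgr0Pnorm_le => d d0.
have d2 : 0 < d / 2 by rewrite divr_gt0.
have h1 : \forall j \near \oo, `|avg u (j * j.+1)| <= d / 2.
  by move/cvgr0Pnorm_le : uj; exact.
have h2 : \forall j \near \oo, `|2 / j%:R : R| <= d / 2.
  by have /cvgr0Pnorm_le := @cvg_divn R 2; exact.
have [M _ MP] : \forall j \near \oo, `|avg u (j * j.+1)| <= d / 2 /\ `|2 / j%:R| <= d / 2.
  exact: filterI h1 h2.
exists (M.+1 * M.+2)%N => // N /= MN.
have [j [Mj jN Nj]] : exists j, [/\ (M < j)%N, (j * j.+1 <= N)%N & (N < j.+1 * j.+2)%N].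
  elim: N MN => // N IH; rewrite leq_eqVlt => /predU1P[<-|].
    by exists M.+1; split=> //; rewrite ltn_mul.
  rewrite ltnS => /IH[j [Mj jN Nj]].
  have [Nj'|jN'] := ltnP N.+1 (j.+1 * j.+2)%N; first by exists j; rewrite (leqW jN).
  exists j.+1; split => //; first exact: ltnW.
  apply: (leq_ltn_trans Nj); by rewrite ltn_mul.
have [j1 j2] := MP j (ltnW Mj).
have j0 : (0 < j)%N by exact: leq_trans Mj.
have jj0 : (0 < j * j.+1)%N by rewrite muln_gt0 j0.
have N0 : (0 < N)%N by exact: leq_trans jN.
rewrite /avg (big_cat_nat _ (n := (j * j.+1)%N))//= mulrDr [d]splitr.
apply: le_trans (ler_normD _ _) (lerD _ _).
  apply: le_trans j1; rewrite /avg !normrM ler_wpM2r// !ger0_norm ?invr_ge0//.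
  by rewrite lef_pV2 ?posrE ?ltr0n// ler_nat.
apply: le_trans j2; rewrite normrM ger0_norm ?invr_ge0//.
apply: (@le_trans _ _ (N%:R^-1 * (N - j * j.+1)%:R)).
  rewrite ler_wpM2l ?invr_ge0//; apply: le_trans (ler_norm_sum _ _ _) _.
  apply: le_trans (_ : \sum_(j * j.+1 <= i < N) 1 <= _); first exact: ler_sum.
  by rewrite big_const_nat iter_addr_0.
rewrite ger0_norm ?divr_ge0// mulrC ler_pdivrMr ?ltr0n// mulrAC ler_pdivlMr ?ltr0n//.
rewrite -!natrM ler_nat.
have : (N - j * j.+1 <= 2 * j.+1)%N by lia.
move=> h; apply: (@leq_trans (2 * j.+1 * j)); first by rewrite leq_mul2r h orbT.
by rewrite -mulnA leq_mul2l [(j.+1 * j)%N]mulnC jN.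
Unshelve. all: by end_near. Qed.

(** A deterministic strong law of large numbers: bounded potential makes the squared averages at the
    sparse times summable for each [v], hence null. *)
Theorem exists_uncorrelated_bits : exists e : nat -> bool,
  forall v, has_mean (fun n => walsh (W v n) e) 0.
Proof.
have [e eJ] := exists_low_potential; exists e => v.
apply: cvg_avg_subseq => [n|]; first by rewrite norm_walsh.
set c : R := (2 ^ v * (C v).+1)%:R.
have c0 : 0 < c by rewrite ltr0n muln_gt0 expn_gt0.
set u := fun j => _; pose s := series (fun j => u j.+1 ^+ 2).
have uE j : u j = walsh_sum v (j * j.+1) e / (j * j.+1)%:R by rewrite mulrC.
have snd : nondecreasing_seq s.
  by apply: nondecreasing_series => n _ _; exact: sqr_ge0.
have sb n : s n <= c * 2.
  rewrite -ler_pdivrMl//; apply: le_trans (eJ (maxn v.+1 n.+1)).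
  rewrite /potential (big_cat_nat _ (n := v)) ?leq_max//=; last first.
    by rewrite ltnW// leq_max leqnn.
  rewrite [X in _ <= _ + X]big_ltn ?leq_max ?leqnn// addrCA.
  have t0 w j : 0 <= (2 ^ w * (C w).+1)%:R^-1 *
      ((walsh_sum w (j * j.+1) e) / (j * j.+1)%:R) ^+ 2.
    by rewrite mulr_ge0 ?invr_ge0// sqr_ge0.
  rewrite -[leLHS]addr0 lerD//; last by rewrite addr_ge0// sumr_ge0// => w _; rewrite sumr_ge0.
  rewrite (big_cat_nat _ (n := n.+1))//=; last by rewrite leq_max leqnn orbT.
  rewrite -[leLHS]addr0 lerD ?sumr_ge0// -mulr_sumr -/c ler_wpM2l//; first by rewrite invr_ge0 ltW.
  rewrite big_add1 /s /series/= le_eqVlt; apply/orP; left; apply/eqP.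
  by apply: eq_bigr => j _; rewrite uE.
have cs : cvgn s by apply: nondecreasing_is_cvgn => //; exists (c * 2) => _ [n _ <-].
have := cvg_series_cvg_0 cs => h.
rewrite -(cvg_shiftS u); apply/cvgr0Pnorm_lt => d d0.
have d2 : 0 < d ^+ 2 by rewrite exprn_gt0.
have : \forall n \near \oo, `|u n.+1 ^+ 2| < d ^+ 2 by move/cvgr0Pnorm_lt : h; exact.
apply: filterS => n.
rewrite ger0_norm ?sqr_ge0// -[X in X < _]real_normK ?num_real// ltr_pXn2r//.
by rewrite nnegrE ltW.
Qed.

End random_bits.

(** * Patterns read off the bits, and finite codings of independent sequences *)

Section independent_patterns.
Variable R : realType.

Lemma has_mean_shift_inv (u : nat -> R) m (C : R) k : (forall n, `|u n| <= C) ->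
  has_mean (fun n => u (n + k)%N) m -> has_mean u m.
Proof.
move=> uC um; have C0 : 0 <= C by exact: le_trans (normr_ge0 (u 0%N)) (uC _).
have h : avg u N - avg (fun n => u (n + k)%N) N @[N --> \oo] --> (0 : R).
  apply/norm_cvg0P; apply: squeeze_cvgr (cvg_cst 0) (@cvg_divn _ (2 * k%:R * C)).
  by near=> N; rewrite normr_ge0 /=; exact: avg_shift.
have := cvgD h um; rewrite add0r => hm.
suff e : avg u = (fun N => avg u N - avg (fun n => u (n + k)%N) N +
    avg (fun n => u (n + k)%N) N) by rewrite /has_mean e; exact: hm.
by apply/funext => N; rewrite subrK.
Unshelve. all: by end_near. Qed.

Lemma has_mean_near (u v : nat -> R) m (C : R) k :
  (forall n, `|u n| <= C) -> (forall n, `|v n| <= C) ->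
  (forall n, (k <= n)%N -> u n = v n) -> has_mean u m -> has_mean v m.
Proof.
move=> uC vC uv um; apply: (has_mean_shift_inv (k := k) vC).
apply: eq_has_mean (@has_mean_shift _ u m C k uC um) => n.
by rewrite uv// leq_addl.
Qed.

Section patterns.
Variables (I : finType) (b : I -> nat -> nat) (sg : I -> bool).
Hypothesis b_inj : forall i, injective (b i).
(** Positions far apart may share bits; distinct bits are required only at bounded distance and far
    from the origin, which is all that a correlation over bounded shifts sees. *)
Hypothesis b_loc : forall K, exists M, forall i j m n, (M <= m)%N -> (M <= n)%N ->
  (m <= n + K)%N -> (n <= m + K)%N -> b i m = b j n -> i = j /\ m = n.

Definition pattern_at (e : nat -> bool) n := [forall i, e (b i n) == sg i].

Definition signed_bit (e : nat -> bool) (x : nat * I) n : R :=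
  (-1) ^+ sg x.2 * (-1) ^+ e (b x.2 (n + x.1)).

Lemma pattern_atE e n : (pattern_at e n)%:R =
  2^-1 ^+ #|I| * \prod_i (1 + signed_bit e (0%N, i) n) :> R.
Proof.
rewrite -prodr_const -big_split/= /pattern_at.
case: (boolP [forall i, e (b i n) == sg i]) => [/forallP h|/forallPn[i hi]].
  rewrite big1 // => i _; rewrite /signed_bit /= addn0 (eqP (h i)).
  by rewrite -expr2 sqrr_sign; field.
rewrite (bigD1 i)//= /signed_bit /= addn0 -signr_addb.
by move: hi; case: (e _); case: (sg i) => //= _; rewrite expr1 subrr mulr0 mul0r.
Qed.

Lemma signed_bitE e x i n : signed_bit e (0%N, x) (n + i)%N = signed_bit e (i, x) n.
Proof. by rewrite /signed_bit /= addn0. Qed.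

Lemma exists_uncorrelated_signed_bits : exists e : nat -> bool,
  forall V : seq (nat * I), uniq V -> V <> [::] ->
    has_mean (fun n => \prod_(x <- V) signed_bit e x n) 0.
Proof.
have [M MP] := choice b_loc.
pose K (V : seq (nat * I)) := (\max_(x <- V) x.1)%N.
(* Starting at [M (K V)] makes the bits of one window distinct, and a shift does not change the
   mean. A code [v] of no nonempty duplicate-free [V] gets [[:: n]], which couples [n] with itself
   alone. *)
pose Wf V n := [seq b x.2 (n + M (K V) + x.1)%N | x <- V].
pose W v n := if unpickle v is Some V then
  if uniq V && (V != [::]) then Wf V n else [:: n] else [:: n].
pose C v := if unpickle v is Some V then (@size (nat * I) V).+1 else 1%N.
have le1 n N : (count (fun n' => ~~ [exists c : 'I_(\max_(i <- [:: n; n']) i).+1,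
     odd (count_mem (val c) [:: n; n'])]) (iota 0 N) <= 1)%N.
  rewrite -size_filter -[1%N]/(size [:: n]) uniq_leq_size ?filter_uniq ?iota_uniq// => n'.
  rewrite mem_filter inE => /andP[/existsPn h _]; apply/eqP; apply: contrapT => nn'.
  have nm : (n < (\max_(i <- [:: n; n']) i).+1)%N.
    by rewrite ltnS; apply: leq_bigmax_seq => //; rewrite mem_head.
  have := h (Ordinal nm); rewrite /= eqxx.
  by case: eqP.
have cntV (V : seq (nat * I)) n N : uniq V -> V != [::] ->
    (count (fun n' => ~~ [exists c : 'I_(\max_(i <- Wf V n ++ Wf V n') i).+1,
     odd (count_mem (val c) (Wf V n ++ Wf V n'))]) (iota 0 N) <= size V)%N.
  case: V => // x0 V' uV _; set V := x0 :: V' in uV *.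
  have uW : uniq (Wf V n).
    rewrite map_inj_in_uniq// => x y xV yV /= e.
    have xK : (x.1 <= K V)%N by exact: (leq_bigmax_seq (F := fst)).
    have yK : (y.1 <= K V)%N by exact: (leq_bigmax_seq (F := fst)).
    case: x y xV yV e xK yK => [x1 x2] [y1 y2] /= xV yV e xK yK.
    have le_M (z : nat) : (M (K V) <= n + M (K V) + z)%N by rewrite -addnA addnCA leq_addr.
    have le_K (z z' : nat) : (z <= K V)%N -> (n + M (K V) + z <= n + M (K V) + z' + K V)%N.
      by move=> zK; rewrite -[leqRHS]addnA leq_add2l (leq_trans zK)// leq_addl.
    by have [-> /addnI ->] := MP (K V) x2 y2 _ _ (le_M _) (le_M _) (le_K _ _ xK) (le_K _ _ yK) e.
  (* Any [n'] coupled to [n] also reads the bit [c], through some element of [V]; by injectivity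
     each element of [V] does so for one [n'] only. *)
  pose c := b x0.2 (n + M (K V) + x0.1)%N.
  pose f n' := nth x0 V (find (fun x => b x.2 (n' + M (K V) + x.1)%N == c) V).
  rewrite -size_filter; set s := seq.filter _ _.
  have us : uniq s by rewrite filter_uniq// iota_uniq.
  have fP n' : n' \in s -> f n' \in V /\ b (f n').2 (n' + M (K V) + (f n').1)%N = c.
    rewrite mem_filter => /andP[/existsPn h _].
    have hc : has (fun x => b x.2 (n' + M (K V) + x.1)%N == c) V.
      apply/negPn/negP => /hasPn nh.
      have cm : (c < (\max_(i <- Wf V n ++ Wf V n') i).+1)%N.
        by rewrite ltnS; apply: leq_bigmax_seq => //; rewrite mem_cat mem_head.
      have c1 : count_mem c (Wf V n) = 1%N by rewrite count_uniq_mem// mem_head.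
      have c0 : count_mem c (Wf V n') = 0%N.
        apply/count_memPn/negP => /mapP[x xV cx].
        by have := nh x xV; rewrite -cx eqxx.
      by have := h (Ordinal cm); rewrite count_cat [val _]/= c1 c0.
    by split; [rewrite mem_nth// -has_find|apply/eqP/(nth_find x0 hc)].
  rewrite -(size_map f); apply: uniq_leq_size.
    rewrite map_inj_in_uniq// => n1 n2 n1s n2s f12.
    have [_ e1] := fP n1 n1s; have [_ e2] := fP n2 n2s.
    by move: e1; rewrite -e2 f12 => /b_inj/addIn/addIn.
  by move=> _ /mapP[n' /fP[fV _] ->].
have WC v n N : (count (fun n' => ~~ decoupled W v n n') (iota 0 N) <= C v)%N.
  rewrite /decoupled /W /C; case: (unpickle v) => [V|]; last exact: le1.
  case: ifPn => [/andP[uV V0]|_]; last exact: leq_trans (le1 _ _) _.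
  by apply: leq_trans (leqnSn _); exact: cntV.
have [e eW] := exists_uncorrelated_bits R WC.
exists e => V uV V0.
have h1 x n : `|signed_bit e x n| <= 1.
  by rewrite /signed_bit normrM !normrX !normrN1 !expr1n mulr1.
apply: (has_mean_shift_inv (C := 1) (k := M (K V))).
  by move=> n; apply: le_trans (norm_prod_leX (D := 1) (lexx 1) (leqnn _) _) _; rewrite ?expr1n.
have := @has_meanZ _ (\prod_(x <- V) (-1) ^+ sg x.2) _ _ (eW (pickle V)).
rewrite mulr0; apply: eq_has_mean => n.
rewrite /W pickleK uV; have -> /= : V != [::] by apply/eqP.
rewrite /walsh big_map -big_split/=; apply: eq_bigr => x _.
by rewrite /signed_bit.
Qed.

Theorem exists_independent_pattern : exists e : nat -> bool,
  forall s : seq nat, uniq s ->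
    has_mean (fun n => \prod_(i <- s) ((pattern_at e (n + i))%:R : R))
      ((2^-1 ^+ #|I|) ^+ size s).
Proof.
have [e eV] := exists_uncorrelated_signed_bits; exists e => s us.
(* Expand the factors [1 + signed_bit] one by one: the head of [L] is dropped or moved to [V]. Of
   all the resulting products only the empty one has nonzero mean. *)
have mono (L V : seq (nat * I)) : uniq (L ++ V) ->
    has_mean (fun n => \prod_(x <- L) (1 + signed_bit e x n) *
      \prod_(x <- V) signed_bit e x n) (V == [::])%:R.
  elim: L V => [|x L IH] V /=.
    move=> uV; case: eqP => [->|V0].
      apply: (@eq_has_mean _ (fun=> 1)); last exact: has_mean_cst.
      by move=> n; rewrite !big_nil mulr1.
    apply: (@eq_has_mean _ (fun n => \prod_(x <- V) signed_bit e x n)).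
      by move=> n; rewrite big_nil mul1r.
    exact: eV.
  move=> /andP[xLV uLV].
  have h1 := IH V uLV.
  have h2 : uniq (L ++ x :: V).
    suff pe : perm_eq (L ++ x :: V) (x :: L ++ V) by rewrite (perm_uniq pe) /= xLV.
    by rewrite perm_catC /= perm_cons perm_catC.
  have := has_meanD h1 (IH _ h2); rewrite /= addr0; apply: eq_has_mean => n.
  by rewrite !big_cons; ring.
pose L := [seq (i, x) | i <- s, x <- enum I].
have uL : uniq L by rewrite allpairs_uniq ?enum_uniq// => -[? ?] [? ?].
have := mono L [::]; rewrite cats0 => /(_ uL) hm.
have := @has_meanZ _ ((2^-1 ^+ #|I|) ^+ size s) _ _ hm; rewrite mulr1.
apply: eq_has_mean => n; rewrite big_nil mulr1.
rewrite (eq_bigr (fun i => 2^-1 ^+ #|I| * \prod_x (1 + signed_bit e (i, x) n))); last first.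
  by move=> i _; rewrite pattern_atE; under eq_bigr do rewrite signed_bitE.
rewrite big_split/= big_const_seq count_predT iter_mulr_1; congr (_ * _).
rewrite big_allpairs_dep/=; apply: eq_bigr => i _.
by rewrite big_enum.
Qed.

End patterns.

Definition depends (A : Type) (K : nat) (g : (nat -> bool) -> A) :=
  forall x y, (forall i, (i < K)%N -> x i = y i) -> g x = g y.

Definition tail (a : nat -> bool) n : nat -> bool := fun i => a (n + i)%N.

(** Bernoulli frequencies with parameter [p]: the moments over distinct positions determine the
    frequencies of all finite patterns. *)
Definition independent_bits (a : nat -> bool) (p : R) := forall s : seq nat, uniq s ->
  has_mean (fun n => \prod_(i <- s) ((a (n + i)%N)%:R : R)) (p ^+ size s).

(** Multilinear interpolation in the last bit: [g = g0 + y K * (g1 - g0)], where [g0] and [g1] fix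
    that bit to 0 and 1. *)
Lemma depends_expand K (g : (nat -> bool) -> R) a : depends K g ->
  exists l : seq (R * seq nat), (forall t, t \in l -> uniq t.2 /\ {in t.2, forall i, (i < K)%N}) /\
    forall n, g (tail a n) = \sum_(t <- l) t.1 * \prod_(i <- t.2) (a (n + i)%N)%:R.
Proof.
elim: K g => [|K IH] g gK.
  exists [:: (g (fun=> false), [::])]; split; first by move=> t; rewrite inE => /eqP ->.
  by move=> n; rewrite big_seq1 big_nil mulr1; apply: gK.
pose up (c : bool) (x : nat -> bool) : nat -> bool := fun i => if i == K then c else x i.
have gup c : depends K (fun x => g (up c x)).
  move=> x y xy; apply: gK => i; rewrite ltnS leq_eqVlt /up.
  by case: eqP => //= _; exact: xy.
have [l1 [ul1 gl1]] := IH _ (gup true).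
have [l0 [ul0 gl0]] := IH _ (gup false).
pose ext (c : R) (l : seq (R * seq nat)) := [seq (c * t.1, K :: t.2) | t <- l].
exists (l0 ++ ext 1 l1 ++ ext (-1) l0); split.
  have extP c l t : (forall t, t \in l -> uniq t.2 /\ {in t.2, forall i, (i < K)%N}) ->
      t \in ext c l -> uniq t.2 /\ {in t.2, forall i, (i < K.+1)%N}.
    move=> lP /mapP[t' /lP[ut' t'K] ->] /=; split.
      by rewrite ut' andbT; apply/negP => /t'K; rewrite ltnn.
    by move=> i; rewrite inE => /predU1P[->|/t'K/ltnW].
  move=> t; rewrite !mem_cat => /or3P[/ul0[ut tK]|/(extP _ _ _ ul1)|/(extP _ _ _ ul0)]//.
  by split=> // i /tK/ltnW.
move=> n; rewrite !big_cat /= /ext !big_map /=.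
have sE c l : \sum_(t <- l) (c * t.1) * \prod_(i <- K :: t.2) ((a (n + i)%N)%:R : R) =
    c * (a (n + K)%N)%:R * \sum_(t <- l) t.1 * \prod_(i <- t.2) ((a (n + i)%N)%:R : R).
  by rewrite mulr_sumr; apply: eq_bigr => t _; rewrite big_cons; ring.
rewrite !sE -gl1 -gl0.
have -> : g (tail a n) = g (up (a (n + K)%N) (tail a n)).
  by apply: gK => i _; rewrite /up; case: eqP => // ->.
by case: (a _); rewrite /= ?mulr1n ?mulr0n; ring.
Qed.

Lemma has_mean_sum (T : eqType) (l : seq T) (u : T -> nat -> R) (m : T -> R) :
  (forall t, t \in l -> has_mean (u t) (m t)) ->
  has_mean (fun n => \sum_(t <- l) u t n) (\sum_(t <- l) m t).
Proof.
elim: l => [|t l IH] um.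
  rewrite big_nil; apply: (@eq_has_mean _ (fun=> 0)); last exact: has_mean_cst.
  by move=> n; rewrite big_nil.
rewrite big_cons; apply: (@eq_has_mean _ (fun n => u t n + \sum_(t <- l) u t n)).
  by move=> n; rewrite big_cons.
apply: has_meanD; first by apply: um; rewrite mem_head.
by apply: IH => t' t'l; apply: um; rewrite inE t'l orbT.
Qed.

Definition bits_monomial (a : nat -> bool) (s : seq nat) n : R :=
  \prod_(i <- s) (a (n + i)%N)%:R.

Lemma depends_bounded K (g : (nat -> bool) -> R) a : depends K g ->
  exists C : R, forall n, `|g (tail a n)| <= C.
Proof.
move=> gK; have [l [_ gl]] := depends_expand a gK.
exists (\sum_(t <- l) `|t.1|) => n; rewrite gl.
apply: le_trans (ler_norm_sum _ _ _) _; apply: ler_sum => t _.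
rewrite normrM ler_piMr//; apply: le_trans (norm_prod_leX (D := 1) (lexx 1) (leqnn _) _) _.
  by move=> i _; case: (a _); rewrite /= ?mulr1n ?mulr0n ?normr1 ?normr0.
by rewrite expr1n.
Qed.

Lemma independent_bits_poly a p K (l : seq (R * seq nat)) : independent_bits a p ->
  (forall t, t \in l -> uniq t.2 /\ {in t.2, forall i, (i < K)%N}) ->
  has_mean (fun n => \sum_(t <- l) t.1 * bits_monomial a t.2 n)
    (\sum_(t <- l) t.1 * p ^+ size t.2).
Proof.
move=> ap ul; apply: has_mean_sum => t /ul[ut _].
by apply: has_meanZ; exact: ap.
Qed.

Lemma independent_bits_mean a p K (g : (nat -> bool) -> R) :
  independent_bits a p -> depends K g -> exists m, has_mean (fun n => g (tail a n)) m.
Proof.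
move=> ap gK; have [l [ul gl]] := depends_expand a gK.
exists (\sum_(t <- l) t.1 * p ^+ size t.2).
apply: eq_has_mean (independent_bits_poly ap ul) => n.
by rewrite gl.
Qed.

(** The shift by [K] puts the monomials of [h] on positions disjoint from those of [g], so their
    moments multiply. *)
Lemma independent_bits_mul a p K L (g h : (nat -> bool) -> R) (m m' : R) :
  independent_bits a p -> depends K g -> depends L h ->
  has_mean (fun n => g (tail a n)) m -> has_mean (fun n => h (tail a n)) m' ->
  has_mean (fun n => g (tail a n) * h (tail a (n + K)%N)) (m * m').
Proof.
move=> ap gK hL gm hm.
have [l [ul gl]] := depends_expand a gK.
have [l' [ul' hl]] := depends_expand a hL.
have -> : m = \sum_(t <- l) t.1 * p ^+ size t.2.
  apply: (has_mean_unique gm); apply: eq_has_mean (independent_bits_poly ap ul) => n.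
  by rewrite gl.
have -> : m' = \sum_(t <- l') t.1 * p ^+ size t.2.
  apply: (has_mean_unique hm); apply: eq_has_mean (independent_bits_poly ap ul') => n.
  by rewrite hl.
apply: (@eq_has_mean _ (fun n => \sum_(t <- l) \sum_(t' <- l')
  (t.1 * t'.1) * bits_monomial a (t.2 ++ [seq (K + i)%N | i <- t'.2]) n)).
  move=> n; rewrite gl hl mulr_suml; apply: eq_bigr => t _.
  rewrite mulr_sumr; apply: eq_bigr => t' _.
  rewrite /bits_monomial big_cat big_map /=.
  have e : \prod_(j <- t'.2) (a (n + (K + j))%N)%:R =
      \prod_(j <- t'.2) (a (n + K + j)%N)%:R :> R.
    by apply: eq_bigr => j _; rewrite addnA.
  by rewrite e; ring.
rewrite mulr_suml; apply: has_mean_sum => t /ul[ut tK].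
rewrite mulr_sumr; apply: has_mean_sum => t' /ul'[ut' t'L].
rewrite mulrACA -exprD.
have -> : (size t.2 + size t'.2)%N = size (t.2 ++ [seq (K + i)%N | i <- t'.2]).
  by rewrite size_cat size_map.
apply: has_meanZ; apply: ap.
rewrite cat_uniq ut map_inj_uniq ?ut' ?andbT; last exact: addnI.
apply/hasPn => _ /mapP[i _ ->]; apply/negP => /tK.
by rewrite ltnNge leq_addr.
Qed.

(* Windows of the sequence separated by a gap of [S] are exactly independent; this
   is what a coding by [S.+1] consecutive bits leaves of independence. *)
Definition mixing_bits (S : nat) (x : nat -> bool) :=
  (forall K (g : (nat -> bool) -> R), depends K g -> exists m, has_mean (fun n => g (tail x n)) m) /\
  (forall K L (g h : (nat -> bool) -> R) (m m' : R), depends K g -> depends L h ->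
    has_mean (fun n => g (tail x n)) m -> has_mean (fun n => h (tail x n)) m' ->
    has_mean (fun n => g (tail x n) * h (tail x (n + (K + S))%N)) (m * m')).

(** A window of [K] coded bits reads [K + S] source bits, so the gap [S] makes source windows
    disjoint. The coding need hold only from [C] on, since means ignore finitely many terms. *)
Lemma mixing_bits_code a p S C (f : (nat -> bool) -> bool) (x : nat -> bool) :
  independent_bits a p -> depends S.+1 f ->
  (forall n, (C <= n)%N -> x n = f (tail a n)) -> mixing_bits S x.
Proof.
move=> ap fS xf.
pose code (y : nat -> bool) i := f (tail y i).
have codeE n : (C <= n)%N -> tail x n = code (tail a n).
  move=> Cn; apply/funext => i; rewrite /code /tail xf ?(leq_trans Cn) ?leq_addr//.
  by congr f; apply/funext => j; rewrite /tail addnA.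
have gcode K (g : (nat -> bool) -> R) : depends K g -> depends (K + S)%N (g \o code).
  move=> gK y z yz; apply: gK => i iK; apply: fS => j jS; apply: yz.
  by lia.
have near K (g : (nat -> bool) -> R) m : depends K g ->
    has_mean (fun n => g (tail x n)) m <-> has_mean (fun n => (g \o code) (tail a n)) m.
  move=> gK; have [D1 gD1] := depends_bounded x gK.
  have [D2 gD2] := depends_bounded a (gcode _ _ gK).
  have b1 n : `|g (tail x n)| <= Num.max D1 D2 by rewrite le_max gD1.
  have b2 n : `|(g \o code) (tail a n)| <= Num.max D1 D2 by rewrite le_max gD2 orbT.
  split; [apply: (has_mean_near (k := C) b1 b2)|apply: (has_mean_near (k := C) b2 b1)];
    by move=> n Cn; rewrite /= codeE.
split=> [K g gK|K L g h m m' gK hL gm hm].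
  have [m gm] := independent_bits_mean ap (gcode _ _ gK).
  by exists m; apply/(near _ _ _ gK).
have gm' := (near _ _ _ gK).1 gm; have hm' := (near _ _ _ hL).1 hm.
have := independent_bits_mul ap (gcode _ _ gK) (gcode _ _ hL) gm' hm'.
have [D1 gD1] := depends_bounded x gK; have [D2 hD2] := depends_bounded x hL.
have [D3 gD3] := depends_bounded a (gcode _ _ gK).
have [D4 hD4] := depends_bounded a (gcode _ _ hL).
apply: (has_mean_near (k := C) (C := Num.max (D1 * D2) (D3 * D4))).
- by move=> n; rewrite le_max normrM orbC (ler_pM _ _ (gD3 _) (hD4 _)).
- by move=> n; rewrite le_max normrM (ler_pM _ _ (gD1 _) (hD2 _)).
- by move=> n Cn; rewrite /= !codeE// (leq_trans Cn)// leq_addr.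
Qed.

(** Keeps a one only if the next [S] bits are zero, so no two kept positions are at distance between
    1 and [S]. *)
Definition thin S (y : nat -> bool) : bool := y 0%N && ~~ has y (iota 1 S).

Lemma depends_thin S : depends S.+1 (thin S).
Proof.
move=> x y xy; rewrite /thin xy//; congr (_ && ~~ _); apply: eq_in_has => i.
by rewrite mem_iota add1n => /andP[_ iS]; exact: xy.
Qed.

Lemma mean_thin a p S : independent_bits a p ->
  has_mean (fun n => (thin S (tail a n))%:R) (p * (1 - p) ^+ S).
Proof.
move=> ap.
have a1 : has_mean (fun n => (tail a n 0%N)%:R) p.
  by apply: eq_has_mean (ap [:: 0%N] isT) => n; rewrite big_seq1.
pose none k (y : nat -> bool) : R := \prod_(i <- iota 0 k) (1 - (y i)%:R).
have noneK k : depends k (none k).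
  by move=> x y xy; apply: eq_big_seq => i; rewrite mem_iota => /andP[_ ik]; rewrite xy.
have none_mean k : has_mean (fun n => none k (tail a n)) ((1 - p) ^+ k).
  elim: k => [|k IH].
    rewrite expr0; apply: (@eq_has_mean _ (fun=> 1)); last exact: has_mean_cst.
    by move=> n; rewrite /none big_nil.
  pose g (y : nat -> bool) : R := 1 - (y 0%N)%:R.
  have g1 : depends 1 g by move=> x y xy; rewrite /g xy.
  have gm : has_mean (fun n => g (tail a n)) (1 - p).
    by apply: has_meanB => //; exact: has_mean_cst.
  rewrite exprS; apply: eq_has_mean (independent_bits_mul ap g1 (noneK k) gm IH) => n.
  rewrite /none /= big_cons; congr (_ * _).
  rewrite -[1%N]/(1 + 0)%N iotaDl big_map; apply: eq_bigr => i _.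
  by rewrite /tail addn0 addnA.
have g1 : depends 1 (fun y : nat -> bool => (y 0%N)%:R : R) by move=> x y ->.
apply: eq_has_mean (independent_bits_mul ap g1 (noneK S) a1 (none_mean S)) => n.
rewrite /thin; case: (tail a n 0%N) => /=; last by rewrite mul0r.
rewrite mul1r /none.
rewrite -[1%N in RHS]/(1 + 0)%N iotaDl has_map.
elim: (iota 0 S) => [|i s IH]; first by rewrite big_nil.
rewrite big_cons IH /= /tail -addnA; case: (a _) => /=; first by rewrite subrr mul0r.
by rewrite subr0 mul1r.
Qed.

End independent_patterns.

(** * Mixing sets avoiding affine relations *)

Section avoiding_relations.
Variable R : realType.

Section edges.
Variable rels : seq (rat * rat).
Hypothesis rels_q : forall r, r \in rels -> 0 < r.1 /\ r.1 != 1.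

Definition preimage_of (r : rat * rat) (n : nat) : option nat :=
  if pselect (exists x : nat, n%:R = r.1 * x%:R + r.2) is left h
  then Some (projT1 (cid h)) else None.

Lemma preimage_ofP r n x : preimage_of r n = Some x -> n%:R = r.1 * x%:R + r.2.
Proof.
by rewrite /preimage_of; case: pselect => // h [<-]; case: (cid h).
Qed.

Lemma preimage_ofE r n x : r.1 != 0 -> n%:R = r.1 * x%:R + r.2 -> preimage_of r n = Some x.
Proof.
move=> r0 nx; rewrite /preimage_of; case: pselect => [h|[]]; last by exists x.
congr Some; case: (cid h) => y /=; rewrite nx => /addIr/(mulfI r0)/eqP.
by rewrite eqr_nat => /eqP.
Qed.

(* One random orientation per edge [x -- q x + s]: the bit [(true, t, x)] is
   read by both endpoints, which demand opposite values.  The bits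
   [(false, t, n)] keep the number of bits read by each [n] constant. *)
Definition edge_bit (i : 'I_(size rels) * bool) (n : nat) : nat :=
  if i.2 then pickle (true, i.1, n) else
  if preimage_of (tnth (in_tuple rels) i.1) n is Some x then pickle (true, i.1, x)
  else pickle (false, i.1, n).

Lemma edge_bit_inj i : injective (edge_bit i).
Proof.
case: i => t [] m n; rewrite /edge_bit /=.
  by move=> /(pcan_inj pickleK) [].
case: (preimage_of _ m) (@preimage_ofP (tnth (in_tuple rels) t) m) => [x|] xP;
case: (preimage_of _ n) (@preimage_ofP (tnth (in_tuple rels) t) n) => [y|] yP
  => /(pcan_inj pickleK) [] //.
move=> xy; have := xP x erefl; rewrite xy -(yP y erefl) => /eqP.
by rewrite eqr_nat => /eqP.
Qed.

(** If [m = q x + s] is within [K] of [x], then [|q - 1| x <= K + |s|], which bounds [x] as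
    [q <> 1]. *)
Lemma edge_far (K : nat) : exists M, forall t (m x : nat), (M <= x)%N ->
  m%:R = (tnth (in_tuple rels) t).1 * x%:R + (tnth (in_tuple rels) t).2 ->
  (m <= x + K)%N -> (x <= m + K)%N -> False.
Proof.
pose B (r : rat * rat) := Num.bound ((K%:R + `|r.2|) / `|r.1 - 1|).
exists (\max_(t < size rels) B (tnth (in_tuple rels) t))%N => t m x.
set r := tnth _ t => Mx mx mxK xmK.
have r1 : r.1 != 1 by have [] := rels_q (mem_tnth t (in_tuple rels)).
have Bx : (B r <= x)%N by apply: leq_trans Mx; exact: (leq_bigmax (F := fun t => B (tnth (in_tuple rels) t))).
have r1' : 0 < `|r.1 - 1| by rewrite normr_gt0 subr_eq0.
have : (K%:R + `|r.2|) / `|r.1 - 1| < x%:R.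
  apply: lt_le_trans (archi_boundP _) _; first by rewrite divr_ge0 ?addr_ge0.
  by rewrite ler_nat.
rewrite ltr_pdivrMr// ltNge => /negP; apply.
rewrite -[x%:R]ger0_norm// -normrM.
have -> : x%:R * (r.1 - 1) = (m%:R - x%:R) - r.2 by rewrite mx; ring.
apply: le_trans (ler_normB _ _) _; rewrite lerD2r ler_norml.
have h1 : m%:R <= x%:R + K%:R :> rat by rewrite -natrD ler_nat.
have h2 : x%:R <= m%:R + K%:R :> rat by rewrite -natrD ler_nat.
by apply/andP; split; lra.
Qed.

(** A bit read twice in the same role comes from one position; read in opposite roles, it comes from
    the two ends of an edge, which are far apart. *)
Lemma edge_bit_loc K : exists M, forall i j m n, (M <= m)%N -> (M <= n)%N ->
  (m <= n + K)%N -> (n <= m + K)%N -> edge_bit i m = edge_bit j n -> i = j /\ m = n.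
Proof.
have [M MP] := edge_far K; exists M => -[t c] [t' c'] m n Mm Mn mn nm.
rewrite /edge_bit /=; case: c; case: c'.
- by move=> /(pcan_inj pickleK) [-> ->].
- case: (preimage_of _ n) (@preimage_ofP (tnth (in_tuple rels) t') n) => [y|] yP
    /(pcan_inj pickleK) [] // tt' my.
  by have [] := MP t' n y _ (yP y erefl); rewrite -?my.
- case: (preimage_of _ m) (@preimage_ofP (tnth (in_tuple rels) t) m) => [y|] yP
    /(pcan_inj pickleK) [] // tt' ny.
  by have [] := MP t m y _ (yP y erefl); rewrite ?ny.
case: (preimage_of _ m) (@preimage_ofP (tnth (in_tuple rels) t) m) => [x|] xP;
case: (preimage_of _ n) (@preimage_ofP (tnth (in_tuple rels) t') n) => [y|] yP
  /(pcan_inj pickleK) [] //.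
  move=> tt' xy; split; first by rewrite tt'.
  apply/eqP; rewrite -(eqr_nat rat) (xP x erefl) (yP y erefl).
  by rewrite tt' xy.
by move=> -> ->.
Qed.

Lemma pattern_avoids e r (x y : nat) : r \in rels ->
  pattern_at edge_bit snd e x -> pattern_at edge_bit snd e y ->
  y%:R != r.1 * x%:R + r.2.
Proof.
move=> rr /forallP ex /forallP ey; apply/eqP => yx.
have /tnthP[t rt] : r \in in_tuple rels by [].
have := ex (t, true); have := ey (t, false); rewrite /edge_bit /= -rt.
rewrite (preimage_ofE _ yx); last by rewrite gt_eqF//; have [] := rels_q rr.
by move=> /eqP ->.
Qed.

End edges.

Theorem exists_mixing_set_avoiding (rels : seq (rat * rat)) (C : nat) :
  (forall r, r \in rels -> 0 < r.1 /\ r != (1, 0)) ->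
  exists A : set nat, [/\ A `<=` [set n | (C < n)%N],
    forall r x y, r \in rels -> A x -> A y -> y%:R != r.1 * x%:R + r.2,
    exists s, mixing_bits R s (char_seq A) &
    exists2 d : R, has_mean \1_A d & 0 < d].
Proof.
move=> relsP.
(* The extra relation [(2, 0)] ensures that there is an edge, so that [p < 1] and the thinned set
   keeps positive density. *)
pose rels' : seq (rat * rat) := (2, 0) :: [seq r <- rels | r.1 != 1].
have rels'P r : r \in rels' -> 0 < r.1 /\ r.1 != 1.
  by rewrite inE mem_filter => /predU1P[->|/andP[-> /relsP[]]].
have [e ep] := @exists_independent_pattern R _ (@edge_bit rels') snd
  (@edge_bit_inj rels') (edge_bit_loc rels'P).
set a := pattern_at _ _ _ in ep; set p : R := 2^-1 ^+ _ in ep.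
have p0 : 0 < p by rewrite exprn_gt0.
have p1 : p < 1.
  rewrite /p exprn_ilt1 ?invr_ge0 ?invf_lt1 ?ltr1n//.
  by rewrite card_prod card_bool card_ord muln_eq0.
(* Large enough for every translation length in [rels] to be at most [S]. *)
pose S := (\max_(r <- rels) Num.bound `|r.2|)%N.
pose A : set nat := [set n | (C < n)%N && thin S (tail a n)].
exists A; split.
- by move=> n /andP[].
- move=> r x y rr /andP[_ Ax] /andP[_ Ay].
  have [r1|r1] := eqVneq r.1 1; last first.
    apply: (pattern_avoids rels'P (e := e) (r := r)).
    + by rewrite inE mem_filter r1 rr orbT.
    + by move: Ax => /andP[]; rewrite /tail addn0.
    + by move: Ay => /andP[]; rewrite /tail addn0.
  have [_ r10] := relsP r rr; rewrite r1 mul1r.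
  have far u v : thin S (tail a u) -> thin S (tail a v) -> v%:R = u%:R + `|r.2| -> False.
    move=> /andP[_ /hasPn h] /andP[av _] uv.
    have uv' : (u < v)%N.
      rewrite -(ltr_nat rat) uv ltrDl normr_gt0; apply: contra r10 => /eqP r2.
      by apply/eqP; case: (r) r1 r2 => ? ? /= -> ->.
    have dS : (v - u <= S)%N.
      have rS : (Num.bound `|r.2| <= S)%N.
        by apply: (leq_bigmax_seq (F := fun r : rat * rat => Num.bound `|r.2|)).
      apply: leq_trans rS.
      rewrite -(ler_nat rat) natrB 1?ltnW// uv addrAC subrr add0r ltW//.
      exact: archi_boundP.
    have := h (v - u)%N; rewrite mem_iota add1n ltnS dS subn_gt0 uv' => /(_ isT).
    by rewrite /tail subnKC 1?ltnW//; move: av; rewrite /tail addn0 => ->.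
  apply/eqP => yx; case: (leP 0 r.2) => [r2|/ltW r2].
    by apply: (far x y) => //; rewrite ger0_norm.
  by apply: (far y x) => //; rewrite ler0_norm// yx addrK.
- exists S; apply: (mixing_bits_code (C := C.+1) (f := thin S) ep).
    exact: depends_thin.
  move=> n Cn; rewrite /char_seq /A /= Cn /=; exact: asboolb.
- exists (p * (1 - p) ^+ S); last by rewrite mulr_gt0// exprn_gt0// subr_gt0.
  have indA n : \1_A n = ((C < n)%N && thin S (tail a n))%:R :> R.
    by rewrite indicE /A mem_setE.
  have hm := mean_thin (S := S) ep.
  have b1 n : `|(thin S (tail a n))%:R| <= 1 :> R.
    by case: thin; rewrite /= ?mulr1n ?mulr0n ?normr1 ?normr0.
  have b2 n : `|\1_A n| <= 1 :> R.
    by rewrite indA; case: andb; rewrite /= ?mulr1n ?mulr0n ?normr1 ?normr0.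
  apply: (has_mean_near (k := C.+1) b1 b2 _ hm) => n Cn.
  by rewrite indA Cn.
Qed.

End avoiding_relations.

(** * Weak mixing from exact mixing on a generating family *)

Lemma restricted_image_measure_unique (R : realType) (d d' : measure_display)
    (Y : measurableType d) (X : measurableType d') (P : {measure set Y -> \bar R})
    (m : {measure set X -> \bar R}) (f : Y -> X) (C : set Y) (r : R) (G : set (set X)) :
  measurable_fun setT f -> measurable C -> (P C < +oo)%E -> 0 <= r ->
  measurable = <<s G >> -> setI_closed G -> G setT ->
  (forall D, G D -> P (f @^-1` D `&` C) = (r%:E * m D)%E) ->
  forall B, measurable B -> P (f @^-1` B `&` C) = (r%:E * m B)%E.
Proof.
move=> mf mC PC r0 mG GI GT PG B mB.
pose m1 := mrestr P mC.
(* Both sides are measures in [B], the left one finite, that agree on a generating family closed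
   under intersection. *)
have := @measure_unique _ _ _ G (fun=> setT) mG GI (fun=> GT) _
  (pushforward m1 f) (mscale (NngNum r0) m).
apply => //; first by rewrite bigcup_const.
move=> _; rewrite -[X in (X < _)%E]/(P (f @^-1` setT `&` C)).
by rewrite preimage_setT setTI.
Qed.

Section product_mixing.
Context (R : realType) (d : measure_display) (X : measurableType d).
Variables (nu : probability X R) (T : X -> X) (G : set (set X)).
Hypothesis mT : measurable_fun setT T.
Hypothesis mG : @measurable d X = <<s G >>.
Hypothesis GI : setI_closed G.
Hypothesis GT : G setT.

Let P : {measure set (X * X) -> \bar R} := (nu \x nu)%E.

Let P_lty C : measurable C -> (P C < +oo)%E.
Proof.
move=> mC; apply: (@le_lt_trans _ _ (P setT)); first by apply: le_measure; rewrite ?inE.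
by rewrite [P setT]square_setT ltry.
Qed.

Let mGG A : G A -> measurable A.
Proof. by move=> GA; rewrite mG; exact: sub_sigma_algebra. Qed.

(** Uniqueness one coordinate at a time: [D1], then [D2], is released from [G] to all measurable
    sets, and measurable rectangles generate the product. *)
Lemma square_measure_unique (F : X * X -> X * X) (C : set (X * X)) (r : R) :
  measurable_fun setT F -> measurable C -> 0 <= r ->
  (forall D1 D2, G D1 -> G D2 ->
    P (F @^-1` (D1 `*` D2) `&` C) = (r%:E * (nu D1 * nu D2))%E) ->
  forall B, measurable B -> P (F @^-1` B `&` C) = (r%:E * P B)%E.
Proof.
move=> mF mC r0 PG.
have mF1 : measurable_fun setT (fst \o F) by exact: measurableT_comp.
have mF2 : measurable_fun setT (snd \o F) by exact: measurableT_comp.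
have mpre (g : X * X -> X) D : measurable_fun setT g -> measurable D -> measurable (g @^-1` D).
  by move=> mg mD; rewrite -[X in measurable X]setTI; exact: mg.
have step1 D1 D2 : measurable D1 -> G D2 ->
    P (F @^-1` (D1 `*` D2) `&` C) = (r%:E * (nu D1 * nu D2))%E.
  move=> mD1 GD2; have mD2 := mGG GD2.
  have nD2 : nu D2 = (fine (nu D2))%:E by rewrite fineK// fin_num_measure.
  have mC' : measurable ((snd \o F) @^-1` D2 `&` C) by apply: measurableI => //; exact: mpre.
  have := @restricted_image_measure_unique _ _ _ _ _ P nu (fst \o F) _ (r * fine (nu D2)) G
    mF1 mC' (P_lty mC') _ mG GI GT _ D1 mD1.
  rewrite setIA EFinM -nD2 => -> //; first by rewrite muleAC muleA.
    by rewrite mulr_ge0// fine_ge0.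
  move=> D GD; rewrite setIA -[X in P (X `&` C)]/(F @^-1` (D `*` D2)) PG//.
  by rewrite muleAC muleA.
have step2 D1 D2 : measurable D1 -> measurable D2 ->
    P (F @^-1` (D1 `*` D2) `&` C) = (r%:E * (nu D1 * nu D2))%E.
  move=> mD1 mD2.
  have nD1 : nu D1 = (fine (nu D1))%:E by rewrite fineK// fin_num_measure.
  have mC' : measurable ((fst \o F) @^-1` D1 `&` C) by apply: measurableI => //; exact: mpre.
  have := @restricted_image_measure_unique _ _ _ _ _ P nu (snd \o F) _ (r * fine (nu D1)) G
    mF2 mC' (P_lty mC') _ mG GI GT _ D2 mD2.
  have swap D : F @^-1` (D1 `*` D) `&` C = (snd \o F) @^-1` D `&` ((fst \o F) @^-1` D1 `&` C).
    by rewrite setICA setIA.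
  rewrite swap EFinM -nD1 => -> //; first by rewrite muleA.
    by rewrite mulr_ge0// fine_ge0.
  by move=> D GD; rewrite -swap step1// muleA.
have sT : [set A `*` B | A in @measurable _ X & B in @measurable _ X] setT.
  by exists setT => //; exists setT => //; rewrite setXTT.
apply: (restricted_image_measure_unique mF mC (P_lty mC) r0
  (measurable_prod_measurableType _ _) _ sT).
  move=> _ _ [A1 mA1 [A2 mA2 <-]] [B1 mB1 [B2 mB2 <-]]; rewrite -setXI.
  by exists (A1 `&` B1); [exact: measurableI|exists (A2 `&` B2) => //; exact: measurableI].
by move=> _ [D1 mD1 [D2 mD2 <-]]; rewrite step2// [P _]product_measure1E.
Qed.

Hypothesis mixG : forall A, G A -> exists N, forall n, (N <= n)%N -> forall D, G D ->
  nu (A `&` iter n T @^-1` D) = (nu A * nu D)%E.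

(** For large [n] the preimage of any measurable set under the [n]-th iterate is independent of a
    given rectangle with sides in [G]. An invariant [B] is thus independent of all such rectangles
    and, by uniqueness once more, of itself: [P B = P B * P B]. *)
Theorem mixing_weakly_mixing : weakly_mixing nu T.
Proof.
move=> B mB invB.
pose TT (p : X * X) := (T p.1, T p.2).
have mTT : measurable_fun setT TT := measurable_square_map mT.
have mTTn n : measurable_fun setT (iter n TT).
  by elim: n => [|n IH]; [exact: measurable_id|exact: (measurableT_comp mTT IH)].
have invBn n : iter n TT @^-1` B = B.
  elim: n => // n IH; rewrite -[RHS]IH -[in RHS]invB.
  by apply/seteqP; split => p /=.
have iterTT n p : iter n TT p = (iter n T p.1, iter n T p.2).
  by elim: n => [|n /= ->] //; case: p.
have finP C : measurable C -> P C = (fine (P C))%:E.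
  by move=> mC; rewrite fineK// ge0_fin_numE// P_lty.
have PBC A1 A2 : G A1 -> G A2 -> P (A1 `*` A2 `&` B) = (P B * (nu A1 * nu A2))%E.
  move=> GA1 GA2; have mA1 := mGG GA1; have mA2 := mGG GA2.
  have [N1 N1P] := mixG GA1; have [N2 N2P] := mixG GA2.
  pose n := maxn N1 N2.
  have mC : measurable (A1 `*` A2) by exact: measurableX.
  have r0 : 0 <= fine (P (A1 `*` A2)) by rewrite fine_ge0.
  have PC : P (A1 `*` A2) = (nu A1 * nu A2)%E by exact: product_measure1E.
  have := @square_measure_unique (iter n TT) (A1 `*` A2) _ (mTTn n) mC r0 _ B mB.
  suff PG D1 D2 : G D1 -> G D2 -> P (iter n TT @^-1` (D1 `*` D2) `&` A1 `*` A2) =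
      ((fine (P (A1 `*` A2)))%:E * (nu D1 * nu D2))%E.
    by move=> /(_ PG); rewrite invBn -finP// setIC PC muleC.
  move=> GD1 GD2; rewrite -finP// PC.
  have -> : iter n TT @^-1` (D1 `*` D2) `&` A1 `*` A2 =
      (A1 `&` iter n T @^-1` D1) `*` (A2 `&` iter n T @^-1` D2).
    apply/seteqP; split => [[x y]|[x y]] /=; rewrite iterTT /=; by move=> [[? ?] [? ?]].
  have mD k D : G D -> measurable (iter k T @^-1` D).
    move=> GD; have : measurable_fun setT (iter k T).
      by elim: k => [|k IH]; [exact: measurable_id|exact: (measurableT_comp mT IH)].
    by move=> mk; rewrite -[X in measurable X]setTI; apply: mk => //; exact: mGG.
  transitivity (nu (A1 `&` iter n T @^-1` D1) * nu (A2 `&` iter n T @^-1` D2))%E.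
    by apply: product_measure1E; apply: measurableI => //; exact: mD.
  by rewrite N1P ?leq_maxl// N2P ?leq_maxr// muleACA.
have r0 : 0 <= fine (P B) by rewrite fine_ge0.
have := @square_measure_unique id B _ (@measurable_id _ _ _) mB r0 _ B mB.
rewrite preimage_id setIid -finP// => h.
have {}h : P B = (P B * P B)%E by apply: h => D1 D2 GD1 GD2; rewrite preimage_id; exact: PBC.
move: h; rewrite finP// -EFinM => -[h].
have : fine (P B) * (1 - fine (P B)) = 0 by rewrite mulrBr mulr1 -h subrr.
move=> /eqP; rewrite mulf_eq0 => /orP[/eqP h0|]; first by left; rewrite [LHS]finP// h0.
by rewrite subr_eq0 => /eqP h1; right; rewrite [LHS]finP// -h1.
Qed.

End product_mixing.

(** * The invariant measure on the orbit closure *)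

Section cylinder_sets.
Variable xi : cantor_space.
Let X := orbit_closure xi.
Let T : X -> X := @orbit_shift xi.
Let x0 : X := orbit_base xi.

Definition agree K (w w' : orbit_closure xi) := forall i, (i < K)%N -> val w i = val w' i.

Definition cylfun (A : Type) K (F : orbit_closure xi -> A) :=
  forall w w', agree K w w' -> F w = F w'.

Definition cylset (A : set (orbit_closure xi)) := exists K, cylfun K A.

Lemma orbit_nbhs_prefix (w : X) U : nbhs w U -> exists K, forall w', agree K w w' -> U w'.
Proof.
move=> [V [[W oW <-] Ww WU]].
have nW : nbhs (val w : cantor_space) W by apply: open_nbhs_nbhs; split.
pose FF := filter_from [set: nat]
  (fun K => [set y : cantor_space | forall i, (i < K)%N -> y i = val w i]).
have FFF : Filter FF.
  apply: filter_from_filter; first by exists 0%N.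
  move=> K K' _ _; exists (maxn K K') => // y yw.
  by split=> i iK; apply: yw; rewrite leq_max iK ?orbT.
have [K _ KW] : FF W.
  suff : FF --> (val w : cantor_space) by apply.
  apply/cvg_sup => i B [V' [[W' oW' <-] W'w W'B]].
  exists i.+1 => // y /(_ i (ltnSn i)) yi; apply: W'B.
  by rewrite /= yi.
exists K => w' ww'; apply: WU; apply: KW => i iK /=.
by rewrite ww'.
Qed.

Lemma nbhs_agree K (w : X) : nbhs w [set w' | agree K w w'].
Proof.
have c1 : continuous (set_val : orbit_closure xi -> cantor_space).
  exact: initial_continuous.
have := c1 w _ (@cantor_nbhs_prefix (val w) K); rewrite !nbhs_simpl /=.
by apply: (@filterS _ (nbhs w)) => w' ww' i iK; exact: esym (ww' i iK).
Qed.

Lemma orbit_cluster (u : nat -> X) : exists w : X, forall K M, exists2 N, (M <= N)%N & agree K w (u N).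
Proof.
have [w [_ cw]] := @orbit_closure_compact xi ((u : nat -> orbit_closure xi) @ \oo) _ filterT.
exists w => K M.
have [_ [[N MN <-] wN]] : [set u N | N in [set N | (M <= N)%N]] `&` [set w' | agree K w w'] !=set0.
  apply: cw; last exact: nbhs_agree.
  by exists M => // N /= MN; exists N.
by exists N.
Qed.

Lemma cylfunW (A : Type) K K' (F : X -> A) : (K <= K')%N -> cylfun K F -> cylfun K' F.
Proof. by move=> KK' FK w w' ww'; apply: FK => i iK; apply: ww'; exact: leq_trans KK'. Qed.

Lemma cylfun_comp2 (A B C : Type) (h : A -> B -> C) K K' (F : X -> A) (G : X -> B) :
  cylfun K F -> cylfun K' G -> cylfun (maxn K K') (fun w => h (F w) (G w)).
Proof.
move=> /(cylfunW (leq_maxl K K')) FK /(cylfunW (leq_maxr K K')) GK w w' ww'.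
by rewrite (FK _ _ ww') (GK _ _ ww').
Qed.

Lemma cylset0 : cylset set0. Proof. by exists 0%N. Qed.

Lemma cylsetT : cylset setT. Proof. by exists 0%N. Qed.

Lemma cylsetU : setU_closed cylset.
Proof. by move=> A B [K AK] [L BL]; exists (maxn K L); exact: cylfun_comp2. Qed.

Lemma cylsetI : setI_closed cylset.
Proof. by move=> A B [K AK] [L BL]; exists (maxn K L); exact: cylfun_comp2. Qed.

Lemma cylsetC : setC_closed cylset.
Proof. by move=> A [K AK]; exists K => w w' ww'; rewrite /setC /mkset (AK _ _ ww'). Qed.

Lemma cylset_open A : cylset A -> open (A : set X).
Proof.
move=> [K AK]; rewrite openE => w Aw; rewrite /interior.
by apply: filterS (nbhs_agree K w) => w' ww'; rewrite -(AK _ _ ww').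
Qed.

Lemma sigma_cylset : <<s cylset >> = <<s @open X >>.
Proof.
apply/seteqP; split; apply: smallest_sub; try exact: smallest_sigma_algebra.
  by move=> A cA; apply: sub_sigma_algebra; exact: cylset_open.
move=> U oU.
(* The [K]-th set collects the points whose whole cylinder of length [K] lies in [U]; it is itself a
   cylinder set. *)
have -> : U = \bigcup_K [set w | forall w', agree K w w' -> U w'].
  apply/seteqP; split => [w Uw|w [K _]]; last by apply.
  have [K KU] := orbit_nbhs_prefix (open_nbhs_nbhs (conj oU Uw)).
  by exists K.
apply: (@bigcupT_measurable _ (g_sigma_algebraType cylset)) => K.
apply: sub_sigma_algebra; exists K => w w' ww'; apply/propext; split => h v wv; apply: h => i iK.
  by rewrite ww'// wv.
by rewrite -ww'// wv.
Qed.

Lemma cylfun_iter_shift (A : Type) K n (F : X -> A) : cylfun K F -> cylfun (K + n) (F \o iter n T).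
Proof.
move=> FK w w' ww'; apply: FK => i iK; rewrite !val_iter_orbit_shift.
by apply: ww'; rewrite ltn_add2r.
Qed.

Lemma cylfun_tail (A : Type) K (F : X -> A) : cylfun K F ->
  exists2 g : (nat -> bool) -> A, depends K g & forall n, F (iter n T x0) = g (tail xi n).
Proof.
move=> FK.
(* A prefix occurring at no point of the orbit closure gets the default [x0]; along the orbit this
   never happens. *)
exists (fun y => F (xget x0 [set w : X | forall i, (i < K)%N -> val w i = y i])).
  move=> x y xy; congr (F (xget _ _)); apply/seteqP.
  by split => w /= wx i iK; rewrite wx// xy.
move=> n; apply: FK => i iK; case: xgetP => [w -> /= -> //|/(_ (iter n T x0)) h].
  by rewrite val_iter_orbit_shift /tail addnC.
by exfalso; apply: h => j jK /=; rewrite val_iter_orbit_shift /tail addnC.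
Qed.

End cylinder_sets.

(** An alias of the orbit closure whose measurable structure is the algebra of cylinder sets, kept
    apart from the Borel structure to which the measure is extended. *)
Definition cylinder_space (xi : cantor_space) : Type := orbit_closure xi.

HB.instance Definition _ (xi : cantor_space) :=
  Pointed.copy (cylinder_space xi) (orbit_closure xi).

HB.instance Definition _ (xi : cantor_space) :=
  isAlgebraOfSets.Build default_measure_display (cylinder_space xi)
    (@cylset0 xi) (@cylsetU xi) (@cylsetC xi).

(** * Extension of cylinder frequencies to a Borel probability *)

Section orbit_measure.
Variables (R : realType) (xi : cantor_space) (s : nat).
Hypothesis mix : mixing_bits R s xi.
Let X := orbit_closure xi.
Let T : X -> X := @orbit_shift xi.
Let x0 : X := orbit_base xi.

Definition freq (F : orbit_closure xi -> R) : R :=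
  mean (fun n => F (iter n (@orbit_shift xi) (orbit_base xi))).

Lemma cylfun_freq K (F : X -> R) : cylfun K F ->
  has_mean (fun n => F (iter n T x0)) (freq F).
Proof.
move=> FK; have [g gK gF] := cylfun_tail FK; apply: meanP.
have [m gm] := mix.1 K g gK; exists m; apply: eq_has_mean gm => n.
by rewrite gF.
Qed.

Lemma freqE (F : X -> R) m : has_mean (fun n => F (iter n T x0)) m -> freq F = m.
Proof. by move=> Fm; exact: (has_mean_unique (meanP (ex_intro _ m Fm)) Fm). Qed.

Lemma cylset_indic A : cylset A -> exists K, cylfun K (\1_A : X -> R).
Proof.
move=> [K AK]; exists K => w w' ww'; rewrite !indicE; congr (_%:R); congr nat_of_bool.
by apply/idP/idP => /set_mem Aw; apply/mem_set; rewrite (AK w w') in Aw *.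
Qed.

Lemma cylset_freq A : cylset A -> has_mean (fun n => \1_A (iter n T x0)) (freq \1_A).
Proof. by move=> /cylset_indic[K /cylfun_freq]. Qed.

Lemma cylset_freq_ge0 A : cylset A -> 0 <= freq \1_A.
Proof.
move=> /cylset_freq fA; apply: (mean_bounded_avg_ge0 fA) => n.
by rewrite indicE; case: (_ \in _).
Qed.

(* The frequency need not be nonnegative outside the cylinder sets, where the mean
   may not exist and [freq] is arbitrary. *)
Definition cyl_freq (A : set (cylinder_space xi)) : \bar R := (Num.max 0 (freq \1_A))%:E.

Lemma cyl_freqE A : cylset A -> cyl_freq A = (freq \1_A)%:E.
Proof. by move=> cA; rewrite /cyl_freq max_r// cylset_freq_ge0. Qed.

Lemma cyl_freq0 : cyl_freq set0 = 0%E.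
Proof.
rewrite cyl_freqE ?(@freqE _ 0)//; last exact: cylset0.
by apply: (@eq_has_mean _ (fun=> 0)); [move=> n; rewrite indic0|exact: has_mean_cst].
Qed.

Lemma cyl_freq_ge0 A : (0 <= cyl_freq A)%E.
Proof. by rewrite lee_fin le_max lexx. Qed.

Lemma cyl_freq_semi_additive : measure_function.semi_additive cyl_freq.
Proof.
apply/(additive2P cyl_freq0) => A B cA cB AB0.
rewrite !cyl_freqE//; last exact: cylsetU.
rewrite -EFinD; congr EFin; apply: freqE.
apply: eq_has_mean (has_meanD (cylset_freq cA) (cylset_freq cB)) => n.
rewrite !indicE in_setU.
have : ~~ ((iter n T x0 \in A) && (iter n T x0 \in B)).
  apply/negP => /andP[/set_mem Ax /set_mem Bx].
  by have : set0 (iter n T x0) by rewrite -AB0.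
by case: (_ \in A); case: (_ \in B) => //= _; rewrite ?mulr1n ?mulr0n ?add0r ?addr0.
Qed.

HB.instance Definition _ := isContent.Build _ _ _ cyl_freq
  cyl_freq_ge0 cyl_freq_semi_additive.

(** Cylinder sets are compact and open, so countable covers reduce to finite ones. Finite additivity
    of the frequencies therefore already yields sigma-subadditivity. *)
Lemma cylset_compact A (F : nat -> set X) : cylset A -> (forall n, cylset (F n)) ->
  A `<=` \bigcup_n F n -> exists N, A `<=` \big[setU/set0]_(n < N) F n.
Proof.
move=> [K AK] cF AF; apply: contrapT => h.
have nh N : exists w : X, A w /\ forall n, (n < N)%N -> ~ F n w.
  apply: contrapT => h'; apply: h; exists N => w Aw; apply: contrapT => nw.
  apply: h'; exists w; split=> // n nN Fw; apply: nw.
  by rewrite -bigcup_mkord; exists n.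
have [u uP] := choice nh.
have [w wP] := orbit_cluster u.
have Aw : A w.
  by have [N _ wN] := wP K 0%N; have [AuN _] := uP N; rewrite (AK _ _ wN).
have [m _ Fmw] := AF w Aw; have [L FL] := cF m.
have [N mN wN] := wP L m.+1; have [_ /(_ m mN)] := uP N; apply.
by rewrite -(FL _ _ wN).
Qed.

Lemma cyl_freq_sigma_subadditive : measurable_subset_sigma_subadditive cyl_freq.
Proof.
move=> A F cF cA AF.
have [N AN] := cylset_compact cA cF AF.
have h := @content_subadditive _ _ _ cyl_freq A F N (fun n _ => cF n) cA AN.
apply: (le_trans h).
rewrite -(big_mkord xpredT (fun k => cyl_freq (F k))).
by apply: nneseries_lim_ge => n _ _; exact: cyl_freq_ge0.
Qed.

HB.instance Definition _ := Content_SigmaSubAdditive_isMeasure.Build _ _ _ cyl_freq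
  cyl_freq_sigma_subadditive.

Definition orbit_measure (A : set (borel (orbit_closure xi))) : \bar R :=
  measure_extension cyl_freq A.

Let om0 : orbit_measure set0 = 0%E.
Proof. exact: (measure0 (measure_extension cyl_freq)). Qed.

Let om_ge0 A : (0 <= orbit_measure A)%E.
Proof. exact: (measure_ge0 (measure_extension cyl_freq)). Qed.

Let om_sigma : semi_sigma_additive orbit_measure.
Proof.
move=> F mF tF mUF.
have mE A : @measurable _ (borel (orbit_closure xi)) A -> <<s @cylset xi >> A.
  by rewrite sigma_cylset.
apply: (@measure_semi_sigma_additive _ _ _ (measure_extension cyl_freq)) => //.
  by move=> n; exact: mE.
exact: mE.
Qed.

HB.instance Definition _ := isMeasure.Build _ _ _ orbit_measure om0 om_ge0 om_sigma.

Lemma orbit_measureE A : cylset A -> orbit_measure A = (freq \1_A)%:E.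
Proof.
by move=> cA; rewrite /orbit_measure /measure_extension /= measurable_mu_extE//= cyl_freqE.
Qed.

Lemma orbit_measure_setT : orbit_measure setT = 1%E.
Proof.
rewrite orbit_measureE; last exact: cylsetT.
congr EFin; apply: freqE; apply: (@eq_has_mean _ (fun=> 1)); last exact: has_mean_cst.
by move=> n; rewrite indicT.
Qed.

HB.instance Definition _ := Measure_isProbability.Build _ _ _ orbit_measure orbit_measure_setT.

End orbit_measure.

(** * Invariance, weak mixing and genericity of the orbit measure *)

Section orbit_system.
Variables (R : realType) (xi : cantor_space) (s : nat).
Hypothesis mix : mixing_bits R s xi.
Let X := orbit_closure xi.
Let T : X -> X := @orbit_shift xi.
Let x0 : X := orbit_base xi.
Let nu : probability (borel (orbit_closure xi)) R := orbit_measure mix.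

Let mT : measurable_fun setT (T : borel X -> borel X).
Proof. exact: (continuous_borel_measurable_self (@orbit_shift_continuous xi)). Qed.

Let mG : @measurable _ (borel (orbit_closure xi)) = <<s @cylset xi >>.
Proof. by rewrite sigma_cylset. Qed.

Let nuE A : cylset A -> nu A = (freq \1_A)%:E.
Proof. exact: orbit_measureE. Qed.

Let cyl_measurable A : cylset A -> @measurable _ (borel (orbit_closure xi)) A.
Proof. by move=> cA; rewrite mG; exact: sub_sigma_algebra. Qed.

Lemma orbit_shift_preserving : measure_preserving nu (T : borel X -> borel X).
Proof.
move=> B mB; have := @restricted_image_measure_unique _ _ _ _ _ nu nu
  (T : borel X -> borel X) setT 1 (@cylset xi) mT measurableT _ ler01 mG
  (@cylsetI xi) (@cylsetT xi) _ B mB.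
have nuT : nu setT = 1%E by exact: orbit_measure_setT.
rewrite setIT mul1e; apply => [|D cD].
  exact: (eq_ind_r (fun z => (z < +oo)%E) (ltry _) nuT).
rewrite setIT mul1e; apply: (etrans (nuE _) (etrans _ (esym (nuE cD)))).
  by have [K DK] := cD; exists (K + 1)%N; exact: (cylfun_iter_shift (n := 1) DK).
congr EFin; apply: freqE.
have b n : `|\1_D (iter n T x0)| <= 1 :> R.
  by rewrite indicE; case: (_ \in _); rewrite /= ?normr1 ?normr0.
have := @has_mean_shift _ _ _ 1 1 b (cylset_freq mix cD).
by apply: eq_has_mean => n; rewrite addn1.
Qed.

Lemma orbit_shift_mixing A : cylset A -> exists N, forall n, (N <= n)%N ->
  forall D, cylset D -> nu (A `&` iter n T @^-1` D) = (nu A * nu D)%E.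
Proof.
move=> cA; have [K AK] := cylset_indic R cA; exists (K + s)%N => n Kn D cD.
have cDn : cylset (iter n T @^-1` D).
  by have [L DL] := cD; exists (L + n)%N; exact: (cylfun_iter_shift DL).
rewrite !nuE//; last exact: cylsetI.
rewrite -EFinM; congr EFin; apply: freqE.
have [L DL] := cylset_indic R cD.
(* [A] is viewed as a window of length [n - s], so that window and gap add up to exactly [n]. *)
have {}AK : cylfun (n - s) (\1_A : X -> R) by apply: cylfunW AK; rewrite leq_subRL; lia.
have [g gK gA] := cylfun_tail AK; have [h hL hD] := cylfun_tail DL.
have gm : has_mean (fun n => g (tail xi n)) (freq \1_A).
  by apply: eq_has_mean (cylset_freq mix cA) => m; rewrite gA.
have hm : has_mean (fun n => h (tail xi n)) (freq \1_D).
  by apply: eq_has_mean (cylset_freq mix cD) => m; rewrite hD.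
have := mix.2 _ _ g h _ _ gK hL gm hm; apply: eq_has_mean => m.
rewrite -gA -hD subnK; last by apply: leq_trans Kn; exact: leq_addl.
rewrite indicI /= [(m + n)%N]addnC iterD.
by rewrite !indicE.
Qed.

Lemma orbit_shift_weakly_mixing : weakly_mixing nu (T : borel X -> borel X).
Proof.
exact: (@mixing_weakly_mixing _ _ _ nu _ (@cylset xi) mT mG (@cylsetI xi) (@cylsetT xi)
  orbit_shift_mixing).
Qed.

Lemma cylfun_indic_sum K (F : X -> R) : cylfun K F ->
  exists c : {ffun 'I_K -> bool} -> R, forall w,
    F w = \sum_(v : {ffun 'I_K -> bool}) c v * \1_[set w : X | forall i : 'I_K, val w i = v i] w.
Proof.
move=> FK; pose word (v : {ffun 'I_K -> bool}) := [set w : X | forall i : 'I_K, val w i = v i].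
exists (fun v => F (xget x0 (word v))) => w.
pose vw : {ffun 'I_K -> bool} := [ffun i : 'I_K => val w (val i)].
rewrite (bigD1 vw)//= big1 ?addr0; last first.
  move=> v vvw; rewrite indicE; case: (boolP (w \in _)); last by rewrite mulr0.
  move=> /set_mem wv; case/negP: vvw; apply/eqP/ffunP => i.
  by rewrite /vw ffunE; exact: esym (wv i).
have wvw : word vw w by move=> i; rewrite /vw ffunE.
rewrite indicE mem_set// mulr1; apply: FK => i iK.
case: xgetP => [y -> /(_ (Ordinal iK))|/(_ w)//].
by rewrite /= ffunE.
Qed.

Lemma cylfun_integral K (F : X -> R) : cylfun K F -> \int[nu]_x F x = freq F /\
  bmfun (F : borel X -> R).
Proof.
move=> FK; have [c Fc] := cylfun_indic_sum FK.
pose word (v : {ffun 'I_K -> bool}) := [set w : X | forall i : 'I_K, val w i = v i].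
have cword v : cylset (word v).
  exists K => w w' ww'; apply/propext; split => h i; first by rewrite -ww'.
  by rewrite ww'.
have b1 v : bmfun (\1_(word v) : borel X -> R).
  split; first by apply: measurable_indic; exact: cyl_measurable.
  by exists 1 => x; rewrite indicE; case: (_ \in _); rewrite /= ?normr1 ?normr0.
have bZ v : bmfun (fun x : borel X => c v * \1_(word v) x) by exact: bmfunZ.
have nuT : nu setT = 1%E by exact: orbit_measure_setT.
have FE : F = (fun w => \sum_v c v * \1_(word v) w) by apply/funext.
split; last by rewrite FE; exact: bmfun_sum.
have -> : freq F = \sum_v c v * freq \1_(word v).
  apply: freqE; rewrite FE; apply: has_mean_sum => v _.
  exact: (@has_meanZ R (c v) _ _ (cylset_freq mix (cword v))).
rewrite FE (Rintegral_sum nuT)//; apply: eq_bigr => v _.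
rewrite RintegralZl//; last exact: (bmfun_integrable nuT).
congr (_ * _); rewrite /Rintegral integral_indic//; last exact: cyl_measurable.
rewrite setIT; exact: (f_equal fine (nuE (cword v))).
Qed.

(** Uniform continuity by compactness: pairs agreeing on ever longer prefixes with values more than
    [e] apart would cluster at a discontinuity. [F] evaluates [f] at a chosen representative of each
    cylinder. *)
Lemma continuous_cylfun_approx (f : X -> R) (e : R) : continuous f -> 0 < e ->
  exists K (F : X -> R), cylfun K F /\ forall w, `|f w - F w| <= e.
Proof.
move=> cf e0.
have [K KP] : exists K, forall w w', agree K w w' -> `|f w - f w'| <= e.
  apply: contrapT => h.
  have nK K : exists ww : X * X, agree K ww.1 ww.2 /\ ~ `|f ww.1 - f ww.2| <= e.
    apply: contrapT => h'; apply: h; exists K => w w' ww'; apply: contrapT => nf.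
    by apply: h'; exists (w, w').
  have [u uP] := choice nK.
  have [w wP] := orbit_cluster (fun n => (u n).1).
  have e2 : 0 < e / 2 by rewrite divr_gt0.
  have : nbhs w [set w' | `|f w - f w'| < e / 2].
    by have /cvgrPdist_lt := cf w; apply.
  move=> /orbit_nbhs_prefix [K KP]; have [N KN wN] := wP K K.
  have [uN nuN] := uP N; apply: nuN.
  have h1 : `|f w - f (u N).1| < e / 2 := KP _ wN.
  have h2 : `|f w - f (u N).2| < e / 2.
    by apply: KP => i iK; rewrite wN// uN// (leq_trans iK).
  rewrite (_ : _ - _ = (f w - f (u N).2) - (f w - f (u N).1)); last by ring.
  by rewrite [e]splitr; apply: le_trans (ler_normB _ _) (lerD (ltW h2) (ltW h1)).
exists K, (fun w => f (xget x0 [set w' | agree K w w'])); split.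
  move=> w w' ww'; congr (f (xget _ _)); apply/seteqP; split => v /= wv i iK.
    by rewrite -ww'// wv.
  by rewrite ww'// wv.
move=> w; apply: KP; case: xgetP => [v -> //|/(_ w) h].
by exfalso; apply: h.
Qed.

(** The measure is defined by frequencies along this very orbit, which settles cylinder functions;
    continuous functions are uniform limits of these. *)
Lemma orbit_generic : generic nu (T : X -> X) x0.
Proof.
move=> f cf; apply/cvgrPdist_le => e e0.
have e3 : 0 < e / 3 by rewrite divr_gt0.
have [K [F [FK fF]]] := continuous_cylfun_approx cf e3.
have [iF bF] := cylfun_integral FK.
have /cvgrPdist_le /(_ _ e3) hF : has_mean (fun n => F (iter n T x0)) (freq F).
  exact: (cylfun_freq mix FK).
have nuT : nu setT = 1%E by exact: orbit_measure_setT.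
have bf : bmfun (f : borel X -> R).
  split; first exact: continuous_borel_measurable.
  have [C FC] := bF.2; exists (C + e / 3) => x.
  rewrite -[f x](subrK (F x)) addrC; apply: le_trans (ler_normD _ _) (lerD (FC x) (fF x)).
have ifF : `|\int[nu]_x f x - freq F| <= e / 3.
  rewrite -iF -RintegralB//; [|exact: (bmfun_integrable nuT)..].
  have bB := bmfunB bf bF.
  apply: le_trans (le_normr_Rintegral _ _) _ => //; first exact: (bmfun_integrable nuT).
  rewrite -[leRHS](Rintegral_cst1 nuT); apply: le_Rintegral => //.
    by apply: (bmfun_integrable nuT); exact: bmfun_norm.
  by apply: (bmfun_integrable nuT); exact: bmfun_cst.
near=> N.
have hN : `|freq F - avg (fun n => F (iter n T x0)) N| <= e / 3 by near: N.
have aN : `|avg (fun n => F (iter n T x0)) N - avg (fun n => f (iter n T x0)) N| <= e / 3.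
  rewrite -avgB; apply: avg_bound; first exact: ltW.
  by move=> n; rewrite distrC.
have -> : e = e / 3 + e / 3 + e / 3 by field.
rewrite -[X in `|X|](subrKA (avg (fun n => F (iter n T x0)) N)).
apply: le_trans (ler_normD _ _) (lerD _ aN).
rewrite -[X in `|X|](subrKA (freq F)).
exact: le_trans (ler_normD _ _) (lerD ifF hN).
Unshelve. all: by end_near. Qed.

End orbit_system.

Theorem WM_set_of_mixing (R : realType) (A : set nat) (s : nat) (d : R) :
  A `<=` [set n | (0 < n)%N] -> mixing_bits R s (char_seq A) ->
  has_mean \1_A d -> 0 < d -> WM_set R A.
Proof.
move=> A0 mix Ad d0; split => //; last by exists d => //; exact: has_mean_density.
exists (orbit_measure mix); split.
- exact: orbit_shift_preserving.
- exact: orbit_shift_weakly_mixing.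
- exact: orbit_generic.
Qed.

(** * Structure of affine subspaces meeting every WM set *)

Lemma exists_nat_notin (F : numDomainType) (s : seq F) : exists n : nat, n%:R \notin s.
Proof.
suff [N NP] : exists N, forall n : nat, (N <= n)%N -> n%:R \notin s by exists N; exact: NP.
elim: s => [|x s [N NP]]; first by exists 0%N.
have [[m mx]|nx] := pselect (exists m : nat, m%:R = x).
  exists (maxn N m.+1) => n; rewrite geq_max => /andP[Nn mn].
  by rewrite inE negb_or NP// andbT -mx eqr_nat neq_ltn mn orbT.
exists N => n Nn; rewrite inE negb_or NP// andbT.
by apply/eqP => nE; apply: nx; exists n.
Qed.

(** In [n v + u] each form vanishes for at most one [n], unless it vanishes at [v], where the value
    at [u] decides; some natural [n] avoids all the bad values. *)
Lemma common_nonvanishing (F : numFieldType) (V : lmodType F) (S : set V) (I : eqType)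
    (l : I -> {linear V -> F^o}) (L : seq I) :
  (forall (c : F) u v, S u -> S v -> S (c *: u + v)) -> S 0 ->
  (forall i, i \in L -> exists2 u, S u & l i u != 0) ->
  exists2 u, S u & forall i, i \in L -> l i u != 0.
Proof.
move=> SD S0; elim: L => [|i L IH] lS; first by exists 0.
have [j jL|u Su lu] := IH; first by apply: lS; rewrite inE jL orbT.
have [v Sv lv] := lS i (mem_head _ _).
have [n] := exists_nat_notin [seq - l j u / l j v | j <- i :: L].
move=> /mapP nP; exists (n%:R *: v + u); first exact: SD.
move=> j jL; rewrite linearD linearZ /=; apply/eqP => h.
have [ljv|ljv] := eqVneq (l j v) 0.
  move: h; rewrite ljv scaler0 add0r => h.
  move: jL; rewrite inE => /predU1P[ji|/lu]; last by rewrite h eqxx.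
  by rewrite -ji ljv eqxx in lv.
by apply: nP; exists j => //; move/eqP: h; rewrite addr_eq0 => /eqP <-; rewrite mulfK.
Qed.

Lemma clear_denominators (k : nat) (x : 'cV[rat]_k) : (forall i, 0 < x i ord0) ->
  exists2 D : nat, (0 < D)%N &
  exists2 a : 'cV[nat]_k, forall i, (0 < a i ord0)%N &
    map_mx (fun z : nat => z%:R) a = D%:R *: x.
Proof.
move=> x0; exists (\prod_i `|denq (x i ord0)|)%N.
  by rewrite prodn_gt0// => i; rewrite absz_gt0 denq_neq0.
exists (\col_i (`|numq (x i ord0)| * \prod_(j | j != i) `|denq (x j ord0)|)%N) => [i|].
  rewrite mxE muln_gt0 absz_gt0 numq_eq0 gt_eqF//=.
  by rewrite prodn_gt0// => j; rewrite absz_gt0 denq_neq0.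
apply/matrixP => i j; rewrite !mxE (ord1 j) [in RHS](bigD1 i)//= natrM [in RHS]natrM.
rewrite [RHS]mulrAC; congr (_ * _).
rewrite !pmulrn gez0_abs ?numq_ge0 ?ltW// gez0_abs//.
rewrite -[x i 0]/(x i ord0); move: (x i ord0) => q.
by rewrite mulrC -[X in X * _]divq_num_den divfK// intr_eq0 denq_neq0.
Qed.

Lemma exists_nat_multiple_pos (k : nat) (x y : 'cV[rat]_k) :
  (forall i, 0 < x i ord0) -> exists N : nat, forall i, 0 < (N%:R *: x + y) i ord0.
Proof.
move=> x0; exists (\max_i Num.bound (`|y i ord0| / x i ord0))%N => i; rewrite !mxE.
rewrite -ltrBlDr sub0r -ltr_pdivrMr//.
apply: (@le_lt_trans _ _ (`|y i ord0| / x i ord0)).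
  by rewrite ler_pM2r ?invr_gt0// -normrN ler_norm.
apply: (@lt_le_trans _ _ (Num.bound (`|y i ord0| / x i ord0))%:R).
  by apply: archi_boundP; rewrite divr_ge0// ltW.
by rewrite ler_nat (leq_bigmax i).
Qed.

Section necessity.
Variables (k : nat) (AA : set 'cV[rat]_k) (p : 'cV[rat]_k) (U : {vspace 'cV[rat]_k}).
Hypothesis AAE : AA = [set p + u | u in [set` U]].

Definition equalities (E : {set 'I_k * 'I_k}) : set 'cV[rat]_k :=
  [set y | forall ij, ij \in E -> y ij.1 ord0 = y ij.2 ord0].

(** The default 0 is taken when [AA] has no point satisfying [E], which cannot occur when [E] is
    read off a solution. *)
Definition base_point E := xget (0 : 'cV[rat]_k) (AA `&` equalities E).

(** Only slopes [q > 0] matter: they will arise as ratios of coordinates of a positive direction. *)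
Definition affine_relation E i j : set (rat * rat) :=
  [set r | [/\ 0 < r.1, r != (1, 0) &
     forall y, AA y -> equalities E y -> y j ord0 = r.1 * y i ord0 + r.2]].

(** One relation for each [E], [i], [j] is enough: a solution violating the chosen one shows that
    none is forced. The default [(2, 0)] also has [q > 0] and differs from [(1, 0)], so it may be
    avoided along with the rest. *)
Definition forced_relations : seq (rat * rat) :=
  [seq xget (2, 0) (affine_relation t.1 t.2.1 t.2.2)
     | t <- enum {: {set 'I_k * 'I_k} * ('I_k * 'I_k)}].

Definition base_bound : nat := (\max_E \max_i Num.bound `|base_point E i ord0|)%N.

Lemma forced_relationsP r : r \in forced_relations -> 0 < r.1 /\ r != (1, 0).
Proof.
move=> /mapP[t _ ->]; case: xgetP => [{}r _ []|] //.
Qed.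

Lemma affine_relation_forced E i j : affine_relation E i j !=set0 ->
  exists2 r, r \in forced_relations & affine_relation E i j r.
Proof.
move=> ne; exists (xget (2, 0) (affine_relation E i j)); last exact: xgetPex.
by apply/mapP; exists (E, (i, j)); rewrite ?mem_enum.
Qed.

Lemma base_point_lt E i n : (base_bound < n)%N -> base_point E i ord0 < n%:R.
Proof.
move=> Cn; apply: le_lt_trans (ler_norm _) _.
apply: (@lt_trans _ _ (Num.bound `|base_point E i ord0|)%:R); first exact: archi_boundP.
rewrite ltr_nat; apply: leq_ltn_trans Cn; apply: leq_trans (leq_bigmax E).
exact: (leq_bigmax i).
Qed.

Lemma avoiding_solution_structure (A : set nat) :
  A `<=` [set n | (base_bound < n)%N] ->
  (forall r (x y : nat), r \in forced_relations -> A x -> A y ->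
     y%:R != r.1 * x%:R + r.2) ->
  AA `&` cartesian_power k A !=set0 ->
  exists (a b : 'cV[nat]_k) (f : 'cV[int]_k),
     [/\ forall i, (0 < a i ord0)%N /\ (0 < b i ord0)%N,
         two_parameter_set a b f `<=` AA &
         exists P : {set {set 'I_k}},
           [/\ finset.partition P [set: 'I_k]%SET,
               directions_compatible a b P &
               translation_compatible f P]].
Proof.
move=> AC Arel [x [AAx Ax]].
have /choice[n nP] : forall i, exists m : nat, A m /\ x i ord0 = m%:R.
  by move=> i; have [m Am xm] := Ax i; exists m.
have An i : A (n i) by have [] := nP i.
have xn i : x i ord0 = (n i)%:R by have [_] := nP i.
pose E : {set 'I_k * 'I_k} := [set ij | x ij.1 ord0 == x ij.2 ord0]%SET.
have Ex : equalities E x by move=> ij; rewrite inE => /eqP.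
pose q := base_point E.
have [AAq Eq] : (AA `&` equalities E) q by apply: (@xgetPex _ 0); exists x.
pose D : set 'cV[rat]_k := [set u | u \in U /\ equalities E u].
have D_lin c u v : D u -> D v -> D (c *: u + v).
  move=> [Uu Eu] [Uv Ev]; split; first by rewrite memvD// memvZ.
  by move=> ij ijE; rewrite !mxE Eu// Ev.
have D_sub y z : AA y -> equalities E y -> AA z -> equalities E z -> D (y - z).
  rewrite AAE => -[u Uu <-] Ey [v Uv <-] Ez; split.
    by rewrite opprD addrACA subrr add0r memvB.
  by move=> ij ijE; rewrite !mxE; have := Ey _ ijE; have := Ez _ ijE; rewrite !mxE => -> ->.
have D0 : D 0 by rewrite -(subrr x); exact: D_sub.
pose a' := x - q.
have Da : D a' by exact: D_sub.
have a'0 i : 0 < a' i ord0.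
  by rewrite !mxE subr_gt0 [x _ _]xn; apply: base_point_lt; exact: AC.
(* The minors of order two of the pair [a'], [u]. *)
pose l (ij : 'I_k * 'I_k) (u : 'cV[rat]_k) : rat^o :=
  a' ij.1 ord0 * u ij.2 ord0 - a' ij.2 ord0 * u ij.1 ord0.
have l_lin ij : linear (l ij).
  by move=> c u v; rewrite /l !mxE; rewrite /GRing.scale/=; ring.
pose lL ij : {linear 'cV[rat]_k -> rat^o} :=
  HB.pack (l ij) (GRing.isLinear.Build _ _ _ _ _ (l_lin ij)).
have [|u Du lu] := @common_nonvanishing _ _ D _ lL (enum (~: E)%SET) D_lin D0.
  move=> [i j]; rewrite mem_enum !inE /= => xij.
  apply: contrapT => nu.
  have lu0 u : D u -> a' i ord0 * u j ord0 = a' j ord0 * u i ord0.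
    move=> Du; apply/eqP; rewrite -subr_eq0; apply: contrapT => /negP h.
    by apply: nu; exists u.
  (* Were the minor zero on all of [D], the coordinates [i] and [j] would be proportional there with
     ratio [c > 0]. This forces an affine relation, other than [(1, 0)] because [x] differs at [i]
     and [j]; the listed one for [E], [i], [j] then holds between two elements of [A]. *)
  pose c := a' j ord0 / a' i ord0.
  have [|r rF [_ _ /(_ x AAx Ex)]] := @affine_relation_forced E i j.
    exists (c, x j ord0 - c * x i ord0); split.
    - by rewrite divr_gt0.
    - apply: contra xij => /eqP[-> /eqP].
      by rewrite mul1r subr_eq0 eq_sym.
    - move=> y AAy Ey /=; have := lu0 _ (D_sub _ _ AAy Ey AAx Ex).
      rewrite [(y - x) j _]mxE [(y - x) i _]mxE ![(- x) _ _]mxE => h.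
      have a0 := lt0r_neq0 (a'0 i); apply: (mulfI a0).
      rewrite /c; move: h a0; move: (a' i ord0) (a' j ord0) => ai aj h a0.
      have -> : ai * y j ord0 = ai * x j ord0 + aj * (y i ord0 - x i ord0).
        by rewrite -h; ring.
      by field.
  by rewrite !xn => /eqP; apply/negP; exact: Arel.
(* Adding a multiple of [a'] makes the second direction positive and leaves its minors with [a']
   unchanged. *)
have [N Npos] := exists_nat_multiple_pos u a'0.
pose b' := N%:R *: a' + u.
have Db : D b' by exact: D_lin.
have lb i j : x i ord0 != x j ord0 -> a' i ord0 * b' j ord0 - a' j ord0 * b' i ord0 != 0.
  move=> xij; have := lu (i, j); rewrite mem_enum !inE /= => /(_ xij).
  rewrite /l/=; congr (_ != _); rewrite /b' !mxE.
  ring.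
have [Ka Ka0 [a a0 aE]] := clear_denominators a'0.
have [Kb Kb0 [b b0 bE]] := clear_denominators Npos.
(* The translation vector is the solution [x] itself, which is integral; clearing denominators
   rescales only the directions. *)
exists a, b, (\col_i (n i)%:Z); split => //.
  move=> _ [s [t [_ _ ->]]]; rewrite aE bE.
  have -> : map_mx intr (\col_i (n i)%:Z) = x.
    by apply/matrixP => i j; rewrite !mxE (ord1 j) [x i 0]xn.
  move: AAx; rewrite AAE => -[v Uv <-].
  exists (s%:R *: (Ka%:R *: a') + t%:R *: (Kb%:R *: b') + v); last by rewrite addrCA.
  by rewrite /= !memvD ?memvZ//; [case: Da | case: Db].
pose P := finset.preim_partition (fun i => x i ord0) [set: 'I_k]%SET.
have PP F : F \in P -> exists i, F = [set j | x i ord0 == x j ord0]%SET.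
  by move=> /finset.imsetP[i _ ->]; exists i; apply/finset.setP => j; rewrite !inE.
have eqD w i j : D w -> x i ord0 = x j ord0 -> w j ord0 = w i ord0.
  by move=> [_ Ew] xij; apply: (Ew (j, i)); rewrite inE /= xij.
have aEi i : (a i ord0)%:R = Ka%:R * a' i ord0 :> rat.
  by have /matrixP/(_ i ord0) := aE; rewrite !mxE.
have bEi i : (b i ord0)%:R = Kb%:R * b' i ord0 :> rat.
  by have /matrixP/(_ i ord0) := bE; rewrite [LHS]mxE [RHS]mxE.
exists P; split.
- exact: finset.preim_partitionP.
- move=> F /PP[i ->]; exists (a i ord0), (b i ord0); split => // j; rewrite inE.
    move=> /eqP xij; split; apply/eqP; rewrite -(eqr_nat rat).
      by rewrite !aEi (eqD a' i j).
    by rewrite !bEi (eqD b' i j).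
  rewrite eq_sym => xij; rewrite det_mx22 -(intr_eq0 rat) rmorphB !rmorphM/=.
  rewrite -!pmulrn !aEi !bEi.
  have -> (z t : rat) : Ka%:R * a' j ord0 * (Kb%:R * z) - Kb%:R * t * (Ka%:R * a' i ord0) =
      Ka%:R * Kb%:R * (a' j ord0 * z - a' i ord0 * t) by ring.
  by rewrite !mulf_neq0 ?pnatr_eq0 -?lt0n// lb.
- move=> F /PP[i ->]; exists (n i)%:Z => j; rewrite inE => /eqP xij.
  by rewrite mxE; congr Posz; apply/eqP; rewrite -(eqr_nat rat) -!xn xij.
Qed.
End necessity.

Theorem theorem1p3p1 (R : realType) (k : nat) (hk : (0 < k)%N)
    (AA : set 'cV[rat]_k) (hAA : affine_subspace AA) :
  (forall A : set nat, WM_set R A -> AA `&` cartesian_power k A !=set0) <->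
  (exists (a b : 'cV[nat]_k) (f : 'cV[int]_k),
     [/\ forall i, (0 < a i ord0)%N /\ (0 < b i ord0)%N,
         two_parameter_set a b f `<=` AA &
         exists P : {set {set 'I_k}},
           [/\ finset.partition P [set: 'I_k]%SET,
               directions_compatible a b P &
               translation_compatible f P]]).
Proof.
split=> [hit|[a [b [f [_ abf [P [PP dirP transP]]]]]] S wmS]; last first.
  by have [x [/abf AAx Sx]] := WM_set_solvable PP dirP transP wmS; exists x.
have [p [U AAE]] := hAA.
have [A [AC Arel [s mixA] [d Ad d0]]] :=
  exists_mixing_set_avoiding R (base_bound AA) (@forced_relationsP k AA).
apply: (avoiding_solution_structure AAE AC Arel); apply: hit.
by apply: (WM_set_of_mixing _ mixA Ad d0) => n /AC/=; exact: leq_ltn_trans.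
Qed.
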